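(* Assume the standing assumptions (A) on the real-valued functions $p,Q,r,s$ hold, and in addition: (i) $p\in W^1_{2,loc}(\mathbb{R})$ and $p(x)>0$ for all $x\in\mathbb{R}$; (ii) $\displaystyle\int_{-\infty}^{0}p^{-1/2}(t)\,dt=\int_{0}^{\infty}p^{-1/2}(t)\,dt=\infty$. If the preminimal operator $\mathrm{L}_{00}$ is bounded from below in $L^2(\mathbb{R})$ (i.e. there is $\gamma\in\mathbb{R}$ with $(\mathrm{L}_{00}u,u)_{L^2(\mathbb{R})}\ge\gamma\|u\|^2_{L^2(\mathbb{R})}$ for all $u\in\mathrm{Dom}(\mathrm{L}_{00})$), then $\mathrm{L}_{00}$ is essentially self-adjoint and $\mathrm{L}_{00}^*=\mathrm{L}=\mathrm{L}^*$.
   Context: Standing assumptions (A): $p,Q,r,s:\mathbb{R}\to\mathbb{R}$ are real-valued measurable functions with $\frac{1}{\sqrt{|p|}},\frac{Q}{\sqrt{|p|}},\frac{r}{\sqrt{|p|}}\in L^2_{loc}(\mathbb{R})$, $s\in L^1_{loc}(\mathbb{R})$, $\frac1p\neq0$ a.e.; set $q=Q'+s$ (derivative in the sense of distributions). These data define the formal expression $l[u]=-(pu')'+qu+i((ru)'+ru')$, interpreted quasi-differentially via the quasi-derivatives $u^{[0]}:=u$, $u^{[1]}:=pu'-(Q+ir)u$, $u^{[2]}:=(u^{[1]})'+\frac{Q-ir}{p}u^{[1]}+\left(\frac{Q^2+r^2}{p}-s\right)u$, and $l[u]:=-u^{[2]}$ for $u$ with $u,u^{[1]}\in\mathrm{AC}_{loc}(\mathbb{R})$.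 The maximal operator $\mathrm{L}$ in $L^2(\mathbb{R})$: $\mathrm{L}u:=l[u]$, $\mathrm{Dom}(\mathrm{L}):=\{u\in L^2(\mathbb{R}): u,u^{[1]}\in\mathrm{AC}_{loc}(\mathbb{R}),\ l[u]\in L^2(\mathbb{R})\}$. The preminimal operator $\mathrm{L}_{00}$ is the restriction of $\mathrm{L}$ to $\{u\in\mathrm{Dom}(\mathrm{L}):\mathrm{supp}\,u\text{ compact}\}$. The minimal operator $\mathrm{L}_0$ is the closure of $\mathrm{L}_{00}$. *)

(* Defs.v *)
(* MathComp-Analysis over an abstract R : realType,
   complex numbers R[i] from mathcomp-real-closed. *)
From HB Require Import structures.
From mathcomp Require Import all_boot all_order all_algebra.
From mathcomp Require Import all_classical all_reals all_analysis.
From mathcomp Require Import complex.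
Set Implicit Arguments. Unset Strict Implicit. Unset Printing Implicit Defensive.
Import Order.TTheory GRing.Theory Num.Theory.
Import numFieldNormedType.Exports.
Local Open Scope classical_set_scope.
Local Open Scope ring_scope.
Local Open Scope complex_scope.

Section Defs.
Context {R : realType}.
Local Notation mu := (@lebesgue_measure R).
Local Notation C := (R[i]).
Local Notation cRe := (@complex.Re R).
Local Notation cIm := (@complex.Im R).

(* f in L^2_loc(R) (real valued) *)
Definition L2loc (f : R -> R) : Prop :=
  measurable_fun setT f /\ locally_integrable setT (fun x => f x ^+ 2).

(* classical absolute continuity on [a,b] (epsilon-delta, finite families of
   non-overlapping subintervals) *)
Definition AC_on (a b : R) (f : R -> R) : Prop :=
  forall e : R, 0 < e -> exists2 d : R, 0 < d &
    forall (n : nat) (x y : 'I_n -> R),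
      (forall i, a <= x i /\ x i <= y i /\ y i <= b) ->
      (forall i j, i != j -> y i <= x j \/ y j <= x i) ->
      \sum_(i < n) (y i - x i) < d ->
      \sum_(i < n) `|f (y i) - f (x i)| < e.

(* AC_loc(R) for real-valued functions *)
Definition ACloc (f : R -> R) : Prop := forall a b : R, a <= b -> AC_on a b f.

(* AC_loc(R) for complex-valued functions: real and imaginary parts *)
Definition cACloc (u : R -> C) : Prop :=
  ACloc (fun x => cRe (u x)) /\ ACloc (fun x => cIm (u x)).

(* the (a.e. existing) derivative of a complex-valued function *)
Definition cder (u : R -> C) (x : R) : C :=
  @Complex R (derive1 (fun t => cRe (u t)) x) (derive1 (fun t => cIm (u t)) x).

Definition csq (z : C) : R := cRe z ^+ 2 + cIm z ^+ 2.

(* u in L^2(R) *)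
Definition cL2 (u : R -> C) : Prop :=
  measurable_fun setT (fun x => cRe (u x)) /\
  measurable_fun setT (fun x => cIm (u x)) /\
  mu.-integrable setT (fun x => (csq (u x))%:E).

(* squared L^2 norm *)
Definition norm2 (u : R -> C) : R := \int[mu]_(x in setT) csq (u x).

(* L^2 inner product (u, v) = int u * conj v *)
Definition inner (u v : R -> C) : C :=
  @Complex R (\int[mu]_(x in setT) cRe (u x * (v x)^*))
          (\int[mu]_(x in setT) cIm (u x * (v x)^*)).

(* operators in L^2(R) are represented by their graphs *)
Definition op := (R -> C) -> (R -> C) -> Prop.

(* equality of operators in L^2(R) (elements of L^2 are a.e.-classes) *)
Definition op_eq (T S : op) : Prop :=
  (forall u f, T u f -> exists u' f', S u' f' /\
      {ae mu, forall x, u x = u' x} /\ {ae mu, forall x, f x = f' x}) /\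
  (forall u f, S u f -> exists u' f', T u' f' /\
      {ae mu, forall x, u x = u' x} /\ {ae mu, forall x, f x = f' x}).

(* adjoint: (T g, u) = (g, T^* u) for all g in Dom T *)
Definition adjoint (T : op) : op := fun u f =>
  cL2 u /\ cL2 f /\ forall g h, T g h -> inner h u = inner g f.

(* closure: closure of the graph in L^2 x L^2 *)
Definition closure_op (T : op) : op := fun u f =>
  cL2 u /\ cL2 f /\ exists (un fn : nat -> R -> C),
    (forall n, T (un n) (fn n)) /\
    (fun n => norm2 (fun x => un n x - u x)) @ \oo --> (0 : R) /\
    (fun n => norm2 (fun x => fn n x - f x)) @ \oo --> (0 : R).

Definition self_adjoint (T : op) : Prop := op_eq T (adjoint T).
Definition ess_self_adjoint (T : op) : Prop := self_adjoint (closure_op T).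

(* first quasi-derivative: u^[1] = p u' - (Q + i r) u *)
Definition qd1 (p Q r : R -> R) (u : R -> C) (x : R) : C :=
  (p x)%:C * cder u x - @Complex R (Q x) (r x) * u x.

(* u^[2] computed from an (AC_loc) representative u1 of u^[1] *)
Definition qd2 (p Q r s : R -> R) (u u1 : R -> C) (x : R) : C :=
  cder u1 x + @Complex R (Q x) (- r x) / (p x)%:C * u1 x
  + ((Q x ^+ 2 + r x ^+ 2) / p x - s x)%:C * u x.

(* maximal operator L: u in Dom(L), L u = f = l[u] = - u^[2] *)
Definition Lmax (p Q r s : R -> R) : op := fun u f =>
  cL2 u /\ cL2 f /\ cACloc u /\
  exists u1 : R -> C, cACloc u1 /\
    {ae mu, forall x, u1 x = qd1 p Q r u x} /\
    {ae mu, forall x, f x = - qd2 p Q r s u u1 x}.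

(* preminimal operator L00: restriction of L to compactly supported u *)
Definition L00 (p Q r s : R -> R) : op := fun u f =>
  Lmax p Q r s u f /\
  exists a b : R, forall x, x < a \/ b < x -> u x = 0.

(* standing assumptions (A) *)
Definition standingA (p Q r s : R -> R) : Prop :=
  [/\ measurable_fun setT p, measurable_fun setT Q,
      measurable_fun setT r, measurable_fun setT s &
  [/\ L2loc (fun x => (Num.sqrt `|p x|)^-1),
      L2loc (fun x => Q x / Num.sqrt `|p x|),
      L2loc (fun x => r x / Num.sqrt `|p x|),
      locally_integrable setT s &
      {ae mu, forall x, (p x)^-1 != 0}]].

End Defs.

(* Main.v *)
(* For Lambda = gamma - 1 the adjoint equation L00^* u = Lambda u has only the
   trivial solution.  A solution of the adjoint equation is regular, i.e. lies
   in Dom L: locally one subtracts from it a solution of the quasi-differential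
   equation so that the difference is orthogonal to the range of L00, which
   contains everything orthogonal to the (finite dimensional) null space.  Then
   phi u is in Dom L00 for a suitable cutoff phi and, with L u = Lambda u,
     Re (L (phi u), phi u) = Lambda ||phi u||^2 + int p phi'^2 |u|^2,
   so semiboundedness yields ||phi u||^2 <= int p phi'^2 |u|^2.  Choosing phi as a
   function of K * tau, where tau' = p^{-1/2}, makes p phi'^2 = O(K^2); divergence
   of int p^{-1/2} at both ends makes phi compactly supported, and K -> 0 gives
   u = 0.  Hence (L00 - Lambda) has dense range; being bounded below by 1, it
   lets every (u, L u) be approximated by the graph of L00, so L is symmetric. *)
Require Import Defs.
From HB Require Import structures.
From mathcomp Require Import all_boot all_order all_algebra.
From mathcomp Require Import all_classical all_reals all_analysis.
From mathcomp Require Import finmap complex measurable_realfun ring lra.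
Import Order.TTheory GRing.Theory Num.Theory.
Import numFieldNormedType.Exports.
Set Implicit Arguments. Unset Strict Implicit. Unset Printing Implicit Defensive.
Local Open Scope classical_set_scope.
Local Open Scope ring_scope.

(** * Absolutely continuous functions are primitives *)

Section Variation.
Context {R : realType}.
Implicit Types (f : R -> R) (a b c x y : R) (s : seq (R * R)).

(** The domain of L is given by epsilon-delta absolute continuity and pointwise derivatives, while
    the coefficients 1/p, Q/p, r/p and (Q^2 + r^2)/p - s are only locally integrable. Everything is
    therefore moved to identities F y - F x = int_x^y g, which are stable under products, linear
    systems and extension by zero; l[u] = f becomes a real linear system for the real and imaginary
    parts of u and u^[1]. Only real parts of inner products are treated: L commutes with
    multiplication by i, and replacing u by i u recovers the imaginary parts. The assumptions on p
    enter through the cutoff. The function l[phi u] contains (p phi')' u and 2 phi' Q u, and both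
    must be square integrable. The first is controlled by p' in L^2_loc; the second by Q in L^2_loc,
    which follows from Q / sqrt p in L^2_loc and the continuity of p. Functions are never identified
    almost everywhere, so each Hilbert space argument works up to null vectors, and each equality of
    operators ends with the choice of a representative. *)

Definition nonoverlapping : rel (R * R) :=
  fun p q => (p.2 <= q.1) || (q.2 <= p.1).

(** A list replaces the ['I_n]-indexed families of [AC_on], so that partitions can be clipped,
    concatenated and flattened. It need not be sorted, and degenerate intervals are allowed. *)
Definition nov a b s :=
  all (fun p => [&& a <= p.1, p.1 <= p.2 & p.2 <= b]) s && pairwise nonoverlapping s.

Definition vsum f s := \sum_(p <- s) `|f p.2 - f p.1|.

Lemma vsum_nil f : vsum f [::] = 0. Proof. by rewrite /vsum big_nil. Qed.

Lemma vsum_cons f p s : vsum f (p :: s) = `|f p.2 - f p.1| + vsum f s.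
Proof. by rewrite /vsum big_cons. Qed.

Lemma vsum_cat f s t : vsum f (s ++ t) = vsum f s + vsum f t.
Proof. by rewrite /vsum big_cat. Qed.

Lemma nov_cons a b p s : nov a b (p :: s) =
  [&& [&& a <= p.1, p.1 <= p.2 & p.2 <= b], all (nonoverlapping p) s & nov a b s].
Proof.
by rewrite /nov /= -andbA; congr (_ && _); rewrite andbCA.
Qed.

Lemma nov_widen a b c d s : c <= a -> b <= d -> nov a b s -> nov c d s.
Proof.
move=> ca bd; rewrite /nov => /andP[/allP h ->]; rewrite andbT.
apply/allP => p /h /and3P[ap -> pb]/=.
by rewrite (le_trans ca)//= (le_trans pb).
Qed.

Lemma nov_cat a b c s t : nov a b s -> nov b c t -> a <= b -> b <= c ->
  nov a c (s ++ t).
Proof.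
move=> ns nt ab bc; have ns' := nov_widen (lexx a) bc ns.
have nt' := nov_widen ab (lexx c) nt.
rewrite /nov all_cat pairwise_cat.
move: ns' nt' => /andP[-> ->] /andP[-> ->] /=; rewrite !andbT.
move: ns nt => /andP[/allP h _] /andP[/allP k _].
apply/allrelP => p q /h /and3P[_ _ pb] /k /and3P[bq _ _].
by rewrite /nonoverlapping (le_trans pb).
Qed.

(** An interval on the wrong side of [c] collapses to [(c, c)] instead of being filtered out: it
    contributes 0 and the length of the list is kept, which the inductions on [size] use. *)
Definition clipl c (p : R * R) := (Num.min p.1 c, Num.min p.2 c).
Definition clipr c (p : R * R) := (Num.max p.1 c, Num.max p.2 c).

Lemma nov_clipl a b c s : a <= c -> nov a b s -> nov a c (map (clipl c) s).
Proof.
move=> ac /andP[/allP h pw]; apply/andP; split.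
  apply/allP => _ /mapP[p /h /and3P[ap pp pb] ->] /=.
  by rewrite le_min ap ac /= le_min2 //= ge_min lexx orbT.
rewrite pairwise_map; apply: sub_pairwise pw => p q /=.
rewrite /nonoverlapping /= => /orP[] H; apply/orP; [left|right];
  exact: le_min2.
Qed.

Lemma nov_clipr a b c s : c <= b -> nov a b s -> nov c b (map (clipr c) s).
Proof.
move=> cb /andP[/allP h pw]; apply/andP; split.
  apply/allP => _ /mapP[p /h /and3P[ap pp pb] ->] /=.
  by rewrite le_max2//= le_max lexx orbT /= ge_max pb cb.
rewrite pairwise_map; apply: sub_pairwise pw => p q /=.
rewrite /nonoverlapping /= => /orP[] H; apply/orP; [left|right];
  exact: le_max2.
Qed.

Lemma vsum_clip f a b c s : nov a b s ->
  vsum f s <= vsum f (map (clipl c) s) + vsum f (map (clipr c) s).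
Proof.
move=> /andP[/allP h _]; rewrite /vsum !big_map -big_split /=.
rewrite !big_seq; apply: ler_sum => p /h /and3P[_ pp _].
case: (leP p.2 c) => H2.
  by rewrite (min_idPl (le_trans pp H2)) (max_idPr (le_trans pp H2)) subrr normr0 addr0.
case: (leP p.1 c) => H1; last by rewrite subrr normr0 add0r.
by rewrite addrC (le_trans _ (ler_normD _ _))// subrKA.
Qed.

(** Since the list is unsorted, the induction is on its length: what remains after removing the head
    [p] lies in [[a, p.1]] or in [[p.2, b]], and the two clipped halves are bounded separately. *)
Lemma vsum_id_le a b s : a <= b -> nov a b s -> vsum id s <= b - a.
Proof.
elim: {s}(size s) {-2}s (leqnn (size s)) a b => [|n IH] s.
  by rewrite leqn0 size_eq0 => /eqP -> a b ab _; rewrite vsum_nil subr_ge0.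
case: s => [|p s] /=; first by move=> _ a b ab _; rewrite vsum_nil subr_ge0.
rewrite ltnS => ss a b ab; rewrite nov_cons => /and3P[/and3P[ap pp pb] /allP no ns].
rewrite vsum_cons.
have := vsum_clip id p.1 ns.
have /andP[/allP nsh _] := ns.
(* No interval of [s] meets the interior of [p], so clipping on the right at [p.1] or at [p.2]
   leaves the same total length. *)
have E : vsum id (map (clipr p.1) s) <= b - p.2.
  have -> : vsum id (map (clipr p.1) s) = vsum id (map (clipr p.2) s).
    rewrite /vsum !big_map big_seq [RHS]big_seq; apply: eq_bigr => q qs /=.
    have /and3P[_ qq _] := nsh _ qs.
    case/orP: (no _ qs) => H.
      rewrite (max_idPl (le_trans pp H)) (max_idPl H).
      by rewrite (max_idPl (le_trans H qq)) (max_idPl (le_trans pp (le_trans H qq))).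
    rewrite (max_idPr H) (max_idPr (le_trans qq H)).
    by rewrite (max_idPr (le_trans H pp)) (max_idPr (le_trans qq (le_trans H pp))) !subrr.
  by apply: IH; rewrite ?size_map//; apply: nov_clipr (ns).
have E' : vsum id (map (clipl p.1) s) <= p.1 - a.
  apply: IH; rewrite ?size_map//; apply: nov_clipl (ns); exact: ap.
rewrite ger0_norm ?subr_ge0//.
move: E E'; lra.
Qed.

Lemma nov_flatten a b (t : seq (R * R)) (g : R * R -> seq (R * R)) :
  nov a b t -> (forall p, p \in t -> nov p.1 p.2 (g p)) ->
  nov a b (flatten (map g t)).
Proof.
elim: t => [|p t IH] //=; rewrite nov_cons => /and3P[/and3P[ap pp pb] /allP no ns] H.
have n1 : nov a b (g p) by apply: nov_widen (H _ (mem_head _ _)).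
have n2 : nov a b (flatten (map g t)).
  by apply: IH => // q qt; apply: H; rewrite in_cons qt orbT.
rewrite /nov all_cat pairwise_cat.
move: n1 n2 => /andP[-> ->] /andP[-> ->]; rewrite /= !andbT.
apply/allrelP => u v ug /flattenP[_ /mapP[q qt ->] vq].
have /andP[/allP /(_ _ ug) /and3P[h1 h2 h3] _] := H _ (mem_head _ _).
have qpt : q \in p :: t by rewrite in_cons qt orbT.
have /andP[/allP /(_ _ vq) /and3P[k1 k2 k3] _] := H _ qpt.
case/orP: (no _ qt) => K; apply/orP; [left|right].
  exact: le_trans h3 (le_trans K k1).
exact: le_trans k3 (le_trans K h1).
Qed.

Lemma vsum_flatten f (t : seq (R * R)) (g : R * R -> seq (R * R)) :
  vsum f (flatten (map g t)) = \sum_(p <- t) vsum f (g p).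
Proof. by rewrite /vsum big_flatten big_map. Qed.

Definition ACseq a b f := forall e, 0 < e -> exists2 d, 0 < d &
  forall s, nov a b s -> vsum id s < d -> vsum f s < e.

Lemma AC_onP a b f : AC_on a b f <-> ACseq a b f.
Proof.
split=> H e e0; have [d d0 h] := H e e0; exists d => //.
  move=> s /andP[/allP ns pw].
  have ns' i : [&& a <= (tnth (in_tuple s) i).1, (tnth (in_tuple s) i).1 <= (tnth (in_tuple s) i).2 & (tnth (in_tuple s) i).2 <= b].
    by apply: ns; exact: mem_tnth.
  rewrite /vsum !(big_tnth _ _ s) => hs.
  apply: h => [i||]; last 1 first.
  - apply: le_lt_trans hs; apply: ler_sum => i _; exact: ler_norm.
  - by case/and3P: (ns' i).
  move=> i j ij.
  have P (k l : 'I_(size s)) : (k < l)%N -> nonoverlapping (tnth (in_tuple s) k) (tnth (in_tuple s) l).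
    by move=> kl; rewrite !(tnth_nth (0, 0)) /=; apply: (elimT (pairwiseP (0, 0)) pw) => //; rewrite inE ltn_ord.
  have : (i < j)%N || (j < i)%N by rewrite -neq_ltn.
  by case/orP => /P /orP[] H1; [left|right|right|left].
move=> n x y xy no hs.
pose s := [seq (x i, y i) | i <- enum 'I_n].
have E F : vsum F s = \sum_(i < n) `|F (y i) - F (x i)|.
  by rewrite /vsum big_map big_enum.
rewrite -E; apply: h.
  rewrite /nov; apply/andP; split.
    by apply/allP => _ /mapP[i _ ->] /=; have [-> [-> ->]] := xy i.
  apply/(pairwiseP (0, 0)) => i j; rewrite !inE size_map size_enum_ord => hi hj ij.
  rewrite !(nth_map (Ordinal hi)) -?enumT ?size_enum_ord//.
  set i' := nth _ _ i; set j' := nth _ _ j.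
  have /no [K|K] : i' != j'.
  - by rewrite /i' /j' nth_uniq ?(ltn_eqF ij)//= -?enumT ?size_enum_ord ?enum_uniq.
  - by rewrite /nonoverlapping K.
  - by rewrite /nonoverlapping K orbT.
rewrite E; apply: le_lt_trans hs; apply: ler_sum => i _.
by rewrite ger0_norm// subr_ge0; have [_ []] := xy i.
Qed.

(** With [d] belonging to epsilon 1, the interval is exhausted by steps of length [d / 2], strictly
    below [d]; each step adds at most 1 to the variation. *)
Lemma ACseq_bounded a b f : a <= b -> ACseq a b f ->
  exists M, forall s, nov a b s -> vsum f s <= M.
Proof.
move=> ab /(_ _ ltr01)[d d0 hd].
have claim n : forall c, a <= c -> c <= b -> c - a <= n%:R * (d / 2) ->
    forall s, nov a c s -> vsum f s <= n%:R.
  elim: n => [|n IH] c ac cb can s ns.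
    have ca : c - a <= 0 by rewrite (le_trans can)// mul0r.
    have /hd : nov a b s by apply: nov_widen ns.
    have -> : vsum f s = 0; last by [].
    rewrite /vsum big_seq big1// => p ps.
    have /andP[/allP /(_ _ ps) /and3P[h1 h2 h3] _] := ns.
    have -> : p.2 = p.1 by apply/le_anti; rewrite h2 andbT; move: h1 h2 h3 ca; lra.
    by rewrite subrr normr0.
  pose c' := Num.max a (c - d / 2).
  have ac' : a <= c' by rewrite le_max lexx.
  have c'c : c' <= c by rewrite ge_max ac /=; move: d0; lra.
  apply: le_trans (vsum_clip f c' ns) _.
  rewrite -natr1; apply: lerD.
    apply: (IH c') (nov_clipl ac' ns) => //; first exact: le_trans cb.
    move: can; rewrite -natr1 mulrDl mul1r => can.
    rewrite lerBlDr ge_max; apply/andP; split; last by move: can; lra.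
    by rewrite lerDr mulr_ge0// divr_ge0// ltW.
  apply/ltW/hd; first exact: nov_widen (nov_clipr c'c ns).
  apply: le_lt_trans (vsum_id_le c'c (nov_clipr c'c ns)) _.
  rewrite ltrBlDr addrC -ltrBlDr lt_max; apply/orP; right; move: d0; lra.
have d20 : 0 < d / 2 by rewrite divr_gt0.
exists (Num.bound ((b - a) / (d / 2)))%:R => s ns.
apply: claim ns => //.
rewrite -ler_pdivrMr//; apply/ltW/archi_boundP.
by rewrite divr_ge0 ?subr_ge0// ltW.
Qed.

Definition variation f a b := sup [set vsum f s | s in [set s | nov a b s]].

Section VariationAC.
Variables (a b : R) (f : R -> R).
Hypotheses (ab : a <= b) (ACf : ACseq a b f).
Let W := variation f.

Let supW x y : a <= x -> y <= b -> has_sup [set vsum f s | s in [set s | nov x y s]].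
Proof.
move=> ax yb; split; first by exists 0, [::] => //; rewrite vsum_nil.
have [M hM] := ACseq_bounded ab ACf.
by exists M => _ [s /= ns <-]; apply: hM; exact: nov_widen ns.
Qed.

Lemma variation_ub x y s : a <= x -> y <= b -> nov x y s -> vsum f s <= W x y.
Proof. by move=> ax yb ns; apply: sup_upper_bound; [exact: supW|exists s]. Qed.

Lemma variation_lub x y M : a <= x -> y <= b ->
  (forall s, nov x y s -> vsum f s <= M) -> W x y <= M.
Proof.
move=> ax yb h; apply: ge_sup; first by have [] := supW ax yb.
by move=> _ [s /= /h hs <-].
Qed.

Lemma variation_approx x y e : a <= x -> y <= b -> 0 < e ->
  exists2 s, nov x y s & W x y - e < vsum f s.
Proof.
move=> ax yb e0; have [_ [s /= ns <-] hs] := sup_adherent e0 (supW ax yb).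
by exists s.
Qed.

Lemma variation_ge x y : a <= x -> x <= y -> y <= b -> `|f y - f x| <= W x y.
Proof.
move=> ax xy yb; have -> : `|f y - f x| = vsum f [:: (x, y)].
  by rewrite vsum_cons vsum_nil addr0.
by apply: variation_ub => //; rewrite nov_cons /= !lexx xy.
Qed.

Lemma variationD x y z : a <= x -> x <= y -> y <= z -> z <= b ->
  W x z = W x y + W y z.
Proof.
move=> ax xy yz zb; have ay := le_trans ax xy; have yb := le_trans yz zb.
apply/le_anti/andP; split.
  apply: variation_lub => // s ns.
  apply: le_trans (vsum_clip f y ns) _.
  apply: lerD; apply: variation_ub => //; first exact: nov_clipl ns.
  exact: nov_clipr ns.
apply/ler_addgt0Pl => e e0; have e20 : 0 < e / 2 by rewrite divr_gt0.
have [s ns hs] := variation_approx ax yb e20.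
have [t nt ht] := variation_approx ay zb e20.
have := variation_ub ax zb (nov_cat ns nt xy yz); rewrite vsum_cat.
move: hs ht; lra.
Qed.

Lemma variation_nondec x y : a <= x -> x <= y -> y <= b -> W a x <= W a y.
Proof.
move=> ax xy yb; rewrite (variationD (lexx a) ax xy yb) lerDl.
exact: le_trans (variation_ge ax xy yb).
Qed.

(** Each interval of [t] is replaced by a partition that nearly attains its variation. The refined
    list is no longer in total length than [t], so the absolute continuity of [f] applies to it. *)
Lemma ACseq_variation : ACseq a b (W a).
Proof.
move=> e e0; have e20 : 0 < e / 2 by rewrite divr_gt0.
have [d d0 hd] := ACf e20; exists d => // t nt ht.
have /andP[/allP th _] := nt.
have -> : vsum (W a) t = \sum_(p <- t) W p.1 p.2.
  rewrite /vsum big_seq [RHS]big_seq; apply: eq_bigr => p /th /and3P[h1 h2 h3].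
  rewrite (variationD (lexx a) h1 h2 h3) addrAC subrr add0r ger0_norm//.
  exact: le_trans (variation_ge h1 h2 h3).
(* The total loss over [t] is at most [e / 4], next to the [e / 2] for [f] itself; the successor
   avoids a division by zero for the empty list. *)
pose eta := e / 4 / (size t).+1%:R.
have eta0 : 0 < eta by rewrite !divr_gt0.
have /choice[g hg] p : exists s, p \in t -> nov p.1 p.2 s /\ W p.1 p.2 - eta < vsum f s.
  have [/th /and3P[h1 h2 h3]|] := boolP (p \in t); last by exists [::].
  by have [s ns hs] := variation_approx h1 h3 eta0; exists s.
have ng := nov_flatten nt (fun p pt => (hg p pt).1).
have hf : vsum f (flatten (map g t)) < e / 2.
  apply: hd ng _; apply: le_lt_trans ht; rewrite vsum_flatten.
  rewrite /vsum big_seq [leRHS]big_seq; apply: ler_sum => p pt.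
  have /and3P[h1 h2 h3] := th _ pt.
  rewrite ger0_norm ?subr_ge0//; apply: vsum_id_le => //.
  exact: (hg p pt).1.
have le1 : \sum_(p <- t) W p.1 p.2 <= \sum_(p <- t) (vsum f (g p) + eta).
  rewrite big_seq [leRHS]big_seq; apply: ler_sum => p pt.
  by have [_ /ltW] := hg p pt; rewrite lerBlDr.
apply: le_lt_trans le1 _; rewrite big_split /= -vsum_flatten.
have le2 : \sum_(p <- t) eta <= e / 4.
  rewrite big_const_seq count_predT iter_addr_0 -[_ *+ size t]mulr_natr /eta.
  rewrite -mulrA (mulrC _^-1) mulrA ler_pdivrMr// ler_pM2l ?divr_gt0// ler_nat//.
move: hf le2; lra.
Qed.

End VariationAC.
End Variation.

(** * Densities of monotone absolutely continuous functions *)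

Section Density.
Context {R : realType}.
Implicit Types (F : R -> R) (a b x y : R).
Local Notation mu := (@lebesgue_measure R).

(* The list s depends on the intervals only, not on F and nu: it is used once for
   Lebesgue measure and once for the Stieltjes measure. *)
Lemma ocitv_union_nov (a b : R) (n : nat) (E : nat -> set R) : a <= b ->
  (forall k, ocitv (E k)) -> (forall k, E k `<=` `]a, b]) ->
  exists s, [/\ nov a b s &
    forall (F : R -> R) (nu : {measure set (measurableTypeR R) -> \bar R}),
      (forall x y, a <= x -> x <= y -> y <= b -> nu `]x, y]%classic = (F y - F x)%:E) ->
      (forall x y, a <= x -> x <= y -> y <= b -> F x <= F y) ->
      nu (\bigcup_(k < n) E k) = (vsum F s)%:E].
Proof.
move=> ab oE Eab.
have : (SetRing.display (ocitv_display R)).-measurable (\bigcup_(k < n) E k : set (SetRing.type (ocitv_type R))).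
  apply: fin_bigcup_measurable => // k _; apply: sub_gen_smallest; exact: oE.
(* A finite union of half-open intervals lies in the ring they generate, hence is a finite disjoint
   union [B] of such intervals. *)
rewrite SetRing.ring_measurableE => -[B [EB mB finB tB]].
have BE X : B X -> X `<=` `]a, b].
  move=> BX; apply: subset_trans (_ : X `<=` \bigcup_(k < n) E k) _.
    by rewrite EB; exact: bigcup_sup.
  by apply: bigcup_sub => k _; exact: Eab.
(* An empty piece is represented by [(a, a)]. Every other piece has [p.1 < p.2], which turns an
   overlap of two intervals into a common point of two disjoint sets. *)
have /choice[g hg] X : exists p : R * R, B X ->
    [/\ a <= p.1, p.1 <= p.2, p.2 <= b, p.1 < p.2 \/ p = (a, a) & X = `]p.1, p.2]%classic].
  have [BX|] := pselect (B X); last by exists (a, a).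
  have /ocitvP[X0|[p p12 Xp]] : ocitv X by exact: mB.
    by exists (a, a) => _; split => //=; [right|rewrite X0 set_itvoc0].
  exists p => _; split; [|exact: ltW| |by left|by []]; last first.
  - have : X p.2 by rewrite Xp /= in_itv /= p12 lexx.
    by move/(BE _ BX); rewrite /= in_itv /= => /andP[].
  - rewrite leNgt; apply/negP => pa.
    have : X (Num.min a p.2).
      rewrite Xp /= in_itv /= lt_min pa p12 /= ge_min lexx orbT//.
    by move/(BE _ BX); rewrite /= in_itv /= lt_min ltxx.
exists (map g (fset_set B)).
have nB X : X \in fset_set B -> B X by rewrite in_fset_set // => /set_mem.
split.
  rewrite /nov; apply/andP; split.
    by apply/allP => _ /mapP[X /nB /hg[h1 h2 h3 _ _] ->]; apply/and3P.
  rewrite pairwise_map.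
  apply/(pairwiseP set0) => i j; rewrite !inE => hi hj ij.
  set X := nth _ _ i; set Y := nth _ _ j.
  have BX : B X by apply/nB/mem_nth.
  have BY : B Y by apply/nB/mem_nth.
  have XY : X <> Y.
    by move/eqP; rewrite nth_uniq ?fset_uniq// (ltn_eqF ij).
  have [h1 h2 h3 dX hX] := hg _ BX; have [k1 k2 k3 dY hY] := hg _ BY.
  rewrite /nonoverlapping /=; apply/negP => /negP; rewrite negb_or -!ltNge => /andP[l1 l2].
  case: dX => [lX|eX]; last by move: l1; rewrite eX /= ltNge k1.
  case: dY => [lY|eY]; last by move: l2; rewrite eY /= ltNge h1.
  apply: XY; apply: tB => //; exists (Num.min (g X).2 (g Y).2).
  by split; [rewrite [X in X _]hX|rewrite [X in X _]hY];
    rewrite /= in_itv /= lt_min ge_min ?lX ?l1 ?lY ?l2 ?lexx ?orbT.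
move=> F nu hnu Fnd; rewrite EB.
rewrite measure_fin_bigcup//; last first.
  by move=> X /mB; exact: sub_sigma_algebra.
rewrite fsbig_finite//= /vsum big_map -sumEFin big_seq [RHS]big_seq.
apply: eq_bigr => X /nB BX; have [h1 h2 h3 dX hX] := hg _ BX.
by rewrite [X in nu X]hX hnu// ger0_norm// subr_ge0 Fnd.
Qed.

(* Radon-Nikodym for the Lebesgue-Stieltjes measure of F: absolute continuity of F
   bounds it on finite unions of intervals, hence on Lebesgue null sets. *)
Lemma nondecreasing_AC_density a b F : a <= b ->
  (forall x y, a <= x -> x <= y -> y <= b -> F x <= F y) -> ACseq a b F ->
  exists g : R -> R, mu.-integrable setT (EFin \o g) /\
    forall x, a <= x -> x <= b -> F x - F a = \int[mu]_(t in `[a, x]) g t.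
Proof.
move=> ab Fnd ACF.
have Fcont : forall e, 0 < e -> exists2 d, 0 < d & forall x y, a <= x -> x <= y -> y <= b ->
    y - x < d -> F y - F x < e.
  move=> e e0; have [d d0 hd] := ACF _ e0; exists d => // x y ax xy yb yx.
  have : vsum F [:: (x, y)] < e.
    apply: hd; first by rewrite nov_cons /= ax xy yb.
    by rewrite vsum_cons vsum_nil addr0 /= ger0_norm// subr_ge0.
  by rewrite vsum_cons vsum_nil addr0 /=; apply: le_lt_trans; exact: ler_norm.
(* [F] is controlled on [[a, b]] only. Composed with the projection onto [[a, b]] it is monotone and
   right-continuous on the whole line, so it defines a Stieltjes measure. *)
pose clamp x := Num.max a (Num.min x b).
have clampE x : a <= x -> x <= b -> clamp x = x.
  by move=> ax xb; rewrite /clamp (min_idPl xb) (max_idPr ax).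
have clamp_nd x y : x <= y -> clamp x <= clamp y.
  by move=> xy; rewrite /clamp le_max2// le_min2.
have clampa x : a <= clamp x by rewrite /clamp le_max lexx.
have clampb x : clamp x <= b by rewrite /clamp ge_max ab ge_min lexx orbT.
have clamp_lip x y : x <= y -> clamp y - clamp x <= y - x.
  rewrite /clamp => xy.
  case: (leP x b) => xb; case: (leP y b) => yb;
  case: (leP a x) => ax; case: (leP a y) => ay; case: (leP a b) => ab'; 
  move: xy ab xb yb ax ay ab'; lra.
pose G x := F (clamp x).
have Gnd : nondecreasing_fun G.
  by move=> x y xy; apply: Fnd => //; exact: clamp_nd.
have Grc : right_continuous G.
  move=> x; apply/cvgrPdist_lt => e e0; have [d d0 hd] := Fcont _ e0.
  near=> y.
  have xy : x <= y by near: y; exact: nbhs_right_ge.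
  have yx : y - x < d by rewrite ltrBlDl; near: y; apply: nbhs_right_lt; rewrite ltrDl.
  rewrite distrC ger0_norm ?subr_ge0; last exact: Gnd.
  apply: hd => //; first exact: clamp_nd.
  exact: le_lt_trans (clamp_lip _ _ xy) yx.
pose Gc : cumulative R R := HB.pack G (isCumulative.Build R _ R G Gnd Grc).
pose S := lebesgue_stieltjes_measure Gc.
have SE x y : a <= x -> x <= y -> y <= b -> S `]x, y]%classic = (F y - F x)%:E.
  move=> ax xy yb.
  rewrite /S /lebesgue_stieltjes_measure /measure_extension measurable_mu_extE/=; last exact: is_ocitv.
  by rewrite wlength_itv_bnd//= /G !clampE// ?(le_trans xy)// (le_trans ax).
have mab : measurable (`]a, b]%classic : set (measurableTypeR R)) by exact: measurable_itv.
have Sab : (S `]a, b]%classic < +oo)%E by rewrite SE// ltry.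
pose nu := mfrestr mab Sab.
have dom : nu `<< mu.
  apply/null_content_dominatesP => A mA A0.
  suff H e : 0 < e -> (nu A <= e%:E)%E.
    apply/eqP; rewrite eq_le measure_ge0 andbT.
    by apply/lee_addgt0Pr => e e0; rewrite add0e; exact: H.
  move=> e0; have [d d0 hd] := ACF _ e0.
  have : mu A \is a fin_num by rewrite A0.
  rewrite /lebesgue_measure /lebesgue_stieltjes_measure /measure_extension /mu_ext.
  (* By definition of the outer measure, the null set has a cover by half-open intervals of total
     length below [d]. Absolute continuity bounds the Stieltjes measure of each finite union [U n],
     and continuity from below that of the whole cover. *)
  move=> /(lb_ereal_inf_adherent d0)[_ [I [mI AI] <-]].
  set i0 := ereal_inf _; have -> : i0 = 0%E by exact: A0.
  rewrite add0e => Id.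
  pose E k : set R := I k `&` `]a, b].
  have oE k : ocitv (E k) by apply: ocitvI; [exact: mI|exact: is_ocitv].
  have mE k : measurable (E k : set (measurableTypeR R)) by apply: sub_sigma_algebra; exact: oE.
  have Eab k : E k `<=` `]a, b] by exact: subIsetr.
  pose U n := \bigcup_(k < n) E k.
  have mU n : measurable (U n : set (measurableTypeR R)) by apply: bigcup_measurable.
  have Ue n : (S (U n) <= e%:E)%E.
    have [s [ns hs]] := ocitv_union_nov n ab oE Eab.
    have -> : S (U n) = (vsum F s)%:E by exact: (hs F S).
    rewrite lee_fin; apply/ltW/hd => //; rewrite -lte_fin.
    have <- : mu (U n) = (vsum id s)%:E.
      apply: (hs id mu) => //.
      move=> x y _ xy _; rewrite -[LHS]/(lebesgue_measure `]x, y]%classic) lebesgue_measure_itv /= lte_fin.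
      case: ltP => // yx; have -> : x = y by apply/le_anti; rewrite xy.
      by rewrite subrr.
    apply: le_lt_trans Id.
    rewrite /U bigcup_mkord.
    apply: le_trans (_ : _ <= \sum_(k < n) mu (E k))%E _.
      exact: (@Boole_inequality _ _ _ mu E).
    apply: le_trans (_ : _ <= \sum_(0 <= k < n) wlength idfun (I k))%E _; last first.
      by apply: nneseries_lim_ge => k _ _; exact: wlength_ge0.
    rewrite big_mkord; apply: lee_sum => k _.
    rewrite -[leRHS]measurable_mu_extE; last exact: mI.
    by apply: le_mu_ext; exact: subIsetl.
  have -> : nu A = S (A `&` `]a, b]) by [].
  apply: (@le_trans _ _ (S (\bigcup_n U n))).
    apply: le_measure; [apply/mem_set|apply/mem_set|].
    - exact: (measurableI _ _ mA mab).
    - exact: bigcup_measurable.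
    - move=> x [Ax xab]; have [k _ Ik] := AI _ Ax.
      by exists k.+1 => //; exists k => //=; split.
  have : (S \o U) n @[n --> \oo] --> S (\bigcup_n U n).
    apply: nondecreasing_cvg_mu => //; first exact: bigcup_measurable.
    move=> m n mn; apply/subsetPset; apply: bigcup_sub => k km.
    by apply: bigcup_sup => /=; exact: leq_trans mn.
  move=> /cvg_lim <-//; apply: lime_le => //; last by near=> n; exact: Ue.
  by apply: ereal_nondecreasing_is_cvgn => m n mn; apply: le_measure; [exact/mem_set|exact/mem_set|];
    apply: bigcup_sub => k km; apply: bigcup_sup => /=; exact: leq_trans mn.
have [g [g0 gfin gint gE]] := radon_nikodym_sigma_finite dom.
exists (fine \o g).
have gg : EFin \o (fine \o g) = g by apply/funext => x /=; rewrite fineK.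
rewrite gg; split => // x ax xb.
have maxi : measurable (`]a, x]%classic : set (measurableTypeR R)) by exact: measurable_itv.
have : (S (`]a, x] `&` `]a, b]) = \int[mu]_(t in `]a, x]) g t)%E by exact: gE.
rewrite setIidl; last by apply: subset_itvl; rewrite bnd_simp.
rewrite SE// => e; rewrite -[LHS]/(fine (F x - F a)%:E) e -(Rintegral_itv_obnd_cbnd (r := a)).
  by rewrite /Rintegral; congr fine; apply: eq_integral => t _ /=; rewrite fineK.
by rewrite gg; apply: integrableS gint.
Unshelve. all: by end_near.
Qed.
End Density.

(** * Indefinite integrals and absolute continuity *)

Section Primitive.
Context {R : realType}.
Implicit Types (F G f g h : R -> R) (a b x y z : R).
Local Notation mu := (@lebesgue_measure R).

Lemma aeS (P Q : R -> Prop) : {ae mu, forall x, P x} ->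
  (forall x, P x -> Q x) -> {ae mu, forall x, Q x}.
Proof. by move=> + PQ; apply: (@filterS _ _ (ae_filter_ringOfSetsType mu)). Qed.

Lemma aeI (P Q : R -> Prop) : {ae mu, forall x, P x} -> {ae mu, forall x, Q x} ->
  {ae mu, forall x, P x /\ Q x}.
Proof. by move=> hP hQ; apply: (@filterI _ _ (ae_filter_ringOfSetsType mu)). Qed.

Lemma aeW (P : R -> Prop) : (forall x, P x) -> {ae mu, forall x, P x}.
Proof. by move=> hP; apply: aeW. Qed.

Definition locint g := measurable_fun setT g /\
  forall x y, mu.-integrable `[x, y] (EFin \o g).

(** Working substitute for F in AC_loc with F' = g a.e.: [primitive_AC] and [primitive_ae_derivable]
    recover these two properties, and [ACloc_primitive] is the converse. *)
Definition primitive F g := locint g /\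
  forall x y, x <= y -> F y - F x = \int[mu]_(t in `[x, y]) g t.

Lemma locint_locally_integrable g : locint g <-> locally_integrable setT g.
Proof.
split=> [[mg ig]|[mg _ ig]].
  split=> //; first exact: openT.
  move=> K _ cK; have [M [_ hM]] := compact_bounded cK.
  have KM : K `<=` `[- (M + 1), M + 1].
    move=> x Kx; have : `|x| <= M + 1 by apply: hM => //; rewrite ltrDl.
    by rewrite /= in_itv /= ler_norml.
  have /integrableP[_] := ig (- (M + 1)) (M + 1).
  apply: le_lt_trans; apply: ge0_subset_integral => //=.
    exact: compact_measurable.
  by apply/measurable_EFinP; apply: measurableT_comp => //; exact: measurable_funTS.
split=> // x y; apply/integrableP; split.
  by apply/measurable_EFinP; exact: measurable_funTS.
by apply: ig => //; exact: segment_compact.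
Qed.

Lemma ae_eq_Rintegral (D : set R) g h : measurable D ->
  measurable_fun D h -> {ae mu, forall x, D x -> g x = h x} ->
  mu.-integrable D (EFin \o g) ->
  mu.-integrable D (EFin \o h) /\ \int[mu]_(x in D) g x = \int[mu]_(x in D) h x.
Proof.
move=> mD mh gh ig; have /integrableP[mg fg] := ig.
have mh' : measurable_fun D (EFin \o h) by exact/measurable_EFinP.
split.
  apply/integrableP; split=> //.
  suff <- : (\int[mu]_(x in D) `|(EFin \o g) x| = \int[mu]_(x in D) `|(EFin \o h) x|)%E by [].
  apply: ge0_ae_eq_integral => //; try exact: measurableT_comp.
  by apply: (aeS gh) => x {}gh Dx /=; rewrite gh.
rewrite /Rintegral; congr fine; apply: ae_eq_integral => //.
by apply: (aeS gh) => x {}gh Dx /=; rewrite gh.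
Qed.

Lemma locint_ae_eq g h : measurable_fun setT h -> {ae mu, forall x, g x = h x} ->
  locint g -> locint h.
Proof.
move=> mh gh [mg ig]; split=> // x y.
apply: (ae_eq_Rintegral _ _ _ (ig x y)).1 => //; first exact: measurable_funTS.
by apply: (aeS gh) => t ->.
Qed.

Lemma primitive_ae_eq F g h : measurable_fun setT h -> {ae mu, forall x, g x = h x} ->
  primitive F g -> primitive F h.
Proof.
move=> mh gh [lg Fg]; split=> [|x y xy]; first exact: locint_ae_eq lg.
rewrite Fg//; apply: (ae_eq_Rintegral _ _ _ (lg.2 x y)).2 => //; first exact: measurable_funTS.
by apply: (aeS gh) => t ->.
Qed.

Lemma derivable_near_eq F G x c : (\near x, F x = G x + c) ->
  derivable G x 1 -> derivable F x 1 /\ derive1 F x = derive1 G x.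
Proof.
move=> FG dG.
have dGc : derivable (G + cst c) x 1 by exact: derivableD.
have FG' : {near x, (G + cst c) =1 F} by near=> y; apply/esym; near: y.
split; first exact: near_eq_derivable FG' dGc.
rewrite !derive1E -(near_eq_derive _ FG')//.
by rewrite deriveD// derive_cst addr0.
Unshelve. all: by end_near. Qed.

(** Every Lebesgue point of [g] will do: near [x], [F] is the constant [F (x - 1)] plus an integral
    with the fixed lower limit [x - 1]. *)
Lemma primitive_ae_derivable F g : primitive F g ->
  {ae mu, forall x, derivable F x 1 /\ derive1 F x = g x}.
Proof.
move=> [lg Fg]; have /lebesgue_differentiation := (locint_locally_integrable g).1 lg.
move=> /aeS; apply=> x gx.
have x1 : x < x + 1 by rewrite ltrDl.
have ax : (BLeft (x - 1)%R < BRight x)%E by rewrite lte_fin ltrBlDr ltrDl.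
have [dH H'] := FTC1_lebesgue_pt x1 (lg.2 (x - 1) (x + 1)) ax gx.
have [] := @derivable_near_eq F _ x (F (x - 1)) _ dH.
  near=> z; apply/eqP; rewrite -subr_eq; apply/eqP/Fg; apply/ltW.
  by near: z; apply: lt_nbhsr; rewrite ltrBlDr ltrDl.
by move=> dF ->; split.
Unshelve. all: by end_near. Qed.

(** Half-open intervals, so that non-overlapping means disjoint and the measure of the union is the
    sum of the lengths. *)
Definition vset (s : seq (R * R)) : set R :=
  \big[setU/set0]_(p <- s) `]p.1, p.2]%classic.

Lemma vset_cons p s : vset (p :: s) = `]p.1, p.2]%classic `|` vset s.
Proof. by rewrite /vset big_cons. Qed.

Lemma measurable_vset s : measurable (vset s).
Proof.
elim: s => [|p s IH]; first by rewrite /vset big_nil.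
by rewrite vset_cons; apply: measurableU => //; exact: measurable_itv.
Qed.

Lemma vset_disjoint p s : all (nonoverlapping p) s ->
  (forall q, q \in s -> q.1 <= q.2) -> p.1 <= p.2 ->
  `]p.1, p.2]%classic `&` vset s = set0.
Proof.
move=> + + pp; elim: s => [|q s IH] /=; first by rewrite /vset big_nil setI0.
move=> /andP[pq ps] hs; rewrite vset_cons setIUr IH//; last first.
  by move=> r rs; apply: hs; rewrite in_cons rs orbT.
rewrite setU0 -subset0 => x [] /=; rewrite !in_itv /= => /andP[h1 h2] /andP[h3 h4].
by case/orP: pq => h; [have := le_lt_trans (le_trans h2 h) h3|have := le_lt_trans (le_trans h4 h) h1]; rewrite ltxx.
Qed.

Lemma mu_vset a b s : nov a b s -> mu (vset s) = (vsum id s)%:E.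
Proof.
elim: s => [|p s IH]; first by rewrite /vset big_nil measure0 vsum_nil.
rewrite nov_cons => /and3P[/and3P[ap pp pb] no ns].
have dis : `]p.1, p.2]%classic `&` vset s = set0.
  apply: vset_disjoint => // q; have /andP[/allP h _] := ns.
  by move=> /h /and3P[].
rewrite vset_cons.
have -> : (mu (`]p.1, p.2]%classic `|` vset s) = mu `]p.1, p.2]%classic + mu (vset s))%E.
  by rewrite measureU//; exact: measurable_vset.
rewrite IH//.
rewrite vsum_cons EFinD; congr (_ + _)%E.
rewrite lebesgue_measure_itv /= lte_fin ger0_norm ?subr_ge0//.
case: ltP => // yx; have -> : p.1 = p.2 by apply/le_anti; rewrite pp.
by rewrite subrr.
Qed.

(** The increments over [s] sum to at most the integral of [|g|] over [vset s], a set of measure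
    [vsum id s]; the absolute continuity of the integral supplies [d]. *)
Lemma primitive_AC F g : primitive F g -> ACloc F.
Proof.
move=> [[mg ig] Fg] a b ab; apply/AC_onP => e e0.
have mab : measurable `[a, b]%classic by exact: measurable_itv.
have iG : mu.-integrable setT (EFin \o (g \_ `[a, b])).
  by rewrite -restrict_EFin; apply/integrable_restrict => //; rewrite setTI.
have [d [d0 hd]] := integral_normr_continuous iG e0.
exists d => // s ns hs.
have {hs} hs : (mu (vset s) < d%:E)%E by rewrite (mu_vset ns) lte_fin.
have := hd _ (measurable_vset s) hs; apply: le_lt_trans.
have nig A : measurable A -> mu.-integrable A (EFin \o (fun x => `|(g \_ `[a, b]) x|)).
  move=> mA; apply: (@integrableS _ _ _ mu setT) => //.
  exact: (integrable_abse iG).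
elim: s ns {hs} => [|p s IH]; first by rewrite vsum_nil /vset big_nil Rintegral_set0.
rewrite nov_cons => /and3P[/and3P[ap pp pb] no ns].
have dis : `]p.1, p.2]%classic `&` vset s = set0.
  apply: vset_disjoint => // q; have /andP[/allP h _] := ns.
  by move=> /h /and3P[].
rewrite vsum_cons vset_cons Rintegral_setU//; last 3 first.
- exact: measurable_vset.
- by apply: nig; apply: measurableU; [exact: measurable_itv|exact: measurable_vset].
- by apply/disj_set2P.
apply: lerD; last exact: IH.
rewrite Fg//; apply: le_trans (le_normr_Rintegral _ _) _ => //.
rewrite -(Rintegral_itv_obnd_cbnd (r := p.1)); last first.
  apply: integrableS (integrable_abse (ig p.1 p.2)) => //.
  by apply: subset_itvr; rewrite bnd_simp.
rewrite le_eqVlt; apply/orP; left; apply/eqP/eq_Rintegral => x /set_mem /=; rewrite in_itv /= => /andP[h1 h2].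
by rewrite patchE mem_set//= in_itv /= (le_trans ap (ltW h1)) (le_trans h2 pb).
Qed.

Lemma AC_on_continuous_within F a b : AC_on a b F -> forall x, a < x -> x < b ->
  {for x, continuous F}.
Proof.
move=> /AC_onP AF x ax xb; apply/cvgrPdist_lt => e e0.
have [d d0 hd] := AF _ e0.
near=> y.
have ya : a <= y by apply/ltW; near: y; exact: lt_nbhsr.
have yb : y <= b by apply/ltW; near: y; exact: lt_nbhsl.
have yx : `|x - y| < d by near: y; exact: (@cvgr_dist_lt _ R^o).
case: (leP x y) => xy.
  have : vsum F [:: (x, y)] < e.
    apply: hd; first by rewrite nov_cons /= (ltW ax) xy yb.
    by rewrite vsum_cons vsum_nil addr0 /= distrC.
  by rewrite vsum_cons vsum_nil addr0 /= distrC.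
have : vsum F [:: (y, x)] < e.
  apply: hd; first by rewrite nov_cons /= (ltW xb) (ltW xy) ya.
  by rewrite vsum_cons vsum_nil addr0.
by rewrite vsum_cons vsum_nil addr0.
Unshelve. all: by end_near. Qed.

Lemma ACloc_continuous F : ACloc F -> continuous F.
Proof.
move=> AF x; have : x - 1 <= x + 1 by lra.
by move=> /AF /AC_on_continuous_within; apply; lra.
Qed.

(* F = V - (V - F) with V the variation; both terms are nondecreasing and AC. *)
Lemma AC_density F a b : a <= b -> AC_on a b F -> exists2 g, mu.-integrable `[a, b] (EFin \o g) &
  forall x, a <= x -> x <= b -> F x - F a = \int[mu]_(t in `[a, x]) g t.
Proof.
move=> ab /AC_onP AF.
pose V := variation F a.
have Vnd x y : a <= x -> x <= y -> y <= b -> V x <= V y by exact: variation_nondec.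
have AV : ACseq a b V by exact: ACseq_variation.
have [g1 [ig1 hg1]] := nondecreasing_AC_density ab Vnd AV.
have Wnd x y : a <= x -> x <= y -> y <= b -> V x - F x <= V y - F y.
  move=> ax xy yb.
  have := variation_ge ab AF ax xy yb; rewrite /V (variationD ab AF (lexx a) ax xy yb).
  have := ler_norm (F y - F x); lra.
have AW : ACseq a b (fun x => V x - F x).
  move=> e e0; have e20 : 0 < e / 2 by rewrite divr_gt0.
  have [d1 d10 h1] := AV _ e20; have [d2 d20 h2] := AF _ e20.
  exists (Num.min d1 d2); first by rewrite lt_min d10.
  move=> s ns; rewrite lt_min => /andP[/(h1 _ ns) k1 /(h2 _ ns) k2].
  rewrite [ltRHS]splitr; apply: le_lt_trans (ltrD k1 k2).
  rewrite /vsum -big_split /=; apply: ler_sum => p _.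
  have -> : V p.2 - F p.2 - (V p.1 - F p.1) = (V p.2 - V p.1) - (F p.2 - F p.1) by ring.
  exact: ler_normB.
have [g2 [ig2 hg2]] := nondecreasing_AC_density ab Wnd AW.
exists (fun x => g1 x - g2 x) => [|x ax xb].
  have := integrableB measurableT ig1 ig2; apply: integrableS => //.
have iS g : mu.-integrable setT (EFin \o g) -> mu.-integrable `[a, x] (EFin \o g).
  by apply: integrableS.
rewrite RintegralB ?hg1 -?hg1 -?hg2//; try exact: iS.
ring.
Qed.

Lemma ae_neq x : {ae mu, forall t, t <> x}.
Proof.
exists [set x]; split; [exact: measurable_set1|exact: lebesgue_measure_set1|].
by move=> t /= /contrapT.
Qed.

(* An upper limit of difference quotients gives one globally defined measurable
   density, which agrees a.e. with the density of every compact interval. *)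
Lemma ACloc_primitive F : ACloc F -> exists g, primitive F g.
Proof.
move=> AF; have cF := ACloc_continuous AF.
pose q n x := ((F (x + n.+1%:R^-1) - F x) / n.+1%:R^-1).
pose g x := fine (limn_esup (fun n => (q n x)%:E)).
have mF : measurable_fun setT F by exact: continuous_measurable_fun.
have mg : measurable_fun setT g.
  apply: (measurableT_comp (@fine_measurable _ setT measurableT)) => //.
  apply: measurable_fun_limn_esup => n; apply/measurable_EFinP.
  apply: measurable_funM => //; apply: measurable_funB => //.
  by apply: (measurableT_comp mF); apply: measurable_funD.
suff H x y : x <= y -> mu.-integrable `[x, y] (EFin \o g) /\ F y - F x = \int[mu]_(t in `[x, y]) g t.
  exists g; split; [split=> // x y|by move=> x y /H[]].
  have [/H[]//|yx] := leP x y.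
  by rewrite set_itv_ge ?bnd_simp -?ltNge//; exact: integrable_set0.
move=> xy; have [h ih Fh] := AC_density xy (AF _ _ xy).
have gh : {ae mu, forall t, t \in `[x, y] -> h t = g t}.
  have ih' : mu.-integrable setT (EFin \o (h \_ `[x, y])).
    by rewrite -restrict_EFin; apply/integrable_restrict => //; rewrite setTI.
  have lh' := integrable_locally (measurable_itv `[x, y]) ih.
  have ih'' z : mu.-integrable [set` Interval (BLeft x) (BRight z)] (EFin \o (h \_ `[x, y])).
    by apply: integrableS ih'.
  have := FTC1 ih'' lh'.
  move=> /aeI/(_ (ae_neq x))/aeI/(_ (ae_neq y))/aeS; apply=> t [[+ tx] ty].
  rewrite in_itv /= => + /andP[xt ty'].
  have {}xt : x < t by rewrite lt_neqAle xt andbT eq_sym; apply/eqP.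
  have {ty'}ty : t < y by rewrite lt_neqAle ty' andbT; apply/eqP.
  rewrite lte_fin => /(_ xt)[dH H'].
  have [] := @derivable_near_eq F _ t (F x) _ dH.
    near=> z; have xz : x <= z by apply/ltW; near: z; exact: lt_nbhsr.
    have zy : z <= y by apply/ltW; near: z; exact: lt_nbhsl.
    apply/eqP; rewrite -subr_eq Fh//; apply/eqP/eq_Rintegral => r /set_mem /=.
    rewrite in_itv /= => /andP[r1 r2].
    by rewrite patchE mem_set//= in_itv /= r1 (le_trans r2).
  rewrite {}H' patchE mem_set//=; last by rewrite in_itv /= !ltW.
  move=> dF F't.
  suff qn : (fun n => (q n t)%:E) @ \oo --> (h t)%:E.
    by rewrite /g (cvg_limn_einf_sup qn).2.
  apply: cvg_EFin; first by near=> n.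
  rewrite -F't derive1E.
  have /cvgr_dnbhsP/(_ harmonic) : (fun e => e^-1 *: ((F \o shift t) (e *: 1) - F t)) @ 0^' --> 'D_1 F t.
    exact: dF.
  have hh : (forall n, harmonic n != 0 :> R) /\ (@harmonic R n @[n --> \oo] --> (0 : R)).
    by split=> [n|]; [rewrite invr_eq0 pnatr_eq0|exact: cvg_harmonic].
  move=> /(_ hh); apply: cvg_trans; apply: near_eq_cvg; near=> n => /=.
  have -> : (harmonic n)%:A + t = t + n.+1%:R^-1 by rewrite [_%:A]mulr1 addrC.
  by rewrite /q mulrC.
rewrite Fh//; apply: ae_eq_Rintegral => //; first exact: measurable_funTS.
Unshelve. all: by end_near. Qed.
End Primitive.

(** * Calculus of primitives *)

Section PrimitiveCalculus.
Context {R : realType}.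
Implicit Types (F G f g h : R -> R) (a b c x y z : R).
Local Notation mu := (@lebesgue_measure R).

Lemma continuous_bounded f a b : continuous f ->
  exists2 M, 0 < M & forall x, a <= x -> x <= b -> `|f x| <= M.
Proof.
move=> cf.
have : compact (f @` `[a, b]).
  apply: continuous_compact; last exact: segment_compact.
  exact: continuous_subspaceT.
move=> /compact_bounded[M [_ hM]]; exists (`|M| + 1); first by rewrite ltr_pwDr.
move=> x ax xb; apply: hM; first by rewrite (le_lt_trans (ler_norm _))// ltrDl.
by exists x => //=; rewrite in_itv /= ax xb.
Qed.

Lemma locint_le g h : measurable_fun setT h -> (forall x, `|h x| <= g x) ->
  locint g -> locint h.
Proof.
move=> mh hg [mg ig]; split=> // x y.
apply: le_integrable (ig x y) => //=.
  by apply/measurable_EFinP; exact: measurable_funTS.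
by move=> z _; rewrite lee_fin (le_trans (hg z)) ?ler_norm.
Qed.

Lemma locintD g h : locint g -> locint h -> locint (fun x => g x + h x).
Proof.
move=> [mg ig] [mh ih]; split=> [|x y]; first exact: measurable_funD.
exact: (integrableD _ (ig x y) (ih x y)).
Qed.

Lemma locintZ c g : locint g -> locint (fun x => c * g x).
Proof.
move=> [mg ig]; split=> [|x y]; first exact: measurable_funM.
exact: (integrableZl _ _ (ig x y)).
Qed.

Lemma locintN g : locint g -> locint (fun x => - g x).
Proof.
by move=> /(locintZ (-1)); under [X in locint X]eq_fun do rewrite mulN1r.
Qed.

Lemma locintB g h : locint g -> locint h -> locint (fun x => g x - h x).
Proof. by move=> lg /locintN; exact: locintD. Qed.

Lemma locint_norm g : locint g -> locint (fun x => `|g x|).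
Proof.
move=> [mg ig]; split=> [|x y]; first exact: measurableT_comp.
exact: (integrable_norm (ig x y)).
Qed.

Lemma continuous_measurable f : continuous f -> measurable_fun setT f.
Proof. exact: continuous_measurable_fun. Qed.

Lemma locint_continuous f : continuous f -> locint f.
Proof.
move=> cf; split=> [|x y]; first exact: continuous_measurable.
apply: continuous_compact_integrable; first exact: segment_compact.
exact: continuous_subspaceT.
Qed.

Lemma locint_cst c : locint (fun=> c).
Proof. by apply: locint_continuous => x; exact: cvg_cst. Qed.

Lemma locintM_continuous f g : continuous f -> locint g -> locint (fun x => f x * g x).
Proof.
move=> cf [mg ig]; have mfg : measurable_fun setT (fun x => f x * g x).
  by apply: measurable_funM => //; exact: continuous_measurable.
split=> // x y; have [M M0 hM] := continuous_bounded x y cf.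
have iM : mu.-integrable `[x, y] (fun z => M%:E * (EFin \o g) z)%E.
  exact: (integrableZl _ M (ig x y)).
apply: le_integrable iM => //=.
  by apply/measurable_EFinP; exact: measurable_funTS.
move=> z; rewrite in_itv /= => /andP[xz zy].
by rewrite lee_fin !normrM ler_wpM2r// (gtr0_norm M0) hM.
Qed.

Lemma locintM_sqr f g : measurable_fun setT f -> measurable_fun setT g ->
  locint (fun x => f x ^+ 2) -> locint (fun x => g x ^+ 2) ->
  locint (fun x => f x * g x).
Proof.
move=> mf mg lf lg; apply: locint_le (locintD lf lg); first exact: measurable_funM.
move=> x; rewrite normrM -(real_normK (num_real (f x))) -(real_normK (num_real (g x))).
have := sqr_ge0 (`|f x| - `|g x|); have := normr_ge0 (f x); have := normr_ge0 (g x).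
nra.
Qed.

Lemma locint_sqr g : measurable_fun setT g -> locint (fun x => g x ^+ 2) -> locint g.
Proof.
move=> mg lg; apply: locint_le (locintD lg (locint_cst 1)) => // x.
rewrite -(real_normK (num_real (g x))).
have := sqr_ge0 (`|g x| - 1); have := normr_ge0 (g x); nra.
Qed.

Lemma Rintegral_chasles g x y z : locint g -> x <= y -> y <= z ->
  \int[mu]_(t in `[x, z]) g t = \int[mu]_(t in `[x, y]) g t + \int[mu]_(t in `[y, z]) g t.
Proof.
move=> [_ ig] xy yz.
have := @Rintegral_itvB _ g (BLeft x) (BRight z) y (ig x z).
rewrite !bnd_simp => /(_ xy yz) /eqP; rewrite subr_eq addrC => /eqP ->.
congr (_ + _); apply: Rintegral_itv_obnd_cbnd.
by apply: integrableS (ig y z) => //; apply: subset_itvr; rewrite bnd_simp.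
Qed.

(** Set integrals carry no orientation: [[c, x]] is empty for [x < c], so the sign on the left of
    [c] is put in by hand. *)
Lemma primitive_exists g c v : locint g -> exists2 F, primitive F g & F c = v.
Proof.
move=> lg; pose I x y := \int[mu]_(t in `[x, y]) g t.
have I0 x : I x x = 0 by rewrite /I set_itv1 Rintegral_set1.
exists (fun x => v + (if c <= x then I c x else - I x c)); last by rewrite lexx I0 addr0.
split=> // x y xy /=.
have [cx|xc] := leP c x.
  by rewrite (le_trans cx xy) /I (Rintegral_chasles lg cx xy); ring.
have [cy|yc] := leP c y.
  by rewrite [RHS](Rintegral_chasles lg (ltW xc) cy) /I; ring.
by rewrite /I (Rintegral_chasles lg xy (ltW yc)); ring.
Qed.

Lemma primitive_continuous F g : primitive F g -> continuous F.
Proof. by move=> /primitive_AC /ACloc_continuous. Qed.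

Lemma ACloc_primitive_ae F h : ACloc F -> measurable_fun setT h ->
  {ae mu, forall x, derive1 F x = h x} -> primitive F h.
Proof.
move=> /ACloc_primitive[g Fg] mh Fh; apply: (primitive_ae_eq _ _ Fg) => //.
by apply: (aeS (aeI (primitive_ae_derivable Fg) Fh)) => x [[_ ->]].
Qed.

Lemma ACloc_primitive_aeP F h : ACloc F -> measurable_fun setT h ->
  {ae mu, forall x, derivable F x 1 -> derive1 F x = h x} -> primitive F h.
Proof.
move=> AF mh Fh; apply: ACloc_primitive_ae => //.
have [g Fg] := ACloc_primitive AF.
by apply: (aeS (aeI (primitive_ae_derivable Fg) Fh)) => x [[dF _] /(_ dF)].
Qed.

Lemma primitive_derive1 F g : primitive F g -> {ae mu, forall x, derive1 F x = g x}.
Proof. by move=> /primitive_ae_derivable /aeS; apply=> x []. Qed.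

Lemma primitive_cst c : primitive (fun=> c) (fun=> 0).
Proof.
split; first exact: locint_cst.
by move=> x y _; rewrite Rintegral_cst//= mul0r subrr.
Qed.

Lemma primitiveD F G f g : primitive F f -> primitive G g ->
  primitive (fun x => F x + G x) (fun x => f x + g x).
Proof.
move=> [lf Ff] [lg Gg]; split=> [|x y xy]; first exact: locintD.
rewrite RintegralD//; [|exact: lf.2|exact: lg.2].
by rewrite -Ff// -Gg//; ring.
Qed.

Lemma primitiveZ c F f : primitive F f -> primitive (fun x => c * F x) (fun x => c * f x).
Proof.
move=> [lf Ff]; split=> [|x y xy]; first exact: locintZ.
by rewrite RintegralZl//; [rewrite -Ff// mulrBr|exact: lf.2].
Qed.

Lemma primitiveB F G f g : primitive F f -> primitive G g ->
  primitive (fun x => F x - G x) (fun x => f x - g x).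
Proof.
move=> pF /(primitiveZ (-1)) pG; have := primitiveD pF pG.
by under [X in primitive X _]eq_fun do rewrite mulN1r;
  under [X in primitive _ X]eq_fun do rewrite mulN1r.
Qed.

(** Squares, compositions and positive parts of AC functions all reduce to this comparison of
    increments; the constant only has to be uniform on compact intervals. *)
Lemma ACloc_lip F H : ACloc F ->
  (forall a b, a <= b -> exists2 M, 0 < M & forall x y, a <= x -> x <= y -> y <= b ->
    `|H y - H x| <= M * `|F y - F x|) -> ACloc H.
Proof.
move=> AF FH a b ab; have [M M0 hM] := FH a b ab.
apply/AC_onP => e e0; have [|d d0 hd] := (AC_onP _ _ _).1 (AF a b ab) (e / M).
  by rewrite divr_gt0.
exists d => // s ns /(hd s ns); rewrite ltr_pdivlMr// => h; apply: le_lt_trans h.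
rewrite mulrC /vsum big_distrr /= big_seq [leRHS]big_seq; apply: ler_sum => p ps.
by have /andP[/allP /(_ _ ps) /and3P[h1 h2 h3] _] := ns; exact: hM.
Qed.

Lemma ACloc_D F G : ACloc F -> ACloc G -> ACloc (fun x => F x + G x).
Proof.
move=> /ACloc_primitive[f pf] /ACloc_primitive[g pg].
exact: primitive_AC (primitiveD pf pg).
Qed.

Lemma ACloc_sqr F : ACloc F -> ACloc (fun x => F x ^+ 2).
Proof.
move=> AF; apply: (ACloc_lip AF) => a b ab.
have [M M0 hM] := continuous_bounded a b (ACloc_continuous AF).
exists (M + M); first by rewrite addr_gt0.
move=> x y ax xy yb; rewrite subr_sqr normrM mulrC ler_wpM2r//.
rewrite (le_trans (ler_normD _ _))// lerD// hM//; first exact: le_trans xy.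
exact: le_trans yb.
Qed.

(** Polarization: F G = ((F + G)^2 - F^2 - G^2) / 2 reduces products to squares. *)
Lemma ACloc_M F G : ACloc F -> ACloc G -> ACloc (fun x => F x * G x).
Proof.
move=> AF AG.
have /ACloc_primitive[s ps] := ACloc_sqr (ACloc_D AF AG).
have /ACloc_primitive[f pf] := ACloc_sqr AF.
have /ACloc_primitive[g pg] := ACloc_sqr AG.
have := primitive_AC (primitiveZ 2^-1 (primitiveB ps (primitiveD pf pg))).
by congr ACloc; apply/funext => x; field.
Qed.

Lemma primitiveM F G f g : primitive F f -> primitive G g ->
  primitive (fun x => F x * G x) (fun x => f x * G x + F x * g x).
Proof.
move=> pF pG; have cF := primitive_continuous pF; have cG := primitive_continuous pG.
apply: ACloc_primitive_ae.
- exact: ACloc_M (primitive_AC pF) (primitive_AC pG).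
- apply: measurable_funD; apply: measurable_funM.
  + by case: pF => -[].
  + exact: continuous_measurable.
  + exact: continuous_measurable.
  + by case: pG => -[].
- apply: (aeS (aeI (primitive_ae_derivable pF) (primitive_ae_derivable pG))) => x.
  move=> [[dF <-] [dG <-]]; rewrite !derive1E.
  by rewrite (deriveM dF dG) /GRing.scale /= addrC mulrC.
Qed.

(* phi is only assumed differentiable on the range of F, so that phi := sqrt is allowed
   for F > 0. *)
Lemma primitive_comp (phi : R -> R) F f : primitive F f ->
  (forall x, derivable phi (F x) 1) ->
  continuous (fun x => derive1 phi (F x)) ->
  primitive (fun x => phi (F x)) (fun x => derive1 phi (F x) * f x).
Proof.
move=> pF dphi cphi; have cF := primitive_continuous pF.
apply: ACloc_primitive_aeP.
- apply: (ACloc_lip (primitive_AC pF)) => a b ab.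
  have [M M0 hM] := continuous_bounded a b cphi.
  exists M => // x y ax xy yb.
  (* By the intermediate value theorem, every point between [F x] and [F y] is a value of [F] on
     [[x, y]]; hence the mean value theorem for [phi] is applied within the range of [F], where
     [phi] is differentiable. *)
  have seg u : Num.min (F x) (F y) <= u <= Num.max (F x) (F y) ->
      exists z, [/\ a <= z, z <= b & F z = u].
    move=> /(IVT xy (continuous_subspaceT cF))[z]; rewrite in_itv /= => /andP[xz zy] <-.
    by exists z; split => //; [exact: le_trans xz|exact: le_trans yb].
  have main u v : u <= v -> (forall w, u <= w <= v -> exists z, [/\ a <= z, z <= b & F z = w]) ->
      `|phi v - phi u| <= M * `|v - u|.
    move=> uv huv.
    have [|w|w wuv ->] := @MVT_segment _ phi (derive1 phi) u v uv.
    + move=> w; rewrite in_itv /= => /andP[uw wv].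
      have [|z [_ _ zw]] := huv w; first by rewrite !ltW.
      by rewrite derive1E -zw; apply: derivableP.
    + apply: derivable_within_continuous => t; rewrite in_itv /= => /huv[z [_ _ <-]].
      exact: dphi.
    + move: wuv; rewrite in_itv /= => /huv[z [az zb <-]].
      by rewrite normrM ler_wpM2r// hM.
  have [FF|FF] := leP (F x) (F y).
    by apply: main => // w hw; apply: seg; rewrite (min_idPl FF) (max_idPr FF).
  rewrite distrC [X in _ <= M * X]distrC; apply: main; first exact: ltW.
  by move=> w hw; apply: seg; rewrite (min_idPr (ltW FF)) (max_idPl (ltW FF)).
- apply: measurable_funM; first exact: continuous_measurable.
  by case: pF => -[].
- apply: (aeS (primitive_ae_derivable pF)) => x [dF <-] _.
  by rewrite (derive1_comp dF (dphi x)).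
Qed.

Lemma mu_itvcc x y : x <= y -> mu `[x, y]%classic = (y - x)%:E.
Proof.
move=> xy; rewrite lebesgue_measure_itv /= lte_fin.
by case: ltP => //= yx; rewrite (@le_anti _ _ x y) ?subrr// xy.
Qed.

(** Integration by parts without boundary terms is always obtained from this. Outside the support
    [f] is a.e. the derivative of 0, so the integral over the line is one over a compact interval at
    whose ends [F] vanishes. *)
Lemma primitive_compact_integral F f a b : primitive F f ->
  (forall x, x < a \/ b < x -> F x = 0) ->
  mu.-integrable setT (EFin \o f) /\ \int[mu]_(t in setT) f t = 0.
Proof.
move=> pF F0; have [[mf inf] Ff] := pF.
(* [a <= b] is not assumed; the margin 1 puts [A], [B] and all points beyond them strictly outside
   the support. *)
pose A := Num.min a b - 1; pose B := Num.max a b + 1.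
have AB : A <= B.
  rewrite /A /B lerBlDr -addrA ler_wpDr//; last by rewrite le_max ge_min lexx.
have mAB : measurable `[A, B]%classic by exact: measurable_itv.
have f0 : {ae mu, forall x, (f \_ `[A, B]) x = f x}.
  apply: (aeS (primitive_derive1 pF)) => x Fx.
  rewrite patchE; case: ifPn => // /negP xAB; rewrite -Fx.
  have Aa : A < a by rewrite /A ltrBlDr (le_lt_trans (_ : _ <= a)) ?ltrDl// ge_min lexx.
  have bB : b < B by rewrite /B (le_lt_trans (_ : _ <= Num.max a b)) ?ltrDl// le_max lexx orbT.
  have dF0 : (\near x, F x = 0) -> derive1 F x = 0.
    move=> h; have [||_ ->] := @derivable_near_eq _ F (cst 0) x 0 _ _.
    + by near=> z; rewrite addr0; near: z.
    + exact: derivable_cst.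
    + by rewrite derive1_cst.
  have [xA|Ax] := ltP x A.
    apply/esym/dF0; near=> z; apply: F0; left; apply: lt_trans Aa.
    by near: z; exact: lt_nbhsl.
  have [Bx|xB] := ltP B x.
    apply/esym/dF0; near=> z; apply: F0; right; apply: lt_trans bB _.
    by near: z; exact: lt_nbhsr.
  by exfalso; apply: xAB; rewrite mem_set//= in_itv /= Ax.
have ifAB : mu.-integrable setT (EFin \o (f \_ `[A, B])).
  by rewrite -restrict_EFin; apply/integrable_restrict => //; rewrite setTI.
have f0' : {ae mu, forall x, setT x -> (f \_ `[A, B]) x = f x} by apply: (aeS f0).
have [i1 <-] := ae_eq_Rintegral measurableT mf f0' ifAB; split => //.
rewrite -Rintegral_mkcond -Ff// !F0 ?subrr//.
  by left; rewrite /A ltrBlDr (le_lt_trans (_ : _ <= a)) ?ltrDl// ge_min lexx.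
by right; rewrite /B (le_lt_trans (_ : _ <= Num.max a b)) ?ltrDl// le_max lexx orbT.
Unshelve. all: by end_near. Qed.

End PrimitiveCalculus.

(** * Projections in complete semi-inner-product spaces *)

Section SemiHilbert.
Context {R : realType} {V : lmodType R}.
Variables (D : V -> Prop) (B : V -> V -> R).
Hypotheses (D0 : D 0) (DD : forall t u v, D u -> D v -> D (t *: u + v)).
Hypotheses (BC : forall u v, D u -> D v -> B u v = B v u)
  (BD : forall t u v w, D u -> D v -> D w -> B (t *: u + v) w = t * B u w + B v w)
  (B_ge0 : forall u, D u -> 0 <= B u u).

(** [B] is only positive semidefinite, because functions equal a.e. stay distinct: a limit is
    determined up to vectors of zero norm. The predicate [D] confines the algebraic laws to
    square-integrable arguments. *)
Definition sh_cvg (h : nat -> V) (z : V) :=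
  forall e, 0 < e -> exists N, forall n, (N <= n)%N -> B (h n - z) (h n - z) < e.

Definition sh_cauchy (h : nat -> V) :=
  forall e, 0 < e -> exists N, forall m n, (N <= m)%N -> (N <= n)%N ->
    B (h m - h n) (h m - h n) < e.

Lemma shD u v : D u -> D v -> D (u + v).
Proof. by move=> Du Dv; rewrite -[u]scale1r; exact: DD. Qed.

Lemma shZ t u : D u -> D (t *: u).
Proof. by move=> Du; rewrite -[_ *: _]addr0; exact: DD. Qed.

Lemma shB u v : D u -> D v -> D (u - v).
Proof. by move=> Du Dv; rewrite -scaleN1r addrC; exact: DD. Qed.

Lemma shBDl u v w : D u -> D v -> D w -> B (u + v) w = B u w + B v w.
Proof. by move=> Du Dv Dw; rewrite -{1}[u]scale1r BD// mul1r. Qed.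

Lemma shB0l w : D w -> B 0 w = 0.
Proof. by move=> Dw; have := shBDl D0 D0 Dw; rewrite addr0; lra. Qed.

Lemma shBZl t u w : D u -> D w -> B (t *: u) w = t * B u w.
Proof. by move=> Du Dw; rewrite -[_ *: _]addr0 BD// shB0l// addr0. Qed.

Lemma shBBl u v w : D u -> D v -> D w -> B (u - v) w = B u w - B v w.
Proof. by move=> Du Dv Dw; rewrite -scaleN1r addrC BD// mulN1r addrC. Qed.

Lemma shBBr u v w : D u -> D v -> D w -> B w (u - v) = B w u - B w v.
Proof. by move=> Du Dv Dw; rewrite (BC Dw (shB Du Dv)) shBBl// (BC Du Dw) (BC Dv Dw). Qed.

Lemma shBZr t u w : D u -> D w -> B w (t *: u) = t * B w u.
Proof. by move=> Du Dw; rewrite (BC Dw (shZ t Du)) shBZl// (BC Du Dw). Qed.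

Lemma shBB u v : D u -> D v -> B (u - v) (u - v) = B u u - 2 * B u v + B v v.
Proof.
move=> Du Dv; have Duv := shB Du Dv.
by rewrite shBBl// !shBBr// (BC Dv Du); ring.
Qed.

Lemma cauchy_schwarz u v : D u -> D v -> B u v ^+ 2 <= B u u * B v v.
Proof.
move=> Du Dv.
have H t : 0 <= B u u - 2 * t * B u v + t ^+ 2 * B v v.
  have := B_ge0 (shB Du (shZ t Dv)); rewrite shBB//; last exact: shZ.
  rewrite shBZr// shBZl//; last exact: shZ.
  by rewrite shBZr// => h; apply: le_trans h _; rewrite le_eqVlt; apply/orP; left; apply/eqP; ring.
have := B_ge0 Dv; rewrite le_eqVlt => /predU1P[v0|v0].
  rewrite -v0 mulr0.
  have [->|nz] := eqVneq (B u v) 0; first by rewrite expr0n.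
  (* If [B v v = 0], the quadratic is affine in [t]; this [t] would give it the value -1. *)
  have := H ((B u u + 1) / (2 * B u v)); rewrite -v0 mulr0 addr0.
  have -> : 2 * ((B u u + 1) / (2 * B u v)) * B u v = B u u + 1 by field.
  lra.
have := H (B u v / B v v).
have -> : B u u - 2 * (B u v / B v v) * B u v + (B u v / B v v) ^+ 2 * B v v
  = (B u u * B v v - B u v ^+ 2) / B v v by field; rewrite gt_eqF.
by rewrite pmulr_lge0 ?invr_gt0// subr_ge0.
Qed.

Lemma null_orth u v : D u -> D v -> B u u = 0 -> B u v = 0.
Proof.
move=> Du Dv u0; have := cauchy_schwarz Du Dv; rewrite u0 mul0r.
by move=> h; apply/eqP; rewrite -sqrf_eq0; apply/eqP/le_anti; rewrite h sqr_ge0.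
Qed.

Lemma norm_add_le u v : D u -> D v -> B (u + v) (u + v) <= 2 * B u u + 2 * B v v.
Proof.
move=> Du Dv; have := B_ge0 (shB Du Dv); rewrite shBB//.
have -> : B (u + v) (u + v) = B u u + 2 * B u v + B v v.
  have Dw := shD Du Dv.
  by rewrite shBDl// !(BC _ Dw)// !shBDl// (BC Dv Du); ring.
lra.
Qed.

Lemma sh_cvg_cauchy h z : (forall n, D (h n)) -> D z -> sh_cvg h z -> sh_cauchy h.
Proof.
move=> Dh Dz hz e e0; have e40 : 0 < e / 4 by rewrite divr_gt0.
have [N hN] := hz _ e40; exists N => m n Nm Nn.
have -> : h m - h n = (h m - z) + (z - h n) by rewrite addrA subrK.
apply: le_lt_trans (norm_add_le _ _) _; [exact: shB|exact: shB|].
have -> : B (z - h n) (z - h n) = B (h n - z) (h n - z).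
  by rewrite !shBB// (BC Dz)//; ring.
have := hN _ Nm; have := hN _ Nn; lra.
Qed.

Lemma sh_cvg_norm h z : (forall n, D (h n)) -> D z -> sh_cvg h z ->
  forall e, 0 < e -> exists N, forall n, (N <= n)%N -> `|B (h n) (h n) - B z z| < e.
Proof.
move=> Dh Dz hz e e0; have z1 : 0 < B z z + 1 by rewrite ltr_wpDl ?B_ge0.
have c0 : 0 < Num.min (e / 2) ((e / 4) ^+ 2 / (B z z + 1)).
  by rewrite lt_min !divr_gt0// exprn_gt0// divr_gt0.
have [N hN] := hz _ c0; exists N => n /hN; rewrite lt_min => /andP[h1].
have Dhz := shB (Dh n) Dz; rewrite ltr_pdivlMr// => h2.
have E : B (h n) (h n) - B z z = B (h n - z) (h n - z) + 2 * B (h n - z) z.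
  by rewrite shBB// shBBl//; ring.
have h3 : B (h n - z) z ^+ 2 < (e / 4) ^+ 2.
  apply: le_lt_trans (cauchy_schwarz Dhz Dz) (le_lt_trans _ h2).
  by rewrite ler_wpM2l ?B_ge0// lerDl.
have h4 : `|B (h n - z) z| < e / 4.
  by rewrite -ltr_sqr ?nnegrE ?divr_ge0 ?(ltW e0)// real_normK// num_real.
rewrite E; have := B_ge0 Dhz; move: h1; move: h4; rewrite ltr_norml => /andP[].
move=> h4 h5 h1 h0; rewrite ltr_norml; apply/andP; split; lra.
Qed.

Lemma sh_cvgBr h z u : (forall n, D (h n)) -> D z -> D u -> sh_cvg h z ->
  sh_cvg (fun n => u - h n) (u - z).
Proof.
move=> Dh Dz Du hz e /hz[N hN]; exists N => n /hN.
have -> : u - h n - (u - z) = z - h n by rewrite opprB addrC addrA subrK.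
have -> : B (z - h n) (z - h n) = B (h n - z) (h n - z).
  by rewrite !shBB// (BC Dz (Dh n)); ring.
by [].
Qed.

Hypothesis complete : forall h, (forall n, D (h n)) -> sh_cauchy h ->
  exists2 z, D z & sh_cvg h z.

(** [S] need not be closed, so the nearest point is only the limit of a minimizing sequence in [S];
    [z] is the residual. A residual of zero norm will mean that [f] is a limit of elements of
    [S]. *)
Lemma projection (S : V -> Prop) f : S 0 -> (forall t u v, S u -> S v -> S (t *: u + v)) ->
  (forall u, S u -> D u) -> D f ->
  exists2 z, D z & (forall s, S s -> B s z = 0) /\
    exists2 h, (forall n, S (h n)) & sh_cvg h (f - z).
Proof.
move=> S0 SD SsD Df.
pose d := inf [set B (f - s) (f - s) | s in S].
have hinf : has_inf [set B (f - s) (f - s) | s in S].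
  split; first by exists (B (f - 0) (f - 0)), 0.
  by exists 0 => _ [s Ss <-]; apply: B_ge0; apply: shB => //; exact: SsD.
have dle s : S s -> d <= B (f - s) (f - s).
  by move=> Ss; apply: ge_inf; [exact: hinf.2|exists s].
have /choice[h hh] n : exists s, S s /\ B (f - s) (f - s) < d + n.+1%:R^-1.
  have [_ [s Ss <-] hs] := inf_adherent (ltac:(by rewrite invr_gt0) : 0 < n.+1%:R^-1 :> R) hinf.
  by exists s.
have Dh n : D (h n) by apply/SsD; exact: (hh n).1.
have cau : sh_cauchy h.
  move=> e e0; have e40 : 0 < e / 4 by rewrite divr_gt0.
  have [N _ hN] := near_infty_natSinv_lt (PosNum e40).
  have {}hN n : (N <= n)%N -> n.+1%:R^-1 < e / 4 by move=> Nn; exact: hN.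
  exists N => m n Nm Nn.
  (* The midpoint lies in [S], so the parallelogram law bounds the distance between two nearly
     minimizing points. *)
  have dmid : d <= B (f - 2^-1 *: (h m + h n)) (f - 2^-1 *: (h m + h n)).
    apply: dle; rewrite -[_ *: _]addr0; apply: (SD) => //.
    by rewrite -[h m]scale1r; apply: (SD); [exact: (hh m).1|exact: (hh n).1].
  have Dhm := Dh m; have Dhn := Dh n.
  have E : B (h m - h n) (h m - h n) = 2 * B (f - h m) (f - h m) + 2 * B (f - h n) (f - h n)
      - 4 * B (f - 2^-1 *: (h m + h n)) (f - 2^-1 *: (h m + h n)).
    have Dmn := shD Dhm Dhn; have Dz := shZ 2^-1 Dmn.
    rewrite !shBB// shBZr// shBZl// shBZr// !(BC _ Dmn)// !shBDl// (BC Dhn Df) (BC Dhm Df).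
    by rewrite !(BC _ Dmn)// !shBDl// (BC Dhn Dhm); field.
  rewrite E; move: dmid (hh m).2 (hh n).2 (hN _ Nm) (hN _ Nn).
  move: (B (f - h m) _) (B (f - h n) _) (B (f - 2^-1 *: _) _) (m.+1%:R^-1) (n.+1%:R^-1) => b1 b2 b3 i1 i2.
  by clear; lra.
have [w Dw hw] := complete Dh cau.
have Dz := shB Df Dw.
exists (f - w) => //; split; last first.
  by exists h; [move=> n; exact: (hh n).1|rewrite opprB addrC subrK].
have min s : S s -> B (f - w) (f - w) <= B (f - w - s) (f - w - s).
  move=> Ss; have Ds := SsD _ Ss.
  have c1 := sh_cvgBr Dh Dw Df hw.
  have Dfs := shB Df Ds.
  have c2 := sh_cvgBr Dh Dw Dfs hw.
  apply/ler_addgt0Pl => e e0; have e30 : 0 < e / 3 by rewrite divr_gt0.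
  have [N1 hN1] := sh_cvg_norm (fun n => shB Df (Dh n)) Dz c1 e30.
  have [N2 hN2] := sh_cvg_norm (fun n => shB Dfs (Dh n)) (shB Dfs Dw) c2 e30.
  have [N3 _ hN3] := near_infty_natSinv_lt (PosNum e30).
  pose n := maxn N1 (maxn N2 N3).
  have {}hN1 := hN1 n (leq_maxl _ _).
  have {}hN2 := hN2 n (leq_trans (leq_maxl _ _) (leq_maxr _ _)).
  have {}hN3 : n.+1%:R^-1 < e / 3 by apply: hN3; exact: (leq_trans (leq_maxr _ _) (leq_maxr _ _)).
  have h1 := (hh n).2.
  have : d <= B (f - s - h n) (f - s - h n).
    rewrite -addrA -opprD; apply: dle; rewrite -[s]scale1r; apply: (SD) => //.
    exact: (hh n).1.
  have -> : f - w - s = f - s - w by rewrite addrAC.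
  move: hN1; rewrite ltr_norml => /andP[a1 a2]; move: hN2; rewrite ltr_norml => /andP[a3 a4] h2.
  move: a1 a2 a3 a4 h2 h1 hN3.
  move: (B (f - h n) _) (B (f - s - h n) _) (B (f - w) _) (B (f - s - w) _) (n.+1%:R^-1) => b1 b2 b3 b4 i1.
  by clear; lra.
move=> s Ss; have Ds := SsD _ Ss.
apply: contrapT => /eqP ns.
have s0 : 0 < B s s.
  rewrite lt_neqAle B_ge0// andbT eq_sym; apply/eqP => s0.
  by move/eqP: ns; apply; exact: null_orth.
(* The minimizer over the line through [s]: it would lower the squared distance by
   [B s (f - w) ^+ 2 / B s s > 0]. *)
pose t := B s (f - w) / B s s.
have := min (t *: s) (ltac:(by rewrite -[_ *: _]addr0; exact: (SD))).
rewrite [X in _ <= X]shBB//; last exact: shZ.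
rewrite shBZr// shBZl//; last exact: shZ.
rewrite shBZr// (BC Dz Ds) => h0.
have : 0 < B s (f - w) ^+ 2 / B s s.
  by rewrite divr_gt0// lt_neqAle sqr_ge0 andbT eq_sym sqrf_eq0.
have -> : B s (f - w) ^+ 2 / B s s = 2 * (t * B s (f - w)) - t * (t * B s s).
  by rewrite /t; field; rewrite gt_eqF.
lra.
Qed.

(** Gram-Schmidt for a semidefinite form. The induction is over all subspaces [K], because its
    hypothesis is applied once to [K] for [z] and once to a smaller subspace for the new vector
    [w]. *)
Lemma finite_orth (K : V -> Prop) (ws : seq V) : K 0 ->
  (forall t u v, K u -> K v -> K (t *: u + v)) -> (forall u, K u -> D u) ->
  (forall w, w \in ws -> K w) -> forall z, D z ->
  exists2 k, K k & forall w, w \in ws -> B w (z - k) = 0.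
Proof.
elim: ws K => [|w ws IH] K K0 KD KsD hws z Dz; first by exists 0.
have Kw : K w by apply: hws; exact: mem_head.
have hws' u : u \in ws -> K u by move=> uw; apply: hws; rewrite in_cons uw orbT.
(* The span of [ws] described by duality: whatever is orthogonal to [ws] is orthogonal to [k1], so
   orthogonality to [v = w - k1] gives it for [w]. *)
pose K' u := K u /\ forall y, D y -> (forall w, w \in ws -> B w y = 0) -> B u y = 0.
have [k1 [Kk1 K'k1] h1] : exists2 k, K' k & forall u, u \in ws -> B u (w - k) = 0.
  apply: (IH K') => //; last exact: KsD.
  - by split=> // y Dy _; exact: shB0l.
  - move=> t u v [Ku hu] [Kv hv]; split; first exact: KD.
    move=> y Dy hy; rewrite BD//; [|exact: KsD|exact: KsD].
    by rewrite hu// hv// mulr0 addr0.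
  - by move=> u [Ku _]; exact: KsD.
  - by move=> u uw; split=> [|y _ /(_ _ uw)//]; exact: hws'.
have [k2 Kk2 h2] := IH K K0 KD KsD hws' z Dz.
pose v := w - k1.
have Kv : K v by rewrite /v -scaleN1r addrC; exact: KD.
have Dv := KsD _ Kv; have Dw := KsD _ Kw; have Dk1 := KsD _ Kk1; have Dk2 := KsD _ Kk2.
have Dzk := shB Dz Dk2.
(* When [B v v = 0], [v] is orthogonal to everything by Cauchy-Schwarz and no correction is made. *)
pose t := if B v v == 0 then 0 else B v (z - k2) / B v v.
exists (t *: v + k2); first exact: KD.
have Dtv := shZ t Dv.
have Dr : D (z - (t *: v + k2)) by apply: shB => //; exact: shD.
have E u : D u -> B u (z - (t *: v + k2)) = B u (z - k2) - t * B u v.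
  move=> Du; have -> : z - (t *: v + k2) = (z - k2) - t *: v by rewrite opprD addrCA addrC.
  by rewrite shBBr// shBZr.
have Ev : B v (z - (t *: v + k2)) = 0.
  rewrite E// /t; have [v0|v0] := eqVneq (B v v) 0; last by field.
  by rewrite mul0r subr0 null_orth.
have H u : u \in ws -> B u (z - (t *: v + k2)) = 0.
  move=> uw; have Du : D u by apply/KsD/hws; rewrite in_cons uw orbT.
  by rewrite E// h2// h1// mulr0 subr0.
move=> u; rewrite in_cons => /predU1P[->|/H//].
have -> : w = v + k1 by rewrite subrK.
by rewrite shBDl// Ev K'k1// addr0.
Qed.

End SemiHilbert.

(** * Completeness of L^2 (Riesz-Fischer) *)

Section L2.
Context {R : realType}.
Local Notation mu := (@lebesgue_measure R).

Lemma integrable_mul_sqr (E : set R) (f g : R -> R) : measurable E ->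
  measurable_fun E f -> measurable_fun E g ->
  mu.-integrable E (fun x => (f x ^+ 2)%:E) -> mu.-integrable E (fun x => (g x ^+ 2)%:E) ->
  mu.-integrable E (fun x => (f x * g x)%:E).
Proof.
move=> mE mf mg i_f ig; apply: le_integrable (integrableD _ i_f ig) => //=.
  by apply/measurable_EFinP; exact: measurable_funM.
move=> x _; rewrite lee_fin normrM [leRHS]ger0_norm ?addr_ge0 ?sqr_ge0//.
rewrite -(real_normK (num_real (f x))) -(real_normK (num_real (g x))).
have := sqr_ge0 (`|f x| - `|g x|); have := normr_ge0 (f x); have := normr_ge0 (g x); nra.
Qed.

Lemma geometric_sum_le (z : R) n : 0 <= z -> z <= 2^-1 ->
  \sum_(0 <= k < n) z ^+ k <= 2.
Proof.
move=> z0 z2; have H : \sum_(0 <= k < n) z ^+ k <= 2 - 2 * z ^+ n.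
  elim: n => [|n IH]; first by rewrite big_nil expr0; lra.
  rewrite big_nat_recr//= exprS; have := exprn_ge0 n z0.
  move: IH; set t := z ^+ n; nra.
by apply: le_trans H _; rewrite gerBl mulr_ge0// exprn_ge0.
Qed.

(** Along a subsequence with squared steps below 8^{-k}, the sum of 2^k (b_{k+1} - b_k)^2 has
    integral at most the sum of 4^{-k}, so it is finite a.e. By |y| <= 2^{-k} + 2^k y^2 the
    telescoping series then converges absolutely, and Fatou's lemma gives convergence of the full
    sequence in the mean. *)
Lemma L2_complete (a : nat -> R -> R) : (forall n, measurable_fun setT (a n)) ->
  (forall n, mu.-integrable setT (fun x => (a n x ^+ 2)%:E)) ->
  (forall e, 0 < e -> exists N, forall m n, (N <= m)%N -> (N <= n)%N ->
    \int[mu]_(x in setT) ((a m x - a n x) ^+ 2) < e) ->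
  exists b : R -> R, [/\ measurable_fun setT b, mu.-integrable setT (fun x => (b x ^+ 2)%:E) &
    forall e, 0 < e -> exists N, forall n, (N <= n)%N ->
    \int[mu]_(x in setT) ((a n x - b x) ^+ 2) < e].
Proof.
move=> ma ia cau.
have mab (f g : R -> R) : measurable_fun setT f -> measurable_fun setT g ->
    measurable_fun setT (fun x => ((f x - g x) ^+ 2)%:E).
  by move=> mf mg; apply/measurable_EFinP; apply: measurable_funX; exact: measurable_funB.
have iab (f g : R -> R) : measurable_fun setT f -> measurable_fun setT g ->
    mu.-integrable setT (fun x => (f x ^+ 2)%:E) -> mu.-integrable setT (fun x => (g x ^+ 2)%:E) ->
    mu.-integrable setT (fun x => ((f x - g x) ^+ 2)%:E).
  move=> mf mg i_f ig.
  have iD := integrableZl measurableT 2 (integrableD measurableT i_f ig).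
  apply: (le_integrable measurableT _ _ iD) => //=.
    exact: mab.
  move=> x _; rewrite lee_fin !ger0_norm ?sqr_ge0// ?mulr_ge0 ?addr_ge0 ?sqr_ge0//.
  by have := sqr_ge0 (f x + g x); nra.
have cauE e : 0 < e -> exists N, forall m n, (N <= m)%N -> (N <= n)%N ->
    (\int[mu]_(x in setT) ((a m x - a n x) ^+ 2)%:E < e%:E)%E.
  move=> /cau[N hN]; exists N => m n Nm Nn.
  rewrite -[ltLHS]fineK ?lte_fin; first exact: hN.
  by apply: integrable_fin_num => //; exact: iab.
have /choice[phi hphi] k : exists N, forall m n, (N <= m)%N -> (N <= n)%N ->
    (\int[mu]_(x in setT) ((a m x - a n x) ^+ 2)%:E < (8^-1 ^+ k)%:E)%E.
  by apply: cauE; rewrite exprn_gt0// invr_gt0.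
(* Summation makes the index nondecreasing and at least [phi k]; the successors make it at least
   [k]. *)
pose psi k := (\sum_(j < k.+1) (phi j).+1)%N.
have psi_id k : (k <= psi k)%N by elim: k => // k IH; rewrite /psi big_ord_recr /= addnS ltnS (leq_trans IH)// leq_addr.
have psi_ge k : (phi k <= psi k)%N by rewrite /psi big_ord_recr /= addnS (leq_trans (leq_addl _ _) (leqnSn _)).
have psiS k : (psi k <= psi k.+1)%N by rewrite [leqRHS]/psi big_ord_recr /= leq_addr.
have psi_mono k m : (k <= m)%N -> (psi k <= psi m)%N.
  by move=> /subnKC <-; elim: (m - k)%N => [|i IH]; rewrite ?addn0// addnS (leq_trans IH).
pose b k := a (psi k).
pose d k x := (2 ^+ k * (b k.+1 x - b k x) ^+ 2).
have d0 k x : 0 <= d k x by rewrite mulr_ge0 ?sqr_ge0// exprn_ge0.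
have md k : measurable_fun setT (fun x => (d k x)%:E).
  by apply/measurable_EFinP; apply: measurable_funM => //; apply: measurable_funX; apply: measurable_funB; exact: ma.
have id k : (\int[mu]_(x in setT) (d k x)%:E <= (4^-1 ^+ k)%:E)%E.
  have -> : (\int[mu]_(x in setT) (d k x)%:E = (2 ^+ k)%:E * \int[mu]_(x in setT) ((b k.+1 x - b k x) ^+ 2)%:E)%E.
    rewrite -ge0_integralZl//; do ?[by apply: mab; exact: ma | by move=> x _; rewrite lee_fin sqr_ge0 | by rewrite lee_fin exprn_ge0].
  have -> : (4^-1 ^+ k : R)%:E = ((2 ^+ k : R)%:E * (8^-1 ^+ k : R)%:E)%E.
    rewrite -EFinM -exprMn; congr ((_ ^+ _)%:E); by field.
  apply: lee_wpmul2l; first by rewrite lee_fin exprn_ge0.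
  by apply/ltW/hphi; [exact: leq_trans (psi_ge k) (psiS k)|exact: psi_ge].
pose G x := (\sum_(0 <= k <oo) (d k x)%:E)%E.
have mG : measurable_fun setT G by apply: ge0_emeasurable_sum => [k x _ _|k _]; [rewrite lee_fin|exact: md].
have G0 x : (0 <= G x)%E by apply: nneseries_ge0 => k _ _; rewrite lee_fin.
have iG : mu.-integrable setT G.
  apply/integrableP; split => //; under eq_integral do rewrite gee0_abs//.
  rewrite /G integral_nneseries//; last by move=> k x _; rewrite lee_fin.
  apply: (@le_lt_trans _ _ (\sum_(0 <= k <oo) (4^-1 ^+ k)%:E)%E).
    by apply: lee_nneseries => // k _ _; apply: integral_ge0 => x _; rewrite lee_fin.
  apply: (@le_lt_trans _ _ 2%:E); last exact: ltry.
  apply: lime_le; first by apply: is_cvg_nneseries => k _ _; rewrite lee_fin exprn_ge0.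
  by apply: nearW => n /=; rewrite sumEFin lee_fin; apply: geometric_sum_le; lra.
have Gfin := integrable_ae measurableT iG.
pose c x := fine (limn_esup (fun k => (b k x)%:E)).
have mc : measurable_fun setT c.
  apply: (measurableT_comp (@fine_measurable _ setT measurableT)) => //.
  by apply: measurable_fun_limn_esup => k; apply/measurable_EFinP; exact: ma.
have bc : {ae mu, forall x, b ^~ x @ \oo --> c x}.
  apply: (aeS Gfin) => x /(_ I) Gx.
  have cv : cvgn (b ^~ x).
    have -> : b ^~ x = (fun n => b 0 x + series (telescope (b ^~ x)) n).
      by apply/funext => n; exact: (eq_sum_telescope (b ^~ x)).
    apply: is_cvgD; first exact: is_cvg_cst.
    apply: (@normed_cvg _ R^o).
    apply: nondecreasing_is_cvgn; first by apply: nondecreasing_series => *; exact: normr_ge0.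
    exists (2 + fine (G x)) => _ [n _ <-].
    apply: (@le_trans _ _ (\sum_(0 <= k < n) (2^-1 ^+ k + d k x))).
      rewrite /series /=; apply: ler_sum => k _; rewrite /d /telescope /=.
      rewrite -(real_normK (num_real (b k.+1 x - b k x))).
      have := normr_ge0 (b k.+1 x - b k x); set y := `|_|.
      have : 0 < 2^-1 ^+ k :> R by rewrite exprn_gt0// invr_gt0.
      have -> : 2 ^+ k = (2^-1 ^+ k)^-1 :> R by rewrite exprVn invrK.
      move: (2^-1 ^+ k) => z z0 y0.
      rewrite -(ler_pM2r z0) mulrDl mulrAC mulVf ?gt_eqF// mul1r.
      have := sqr_ge0 (y - z); have := mulr_ge0 y0 (ltW z0); nra.
    rewrite big_split /= lerD//; first by apply: geometric_sum_le; rewrite ?invr_ge0.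
    rewrite -lee_fin fineK// -sumEFin.
    by apply: nneseries_lim_ge => k _ _; rewrite lee_fin.
  have cvE : (fun k => (b k x)%:E) @ \oo --> (limn (b ^~ x))%:E.
    by apply: cvg_EFin; [near=> k|exact: cv].
  by rewrite /c (cvg_limn_einf_sup cvE).2.
have fat e : 0 < e -> exists N, forall n, (N <= n)%N ->
    (\int[mu]_(x in setT) ((a n x - c x) ^+ 2)%:E <= e%:E)%E.
  move=> /cauE[N hN]; exists N => n Nn.
  have := fatou mu measurableT (fun k => mab _ _ (ma n) (ma (psi k))).
  move=> /(_ (fun k x _ => ltac:(by rewrite lee_fin sqr_ge0))) fa.
  have -> : (\int[mu]_(x in setT) ((a n x - c x) ^+ 2)%:E =
    \int[mu]_(x in setT) limn_einf (fun k => ((a n x - b k x) ^+ 2)%:E))%E.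
    apply: ge0_ae_eq_integral => //.
    - exact: mab.
    - apply: (measurableT_comp (@oppe_measurable _ setT)) => //.
      apply: measurable_fun_limn_esup => k.
      by apply: (measurableT_comp (@oppe_measurable _ setT)) => //; apply: mab => //; exact: ma.
    - by move=> x _; rewrite lee_fin sqr_ge0.
    - move=> x _; rewrite limn_einf_lim; apply: lime_ge; first exact: is_cvg_einfs.
      apply: nearW => k; apply: le_ereal_inf_tmp => _ [j /= _ <-].
      by rewrite lee_fin sqr_ge0.
    apply: (aeS bc) => x bx _; apply/esym.
    suff cvE : (fun k => ((a n x - b k x) ^+ 2)%:E) @ \oo --> ((a n x - c x) ^+ 2)%:E.
      by rewrite (cvg_limn_einf_sup cvE).1.
    apply: cvg_EFin; first by near=> k.
    rewrite /= expr2; under eq_fun do rewrite expr2.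
    by apply: cvgM; apply: cvgB => //; exact: cvg_cst.
  apply: le_trans fa _; rewrite limn_einf_lim; apply: lime_le; first exact: is_cvg_einfs.
  apply: nearW => k; pose m := maxn k N.
  apply: (@le_trans _ _ (\int[mu]_(x in setT) ((a n x - b m x) ^+ 2)%:E)%E).
    by apply: ereal_inf_lbound; exists m => //=; exact: leq_maxl.
  apply/ltW/hN => //; exact: leq_trans (leq_maxr k N) (psi_id m).
have ic : mu.-integrable setT (fun x => (c x ^+ 2)%:E).
  have [N hN] := fat 1 ltr01; have {}hN := hN N (leqnn N).
  have mc2 : measurable_fun setT (fun x => (c x ^+ 2)%:E).
    by apply/measurable_EFinP; exact: measurable_funX.
  have i1 : mu.-integrable setT (fun x => ((a N x - c x) ^+ 2)%:E).
    apply/integrableP; split; first exact: mab.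
    under eq_integral => x _ do rewrite gee0_abs ?lee_fin ?sqr_ge0//.
    by apply: le_lt_trans hN _; exact: ltry.
  have i2 := integrableZl measurableT 2 (integrableD measurableT i1 (ia N)).
  apply: le_integrable i2 => //=.
  move=> x _; rewrite lee_fin !ger0_norm ?sqr_ge0// ?mulr_ge0 ?addr_ge0 ?sqr_ge0//.
  by have := sqr_ge0 (2 * a N x - c x); nra.
exists c; split => // e e0; have [|N hN] := fat (e / 2); first by rewrite divr_gt0.
exists N => n /hN h; apply: (@le_lt_trans _ _ (e / 2)); last by move: e0; lra.
rewrite -lee_fin /Rintegral fineK//.
by apply: integrable_fin_num => //; exact: iab.
Unshelve. all: by end_near. Qed.
End L2.

(** * Complex L^2 functions as pairs of real functions *)

Section PairL2.
Context {R : realType}.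
Local Notation mu := (@lebesgue_measure R).

(* R^2-valued functions stand for complex-valued ones: u = u.1 + i u.2, [ip] is the real
   part of the inner product and [cmulI] is multiplication by i. *)
Definition cfun : Type := ((R -> R^o) * (R -> R^o))%type.
HB.instance Definition _ := GRing.Lmodule.on cfun.

Implicit Types (u v w : cfun) (E : set R).

Definition L2 E u := [/\ measurable_fun setT u.1, measurable_fun setT u.2,
  mu.-integrable E (fun x => (u.1 x ^+ 2)%:E) & mu.-integrable E (fun x => (u.2 x ^+ 2)%:E)].

Definition ip E u v : R := \int[mu]_(x in E) (u.1 x * v.1 x + u.2 x * v.2 x).

Lemma cfunE t u v x : ((t *: u + v).1 x = t * u.1 x + v.1 x) /\ ((t *: u + v).2 x = t * u.2 x + v.2 x).
Proof. by []. Qed.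

Lemma integrable_lin_sqr E t (f g : R -> R) : measurable E ->
  measurable_fun setT f -> measurable_fun setT g ->
  mu.-integrable E (fun x => (f x ^+ 2)%:E) -> mu.-integrable E (fun x => (g x ^+ 2)%:E) ->
  mu.-integrable E (fun x => ((t * f x + g x) ^+ 2)%:E).
Proof.
move=> mE mf mg i_f ig.
have i1 := integrableD _ (integrableZl _ (2 * t ^+ 2) i_f) (integrableZl _ 2 ig).
apply: le_integrable (i1 mE mE mE) => //=.
  apply/measurable_EFinP; apply: measurable_funTS; apply: measurable_funX.
  by apply: measurable_funD => //; apply: measurable_funM.
move=> x _; rewrite lee_fin !ger0_norm ?sqr_ge0//; last first.
  by have := mulr_ge0 (sqr_ge0 t) (sqr_ge0 (f x)); have := sqr_ge0 (g x); lra.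
have := sqr_ge0 (t * f x - g x); nra.
Qed.

Lemma L2_0 E : measurable E -> L2 E 0.
Proof.
move=> mE; have i0 : mu.-integrable E (fun x => ((0 : R) ^+ 2)%:E).
  by under eq_fun do rewrite expr0n; exact: integrable0.
by split => //; exact: measurable_cst.
Qed.

Lemma L2_lin E t u v : measurable E -> L2 E u -> L2 E v -> L2 E (t *: u + v).
Proof.
move=> mE [mu1 mu2 iu1 iu2] [mv1 mv2 iv1 iv2]; split.
- by apply: measurable_funD => //; apply: measurable_funM.
- by apply: measurable_funD => //; apply: measurable_funM.
- exact: integrable_lin_sqr.
- exact: integrable_lin_sqr.
Qed.

Lemma ip_integrable E u v : measurable E -> L2 E u -> L2 E v ->
  mu.-integrable E (EFin \o (fun x => u.1 x * v.1 x + u.2 x * v.2 x)).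
Proof.
move=> mE [mu1 mu2 iu1 iu2] [mv1 mv2 iv1 iv2].
have i1 : mu.-integrable E (fun x => (u.1 x * v.1 x)%:E).
  by apply: integrable_mul_sqr => //; exact: measurable_funTS.
have i2 : mu.-integrable E (fun x => (u.2 x * v.2 x)%:E).
  by apply: integrable_mul_sqr => //; exact: measurable_funTS.
exact: (integrableD _ i1 i2).
Qed.

Lemma ipC E u v : ip E u v = ip E v u.
Proof. by apply: eq_Rintegral => x _; rewrite mulrC [X in _ + X]mulrC. Qed.

Lemma ipD E t u v w : measurable E -> L2 E u -> L2 E v -> L2 E w ->
  ip E (t *: u + v) w = t * ip E u w + ip E v w.
Proof.
move=> mE Lu Lv Lw; have iuw := ip_integrable mE Lu Lw; have ivw := ip_integrable mE Lv Lw.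
rewrite /ip -RintegralZl// -RintegralD//; last exact: (integrableZl _ t iuw).
by apply: eq_Rintegral => x _; have [-> ->] := cfunE t u v x; ring.
Qed.

Lemma ip_ge0 E u : 0 <= ip E u u.
Proof. by apply: Rintegral_ge0 => x _; rewrite addr_ge0// -expr2 sqr_ge0. Qed.

Lemma ip_eq0 E u : measurable E -> L2 E u -> ip E u u = 0 ->
  {ae mu, forall x, E x -> u.1 x = 0 /\ u.2 x = 0}.
Proof.
move=> mE Lu u0; have iuu := ip_integrable mE Lu Lu.
pose f : R -> \bar R := fun x => (u.1 x * u.1 x + u.2 x * u.2 x)%:E.
have f0 x : (0 <= f x)%E by rewrite lee_fin addr_ge0// -expr2 sqr_ge0.
have mf : measurable_fun E f by case/integrableP: iuu.
have H : (\int[mu]_(x in E) `|f x| = 0)%E.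
  under eq_integral do rewrite gee0_abs//.
  rewrite -[LHS]fineK; last exact: integrable_fin_num.
  by congr EFin.
have [h0 _] := ae_eq_integral_abs mu mE mf; apply: (aeS (h0 H)) => x h Ex.
have /eqP := h Ex; rewrite /f /= eqe -!expr2 paddr_eq0 ?sqr_ge0// !sqrf_eq0.
by move=> /andP[/eqP -> /eqP ->].
Qed.

Lemma ae_eq_ip E u u' v : measurable E ->
  {ae mu, forall x, E x -> u.1 x = u'.1 x /\ u.2 x = u'.2 x} ->
  L2 E u -> L2 E u' -> L2 E v -> ip E u v = ip E u' v.
Proof.
move=> mE uu Lu Lu' Lv; have iu := ip_integrable mE Lu Lv.
have iu' := ip_integrable mE Lu' Lv.
apply: (ae_eq_Rintegral mE _ _ iu).2; first by case/integrableP: iu' => /measurable_EFinP.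
by apply: (aeS uu) => x /[apply] -[-> ->].
Qed.

Lemma L2_ip_complete (h : nat -> cfun) : (forall n, L2 setT (h n)) ->
  sh_cauchy (ip setT) h -> exists2 z, L2 setT z & sh_cvg (ip setT) h z.
Proof.
move=> Lh cau.
have mT : measurable (setT : set R) by [].
have LB m n : L2 setT (h m - h n).
  by rewrite addrC -scaleN1r; exact: L2_lin.
have sub (u : cfun) : L2 setT u ->
    \int[mu]_(x in setT) (u.1 x ^+ 2) <= ip setT u u /\
    \int[mu]_(x in setT) (u.2 x ^+ 2) <= ip setT u u.
  move=> Lu; have [m1 m2 i1 i2] := Lu; split; apply: le_Rintegral => //;
    try exact: (ip_integrable mT Lu Lu).
    by move=> x _; rewrite expr2 lerDl -expr2 sqr_ge0.
  by move=> x _; rewrite expr2 lerDr -expr2 sqr_ge0.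
have [|||b1 [mb1 ib1 h1]] := @L2_complete _ (fun n => (h n).1).
- by move=> n; case: (Lh n).
- by move=> n; case: (Lh n).
- move=> e /cau[N hN]; exists N => m n Nm Nn.
  exact: le_lt_trans (sub _ (LB m n)).1 (hN _ _ Nm Nn).
have [|||b2 [mb2 ib2 h2]] := @L2_complete _ (fun n => (h n).2).
- by move=> n; case: (Lh n).
- by move=> n; case: (Lh n).
- move=> e /cau[N hN]; exists N => m n Nm Nn.
  exact: le_lt_trans (sub _ (LB m n)).2 (hN _ _ Nm Nn).
pose z : cfun := (b1, b2).
have Lz : L2 setT z by split.
exists z => // e e0; have e20 : 0 < e / 2 by rewrite divr_gt0.
have [N1 hN1] := h1 _ e20; have [N2 hN2] := h2 _ e20.
exists (maxn N1 N2) => n Nn.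
have Lhz : L2 setT (h n - z) by rewrite addrC -scaleN1r; exact: L2_lin.
have [m1 m2 i1 i2] := Lhz.
have -> : ip setT (h n - z) (h n - z) = \int[mu]_(x in setT) (((h n).1 x - b1 x) ^+ 2)
    + \int[mu]_(x in setT) (((h n).2 x - b2 x) ^+ 2).
  by rewrite -RintegralD.
have := hN1 n (leq_trans (leq_maxl _ _) Nn); have := hN2 n (leq_trans (leq_maxr _ _) Nn).
lra.
Qed.

Definition cmulI u : cfun := (fun x => - u.2 x, u.1).

End PairL2.

(** * Linear systems with locally integrable coefficients *)

Section LinearODE.
Context {R : realType}.
Local Notation mu := (@lebesgue_measure R).

Lemma geometric_cvg (u : nat -> R) K : (forall k, `|u k.+1 - u k| <= K * 2^-1 ^+ k) ->
  cvgn u /\ forall k, `|u k| <= `|u 0| + 2 * K.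
Proof.
move=> h; split.
  have -> : u = (fun n => u 0 + series (telescope u) n) by apply/funext => n; exact: eq_sum_telescope.
  apply: is_cvgD; first exact: is_cvg_cst.
  apply: (@normed_cvg _ R^o); apply: (@series_le_cvg _ _ (geometric K 2^-1)) => //=.
  - by move=> n; exact: le_trans (h n).
  - apply: is_cvg_geometric_series; rewrite ger0_norm ?invr_ge0//.
    by rewrite invf_lt1 ?ltr1n.
move=> k; suff H : `|u k| <= `|u 0| + 2 * K * (1 - 2^-1 ^+ k).
  have K0 : 0 <= K by have := le_trans (normr_ge0 _) (h 0); rewrite expr0 mulr1.
  apply: le_trans H _; rewrite lerD2l.
  have : 0 <= 2^-1 ^+ k :> R by rewrite exprn_ge0// invr_ge0.
  move: (2^-1 ^+ k) => t; nra.
elim: k => [|k IH]; first by rewrite expr0 subrr mulr0 addr0.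
have -> : u k.+1 = u k + (u k.+1 - u k) by rewrite addrC subrK.
apply: le_trans (ler_normD _ _) _; apply: le_trans (lerD IH (h k)) _.
rewrite exprS; move: (2^-1 ^+ k) => t; lra.
Qed.

Lemma primitive_bound (F f H h : R -> R) x y : primitive F f -> primitive H h -> x <= y ->
  (forall t, x <= t -> t <= y -> `|f t| <= h t) -> `|F y - F x| <= H y - H x.
Proof.
move=> [lf Ff] [lh Hh] xy fh; rewrite Ff// Hh//.
apply: le_trans (le_normr_Rintegral _ (lf.2 x y)) _ => //.
apply: le_Rintegral => //; [exact: (integrable_norm (lf.2 x y))|exact: (lh.2 x y)|].
by move=> t; rewrite /= in_itv /= => /andP[]; exact: fh.
Qed.

Lemma primitive_expR (F f : R -> R) : primitive F f ->
  primitive (fun x => expR (F x)) (fun x => expR (F x) * f x).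
Proof.
move=> pF; have dE : derive1 (@expR R) = expR by apply/funext => x; rewrite derive1E; exact: (congr1 (@^~ x) (@derive_expR R)).
have := @primitive_comp _ expR _ _ pF (fun x => @derivable_expR R (F x)).
rewrite dE; apply.
by move=> x; apply: continuous_comp; [exact: (primitive_continuous pF)|exact: continuous_expR].
Qed.

Lemma cvg_ord_sum (m : nat) (u : 'I_m -> nat -> R) (l : 'I_m -> R) :
  (forall j, u j @ \oo --> l j) -> (fun k => \sum_(j < m) u j k) @ \oo --> \sum_(j < m) l j.
Proof.
elim: m u l => [|m IH] u l ul.
  by rewrite big_ord0; under eq_fun do rewrite big_ord0; exact: cvg_cst.
rewrite big_ord_recl; under eq_fun do rewrite big_ord_recl.
by apply: cvgD; [exact: ul|apply: IH => j; exact: ul].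
Qed.

Section ODE.
Variables (n : nat) (A : 'I_n -> 'I_n -> R -> R) (B : 'I_n -> R -> R) (c : R) (y0 : 'I_n -> R).
Hypotheses (lA : forall i j, locint (A i j)) (lB : forall i, locint (B i)).

Let rhs (y : 'I_n -> R -> R) i x := \sum_(j < n) A i j x * y j x + B i x.

Lemma locint_sum (m : nat) (G : 'I_m -> R -> R) : (forall j, locint (G j)) ->
  locint (fun x => \sum_(j < m) G j x).
Proof.
elim: m G => [|m IH] G lG.
  by under [X in locint X]eq_fun do rewrite big_ord0; exact: locint_cst.
under [X in locint X]eq_fun do rewrite big_ord_recl.
by apply: locintD => //; exact: IH.
Qed.

Let locint_rhs y i : (forall j, continuous (y j)) -> locint (rhs y i).
Proof.
move=> cy; apply: locintD => //; apply: locint_sum => j.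
have := locintM_continuous (cy j) (lA i j).
by under [X in locint X]eq_fun do rewrite mulrC.
Qed.

(** Continuity sits inside the existential, so that [step] is a total map and can be iterated;
    discontinuous families get an arbitrary value. *)
Let step_ex y : exists z : 'I_n -> R -> R, (forall j, continuous (y j)) ->
  forall i, primitive (z i) (rhs y i) /\ z i c = y0 i.
Proof.
have [cy|ncy] := pselect (forall j, continuous (y j)); last by exists y.
have /choice[z hz] i : exists F, primitive F (rhs y i) /\ F c = y0 i.
  by have [F h1 h2] := primitive_exists c (y0 i) (locint_rhs i cy); exists F.
by exists z => _.
Qed.

Let step y := projT1 (cid (step_ex y)).

Let stepP y : (forall j, continuous (y j)) ->
  forall i, primitive (step y i) (rhs y i) /\ step y i c = y0 i.
Proof. exact: (projT2 (cid (step_ex y))). Qed.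

Let Y k := iter k step (fun i _ => y0 i).

Let cY k i : continuous (Y k i).
Proof.
elim: k i => [|k IH] i; first by move=> x; exact: cvg_cst.
exact: primitive_continuous (stepP IH i).1.
Qed.

Let YP k i : primitive (Y k.+1 i) (rhs (Y k) i).
Proof. exact: (@stepP (Y k) (@cY k) i).1. Qed.

Let Yc k i : Y k i c = y0 i.
Proof. by case: k => [|k] //=; exact: (@stepP (Y k) (@cY k) i).2. Qed.

Let a x := \sum_(i < n) \sum_(j < n) `|A i j x|.

Let la : locint a.
Proof. by do 2 (apply: locint_sum => ?); exact: locint_norm. Qed.

Let a_ge i x : \sum_(j < n) `|A i j x| <= a x.
Proof.
rewrite /a [leRHS](bigD1 i)//= lerDl sumr_ge0// => j _; exact: sumr_ge0.
Qed.

(* Picard iterates contract by 1/2 in the weight W = e^{2m} + e^{-2m}, m a primitive of a,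
   because int_c^x a W is at most W / 2 in absolute value. *)
Let picard_bound x0 x1 : x0 <= c -> c <= x1 -> exists2 K, 0 <= K & forall k i x,
  x0 <= x -> x <= x1 -> `|Y k.+1 i x - Y k i x| <= K * 2^-1 ^+ k.
Proof.
move=> x0c cx1; have [m pm mc] := primitive_exists c 0 la.
pose W x := expR (2 * m x) + expR (- 2 * m x).
(* The primitive of [a W] that vanishes at [c]; [|S| <= W / 2] is the contraction factor. The two
   exponentials serve the two sides of [c], where [m] has opposite signs. *)
pose S x := 2^-1 * (expR (2 * m x) - expR (- 2 * m x)).
have pS : primitive S (fun x => a x * W x).
  have := primitiveZ 2^-1 (primitiveB (primitive_expR (primitiveZ 2 pm)) (primitive_expR (primitiveZ (-2) pm))).
  congr primitive; apply/funext => x; rewrite /W; by field.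
have Sc : S c = 0 by rewrite /S mc !mulr0 subrr mulr0.
have W1 x : 1 <= W x.
  rewrite /W mulNr expRN; have := expR_gt0 (2 * m x); set e := expR _ => e0.
  have : 0 < e^-1 by rewrite invr_gt0.
  have : e * e^-1 = 1 by rewrite divff ?gt_eqF.
  move: (e^-1) => e'; nra.
have SW x : `|S x| <= 2^-1 * W x.
  rewrite /S /W normrM ger0_norm ?invr_ge0// ler_wpM2l ?invr_ge0//.
  by rewrite (le_trans (ler_normB _ _))// !ger0_norm ?expR_ge0.
have a0 x : 0 <= a x by apply: sumr_ge0 => i _; exact: sumr_ge0.
have [K K0 hK] : exists2 K, 0 <= K & forall i x, x0 <= x -> x <= x1 -> `|Y 1 i x - Y 0 i x| <= K.
  have /choice[M hM] i : exists M, 0 < M /\ forall x, x0 <= x -> x <= x1 -> `|Y 1 i x - Y 0 i x| <= M.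
    have cD : continuous (fun x => Y 1 i x - Y 0 i x).
      by move=> x; apply: continuousB; exact: cY.
    by have [M M0 h] := continuous_bounded x0 x1 cD; exists M.
  exists (\sum_(i < n) M i); first by apply: sumr_ge0 => i _; apply/ltW; case: (hM i).
  move=> i x h1 h2; apply: le_trans ((hM i).2 x h1 h2) _.
  by rewrite (bigD1 i)//= lerDl sumr_ge0// => j _; apply/ltW; case: (hM j).
have [C C0 hC] : exists2 C, 0 < C & forall x, x0 <= x -> x <= x1 -> W x <= C.
  have cW : continuous W.
    exact: primitive_continuous (primitiveD (primitive_expR (primitiveZ 2 pm))
      (primitive_expR (primitiveZ (-2) pm))).
  have [C C0 h] := continuous_bounded x0 x1 cW; exists C => // x h1 h2.
  exact: le_trans (ler_norm _) (h x h1 h2).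
have main k : forall i x, x0 <= x -> x <= x1 -> `|Y k.+1 i x - Y k i x| <= K * 2^-1 ^+ k * W x.
  elim: k => [|k IH] i x h1 h2.
    by rewrite expr0 mulr1; apply: le_trans (hK i x h1 h2) _; rewrite ler_peMr.
  pose D x := Y k.+2 i x - Y k.+1 i x.
  have Dc : D c = 0 by rewrite /D !Yc subrr.
  have pD : primitive D (fun x => rhs (Y k.+1) i x - rhs (Y k) i x) by exact: primitiveB.
  have pS' := primitiveZ (K * 2^-1 ^+ k) pS.
  have est t : x0 <= t -> t <= x1 ->
      `|rhs (Y k.+1) i t - rhs (Y k) i t| <= K * 2^-1 ^+ k * (a t * W t).
    move=> t0 t1; rewrite /rhs.
    have -> : \sum_(j < n) A i j t * Y k.+1 j t + B i t - (\sum_(j < n) A i j t * Y k j t + B i t)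
        = \sum_(j < n) A i j t * (Y k.+1 j t - Y k j t).
      under [RHS]eq_bigr do rewrite mulrBr.
      by rewrite sumrB; ring.
    apply: le_trans (ler_norm_sum _ _ _) _.
    apply: (@le_trans _ _ (\sum_(j < n) `|A i j t| * (K * 2^-1 ^+ k * W t))).
      by apply: ler_sum => j _; rewrite normrM ler_wpM2l// IH.
    rewrite -big_distrl /= [leRHS]mulrCA ler_wpM2r ?a_ge//.
    by rewrite mulr_ge0 ?(le_trans ler01 (W1 t))// mulr_ge0// exprn_ge0// invr_ge0.
  have KW : `|D x| <= K * 2^-1 ^+ k * `|S x|.
    have K2 : 0 <= K * 2^-1 ^+ k by rewrite mulr_ge0// exprn_ge0// invr_ge0.
    have [cx|xc] := leP c x.
      have := primitive_bound pD pS' cx; rewrite Dc Sc mulr0 !subr0 => /(_ _)/le_trans; apply.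
        by move=> t ct tx; apply: est; [exact: le_trans ct|exact: le_trans h2].
      by rewrite ler_wpM2l// ler_norm.
    have := primitive_bound pD pS' (ltW xc); rewrite Dc Sc mulr0 !sub0r normrN => /(_ _)/le_trans; apply.
      by move=> t xt tc; apply: est; [exact: le_trans xt|exact: le_trans cx1].
    by rewrite -mulrN ler_wpM2l// -normrN ler_norm.
  apply: le_trans KW _; rewrite exprS -!mulrA; apply: ler_wpM2l => //.
  by rewrite mulrCA ler_wpM2l ?exprn_ge0 ?invr_ge0.
exists (K * C) => [|k i x h1 h2]; first by rewrite mulr_ge0// ltW.
apply: le_trans (main k i x h1 h2) _.
by rewrite mulrAC ler_wpM2r ?exprn_ge0 ?invr_ge0// ler_wpM2l// hC.
Qed.

(** On every compact interval the Picard iterates converge pointwise and are uniformly bounded, so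
    dominated convergence carries the integral equation to the limit; the majorant is a bounded
    multiple of the coefficients. *)
Lemma linear_ode : exists y : 'I_n -> R -> R, forall i, y i c = y0 i /\
  primitive (y i) (fun x => \sum_(j < n) A i j x * y j x + B i x).
Proof.
have Ycvg i x : cvgn (Y ^~ i ^~ x).
  have [x0c cx1] : Num.min c x <= c /\ c <= Num.max c x by rewrite ge_min le_max lexx.
  have [K K0 hK] := picard_bound x0c cx1.
  apply: (geometric_cvg (K := K) _).1 => k.
  by apply: hK; rewrite ?ge_min ?le_max lexx orbT.
pose y i x := limn (Y ^~ i ^~ x); exists y => i; split.
  by rewrite /y; under eq_fun do rewrite Yc; exact: lim_cst.
have my j : measurable_fun setT (y j).
  apply: (@measurable_fun_cvg _ _ _ setT (fun k => Y k j)) => [k|x _]; last exact: Ycvg.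
  by apply: continuous_measurable; exact: cY.
have mrhs : measurable_fun setT (rhs y i).
  apply: measurable_funD; last by have [] := lB i.
  apply: measurable_sum => j; apply: measurable_funM => //.
  by have [] := lA i j.
suff H x z : x <= z -> mu.-integrable `[x, z] (EFin \o rhs y i) /\
    y i z - y i x = \int[mu]_(t in `[x, z]) rhs y i t.
  split; [split=> // x z|by move=> x z /H[]].
  have [/H[]//|zx] := leP x z.
  by rewrite set_itv_ge ?bnd_simp -?ltNge//; exact: integrable_set0.
move=> xz.
have [x0c cx1] : Num.min c x <= c /\ c <= Num.max c z by rewrite ge_min le_max lexx.
have [K K0 hK] := picard_bound x0c cx1.
have bY j k t : x <= t -> t <= z -> `|Y k j t| <= `|y0 j| + 2 * K.
  move=> xt tz; have [|_ /(_ k)//] := @geometric_cvg (fun m => Y m j t) K.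
  by move=> m; apply: hK; rewrite ?ge_min ?le_max ?xt ?tz orbT.
pose dom t := \sum_(j < n) `|A i j t| * (`|y0 j| + 2 * K) + `|B i t|.
have ldom : locint dom.
  apply: locintD; last exact: locint_norm.
  apply: locint_sum => j; have := locintZ (`|y0 j| + 2 * K) (locint_norm (lA i j)).
  by under [X in locint X]eq_fun do rewrite mulrC.
have [] := @dominated_convergence _ _ _ mu `[x, z] (measurable_itv _)
  (fun k => EFin \o rhs (Y k) i) (EFin \o rhs y i) (EFin \o dom).
- by move=> k; apply/measurable_EFinP; apply: measurable_funTS; have [] := locint_rhs i (@cY k).
- by apply/measurable_EFinP; exact: measurable_funTS.
- apply: aeW => t _ /=; apply: cvg_EFin; first by near=> k.
  apply: cvgD; last exact: cvg_cst.
  apply: cvg_ord_sum => j; apply: cvgM; first exact: cvg_cst.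
  exact: Ycvg.
- exact: ldom.2.
- apply: aeW => t k; rewrite /= in_itv /= => /andP[xt tz]; rewrite lee_fin.
  apply: le_trans (ler_normD _ _) _; rewrite lerD2r.
  apply: le_trans (ler_norm_sum _ _ _) _; apply: ler_sum => j _.
  by rewrite normrM ler_wpM2l// bY.
move=> iy _ cint; split => //.
have c1 : (fun k => Y k.+1 i z - Y k.+1 i x) @ \oo --> y i z - y i x.
  by apply: cvgB; rewrite (cvg_shiftS (Y ^~ i ^~ _)); exact: Ycvg.
apply: cvg_unique c1 _ => //.
have fi : (\int[mu]_(t in `[x, z]) (EFin \o rhs y i) t)%E \is a fin_num by exact: integrable_fin_num.
move: cint; rewrite -(fineK fi) => /fine_cvg; apply: cvg_trans.
by apply: near_eq_cvg; near=> k => /=; rewrite (YP k i).2.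
Unshelve. all: by end_near. Qed.
End ODE.
End LinearODE.

(** * Extension by zero outside an interval *)

Section Cut.
Context {R : realType}.
Local Notation mu := (@lebesgue_measure R).

Lemma ae_zero_continuous (F : R -> R) (P : set R) : open P -> continuous F ->
  {ae mu, forall x, P x -> F x = 0} -> forall x, P x -> F x = 0.
Proof.
move=> oP cF [N [mN N0 hN]] x Px; apply: contrapT => /eqP Fx.
have Fx0 : nbhs (F x) [set z | z != 0] by apply: open_nbhs_nbhs; split; [exact: open_neq|].
have /nbhs_ballP[d /= d0 hd] : \forall y \near x, P y /\ F y != 0.
  near=> y; split; first by near: y; exact: open_nbhs_nbhs.
  by near: y; exact: (cF x _ Fx0).
have sub : `[x, x + d / 2]%classic `<=` N.
  move=> y /=; rewrite in_itv /= => /andP[h1 h2]; apply: hN => /=.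
  have [Py Fy] : P y /\ F y != 0.
    apply: hd; rewrite /ball /= ltr_distlC; move: d0 h1 h2; lra.
  by move=> /(_ Py) /eqP; apply/negP.
pose I := `[x, x + d / 2]%classic.
have : (mu I <= mu N)%E.
  by apply: le_measure; [apply/mem_set; exact: measurable_itv|exact/mem_set|].
have -> : mu I = (d / 2)%:E by rewrite mu_itvcc ?lerDl ?divr_ge0 ?(ltW d0)// addrAC subrr add0r.
by rewrite N0 lee_fin leNgt divr_gt0.
Unshelve. all: by end_near. Qed.

Definition cut (a b : R) (F : R -> R) x := if a <= x <= b then F x else 0.

Lemma cutE a b F : cut a b F = F \_ `[a, b].
Proof.
apply/funext => x; rewrite /cut patchE; case: ifPn => h; first by rewrite mem_set.
by rewrite memNset//= in_itv /=; exact/negP.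
Qed.

Lemma measurable_cut a b F : measurable_fun setT F -> measurable_fun setT (cut a b F).
Proof.
move=> mF; rewrite cutE; apply/(measurable_restrictT _ _).1; first exact: measurable_itv.
exact: measurable_funTS.
Qed.

Lemma Rintegral_cut a b F : \int[mu]_(x in setT) cut a b F x = \int[mu]_(x in `[a, b]) F x.
Proof. by rewrite cutE -Rintegral_mkcond. Qed.

Lemma integrable_cut a b F : locint F -> mu.-integrable setT (EFin \o cut a b F).
Proof.
move=> [_ iF]; rewrite cutE -restrict_EFin; apply/integrable_restrict => //.
by rewrite setTI.
Qed.

Lemma locint_cut a b F : locint F -> locint (cut a b F).
Proof.
move=> lF; split; first by apply: measurable_cut; case: lF.
by move=> x y; apply: integrableS (integrable_cut a b lF).
Qed.

(** The zero values at both ends prevent a jump of the extension. *)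
Lemma primitive_cut a b F f : a <= b -> primitive F f -> F a = 0 -> F b = 0 ->
  primitive (cut a b F) (cut a b f).
Proof.
move=> ab [lf Ff] Fa Fb; split=> [|x y xy]; first exact: locint_cut.
have E : \int[mu]_(t in `[x, y]) cut a b f t = \int[mu]_(t in `[Num.max x a, Num.min y b]) f t.
  rewrite cutE -Rintegral_mkcondr; congr Rintegral.
  apply/seteqP; split => t /=; rewrite !in_itv /= ge_max le_min.
    by move=> [/andP[-> ->] /andP[-> ->]].
  by move=> /andP[/andP[-> ->] /andP[-> ->]].
rewrite E; have [h|h] := leP (Num.max x a) (Num.min y b).
  rewrite -Ff//; move: h; rewrite ge_max !le_min => /andP[/andP[_ xb] /andP[ay _]].
  have [ax|xa] := leP a x; have [yb|by_] := leP y b.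
  - by rewrite /cut ay yb ax xb.
  - by rewrite /cut ay ax xb (lt_geF by_) /= Fb.
  - by rewrite /cut ay yb (lt_geF xa) /= Fa.
  - by rewrite /cut ay (lt_geF by_) (lt_geF xa) /= Fa Fb.
rewrite set_itv_ge ?bnd_simp -?ltNge// Rintegral_set0 /cut.
have [ya|ay] := ltP y a; first by rewrite (lt_geF (le_lt_trans xy ya)) /= subrr.
have [bx|xb] := ltP b x; first by rewrite (lt_geF (lt_le_trans bx xy)) !andbF /= subrr.
exfalso; move: h; rewrite ltNge => /negP; apply.
by rewrite ge_max !le_min xy xb ay ab.
Qed.

End Cut.

(** * The quasi-differential equation in real coordinates *)

Section QuasiDifferential.
Context {R : realType}.
Local Notation mu := (@lebesgue_measure R).
Variables (p Q r s : R -> R).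

Definition qW x := (Q x ^+ 2 + r x ^+ 2) / p x - s x.

Implicit Types (u v w f g h k : cfun (R := R)).

(* u1 is the quasi-derivative u^[1] and l[u] = f, solved for u' and (u^[1])'. *)
Definition qsol u u1 f :=
  [/\ primitive u.1 (fun x => (u1.1 x + Q x * u.1 x - r x * u.2 x) / p x),
      primitive u.2 (fun x => (u1.2 x + Q x * u.2 x + r x * u.1 x) / p x),
      primitive u1.1 (fun x => - ((Q x * u1.1 x + r x * u1.2 x) / p x) - qW x * u.1 x - f.1 x) &
      primitive u1.2 (fun x => - ((Q x * u1.2 x - r x * u1.1 x) / p x) - qW x * u.2 x - f.2 x)].

Lemma primitive_eq (F F' f f' : R -> R) : primitive F f -> F =1 F' -> f =1 f' -> primitive F' f'.
Proof. by move=> + /funext <- /funext <-. Qed.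

Lemma primitive_lin t (F G f g : R -> R) : primitive F f -> primitive G g ->
  primitive (fun x => t * F x + G x) (fun x => t * f x + g x).
Proof. by move=> pF pG; exact: primitiveD (primitiveZ t pF) pG. Qed.

Lemma qsol_lin t u u1 f v v1 g : qsol u u1 f -> qsol v v1 g ->
  qsol (t *: u + v) (t *: u1 + v1) (t *: f + g).
Proof.
move=> [a1 a2 a3 a4] [b1 b2 b3 b4]; split.
- apply: primitive_eq (primitive_lin t a1 b1) _ _ => x; cbv beta; first by [].
  have [E1 E2] := cfunE t u v x; have [E3 E4] := cfunE t u1 v1 x; have [E5 E6] := cfunE t f g x.
  by rewrite ?E1 ?E2 ?E3 ?E4 ?E5 ?E6; ring.
- apply: primitive_eq (primitive_lin t a2 b2) _ _ => x; cbv beta; first by [].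
  have [E1 E2] := cfunE t u v x; have [E3 E4] := cfunE t u1 v1 x; have [E5 E6] := cfunE t f g x.
  by rewrite ?E1 ?E2 ?E3 ?E4 ?E5 ?E6; ring.
- apply: primitive_eq (primitive_lin t a3 b3) _ _ => x; cbv beta; first by [].
  have [E1 E2] := cfunE t u v x; have [E3 E4] := cfunE t u1 v1 x; have [E5 E6] := cfunE t f g x.
  by rewrite ?E1 ?E2 ?E3 ?E4 ?E5 ?E6; ring.
- apply: primitive_eq (primitive_lin t a4 b4) _ _ => x; cbv beta; first by [].
  have [E1 E2] := cfunE t u v x; have [E3 E4] := cfunE t u1 v1 x; have [E5 E6] := cfunE t f g x.
  by rewrite ?E1 ?E2 ?E3 ?E4 ?E5 ?E6; ring.
Qed.

Lemma qsol_cmulI u u1 f : qsol u u1 f -> qsol (cmulI u) (cmulI u1) (cmulI f).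
Proof.
move=> [a1 a2 a3 a4]; split => /=.
- by apply: primitive_eq (primitiveZ (-1) a2) _ _ => x; rewrite ?mulN1r//; ring.
- by apply: primitive_eq a1 _ _ => x //; ring.
- by apply: primitive_eq (primitiveZ (-1) a4) _ _ => x; rewrite ?mulN1r//; ring.
- by apply: primitive_eq a3 _ _ => x //; ring.
Qed.

(** The real part of the Lagrange bracket u conj(v^[1]) - u^[1] conj(v). *)
Definition boundary_form u u1 v v1 x := u.1 x * v1.1 x + u.2 x * v1.2 x - u1.1 x * v.1 x - u1.2 x * v.2 x.

(** Lagrange's identity: the expression l is formally symmetric, so all terms with [p], [Q], [r] and
    [qW] cancel in the derivative of the bracket. *)
Lemma primitive_boundary_form u u1 f v v1 k : qsol u u1 f -> qsol v v1 k ->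
  primitive (boundary_form u u1 v v1)
    (fun x => (f.1 x * v.1 x + f.2 x * v.2 x) - (u.1 x * k.1 x + u.2 x * k.2 x)).
Proof.
move=> [a1 a2 a3 a4] [b1 b2 b3 b4].
have := primitiveB (primitiveB (primitiveD (primitiveM a1 b3) (primitiveM a2 b4))
  (primitiveM a3 b1)) (primitiveM a4 b2).
by move=> h; apply: primitive_eq h _ _ => x //; ring.
Qed.

Hypotheses (mQ : measurable_fun setT Q) (mr : measurable_fun setT r)
  (lp : locint (fun x => (p x)^-1)) (lQ : locint (fun x => Q x / p x))
  (lr : locint (fun x => r x / p x)) (lW : locint qW) (p0 : forall x, 0 < p x).

Lemma qsol_exists f c d1 d2 d3 d4 : locint f.1 -> locint f.2 ->
  exists u u1, qsol u u1 f /\ [/\ u.1 c = d1, u.2 c = d2, u1.1 c = d3 & u1.2 c = d4].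
Proof.
move=> lf1 lf2.
(* Rows and columns are in the order [u.1], [u.2], [u1.1], [u1.2]. *)
pose M : seq (seq (R -> R)) := [::
  [:: (fun x => Q x / p x); (fun x => - (r x / p x)); (fun x => (p x)^-1); (fun=> 0)];
  [:: (fun x => r x / p x); (fun x => Q x / p x); (fun=> 0); (fun x => (p x)^-1)];
  [:: (fun x => - qW x); (fun=> 0); (fun x => - (Q x / p x)); (fun x => - (r x / p x))];
  [:: (fun=> 0); (fun x => - qW x); (fun x => r x / p x); (fun x => - (Q x / p x))]].
pose A (i j : 'I_4) := nth (fun=> 0) (nth [::] M i) j.
pose b (i : 'I_4) := nth (fun=> 0) [:: (fun=> 0); (fun=> 0); (fun x => - f.1 x); (fun x => - f.2 x)] i.
pose y0 (i : 'I_4) := nth 0 [:: d1; d2; d3; d4] i.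
have lA i j : locint (A i j).
  rewrite /A; case: i => -[|[|[|[|//]]]] /= _; case: j => -[|[|[|[|//]]]] /= _ //;
    first [exact: locint_cst|exact: (locintN lr)|exact: (locintN lQ)|exact: (locintN lW)].
have lb i : locint (b i).
  rewrite /b; case: i => -[|[|[|[|//]]]] /= _; [exact: locint_cst|exact: locint_cst|exact: (locintN lf1)|exact: (locintN lf2)].
have [y hy] := linear_ode c y0 lA lb.
pose i0 : 'I_4 := @Ordinal 4 0 isT; pose i1 : 'I_4 := @Ordinal 4 1 isT.
pose i2 : 'I_4 := @Ordinal 4 2 isT; pose i3 : 'I_4 := @Ordinal 4 3 isT.
exists (y i0, y i1), (y i2, y i3); split; last by split; [case: (hy i0)|case: (hy i1)|case: (hy i2)|case: (hy i3)].
have S x i : \sum_(j < 4) A i j x * y j x =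
    A i i0 x * y i0 x + A i i1 x * y i1 x + A i i2 x * y i2 x + A i i3 x * y i3 x.
  have e0 : ord0 = i0 by exact: val_inj.
  have e1 : lift ord0 (ord0 : 'I_3) = i1 by exact: val_inj.
  have e2 : lift ord0 (lift ord0 (ord0 : 'I_2)) = i2 by exact: val_inj.
  have e3 : lift ord0 (lift ord0 (lift ord0 (ord0 : 'I_1))) = i3 by exact: val_inj.
  by rewrite !big_ord_recl big_ord0 addr0 !addrA e1 e2 e3 e0.
split => /=.
- apply: primitive_eq (hy i0).2 _ _ => x //; rewrite S /A /b /=; ring.
- apply: primitive_eq (hy i1).2 _ _ => x //; rewrite S /A /b /=; ring.
- apply: primitive_eq (hy i2).2 _ _ => x //; rewrite S /A /b /=; ring.
- apply: primitive_eq (hy i3).2 _ _ => x //; rewrite S /A /b /=; ring.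
Qed.

End QuasiDifferential.

(** * Regularity of weak solutions *)

Section Regularity.
Context {R : realType}.
Local Notation mu := (@lebesgue_measure R).
Variables (p Q r s : R -> R).
Hypotheses (lp : locint (fun x => (p x)^-1)) (lQ : locint (fun x => Q x / p x))
  (lr : locint (fun x => r x / p x)) (lW : locint (qW p Q r s)) (p0 : forall x, 0 < p x).
Local Notation qsol := (qsol p Q r s).
Implicit Types (u v w f g h k : cfun (R := R)) (a b c : R).

Lemma L2_continuous u a b : continuous u.1 -> continuous u.2 -> L2 `[a, b] u.
Proof.
move=> c1 c2.
have sq (F : R -> R) : continuous F -> mu.-integrable `[a, b] (fun x => (F x ^+ 2)%:E).
  move=> cF; have [_ /(_ a b)] := locintM_continuous cF (locint_continuous cF).
  by apply: eq_integrable => // x _ /=; rewrite expr2.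
by split; [exact: continuous_measurable|exact: continuous_measurable|exact: sq|exact: sq].
Qed.

Lemma qsol_continuous u u1 f : qsol u u1 f ->
  [/\ continuous u.1, continuous u.2, continuous u1.1 & continuous u1.2].
Proof.
by move=> [a1 a2 a3 a4]; split; [exact: primitive_continuous a1|exact: primitive_continuous a2
  |exact: primitive_continuous a3|exact: primitive_continuous a4].
Qed.

Lemma L2_qsol u u1 f a b : qsol u u1 f -> L2 `[a, b] u.
Proof. by move=> /qsol_continuous[c1 c2 _ _]; exact: L2_continuous. Qed.

Lemma L2_setT_itv u a b : L2 setT u -> L2 `[a, b] u.
Proof. by move=> [m1 m2 i1 i2]; split => //; [apply: integrableS i1|apply: integrableS i2]. Qed.

Lemma L2_locint u : L2 setT u -> locint u.1 /\ locint u.2.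
Proof.
move=> [m1 m2 i1 i2]; split; apply: locint_sqr => //; split=> [|x y].
- exact: measurable_funX.
- exact: integrableS i1.
- exact: measurable_funX.
- exact: integrableS i2.
Qed.

Definition ccut a b u : cfun (R := R) := (cut a b u.1, cut a b u.2).

Lemma L2_ccut u a b : L2 `[a, b] u -> L2 setT (ccut a b u).
Proof.
move=> [m1 m2 i1 i2]; split; try exact: measurable_cut.
- have : mu.-integrable setT (fun x => (cut a b (fun x => u.1 x ^+ 2) x)%:E).
    rewrite cutE; under eq_fun do rewrite -/((EFin \o _) _) -restrict_EFin.
    by apply/integrable_restrict => //; rewrite setTI.
  by apply: eq_integrable => // x _; rewrite /= /cut; case: ifP => //; rewrite expr0n.
- have : mu.-integrable setT (fun x => (cut a b (fun x => u.2 x ^+ 2) x)%:E).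
    rewrite cutE; under eq_fun do rewrite -/((EFin \o _) _) -restrict_EFin.
    by apply/integrable_restrict => //; rewrite setTI.
  by apply: eq_integrable => // x _; rewrite /= /cut; case: ifP => //; rewrite expr0n.
Qed.

Lemma derive1_zero_open (F : R -> R) (P : set R) : open P -> (forall x, P x -> F x = 0) ->
  forall x, P x -> derive1 F x = 0.
Proof.
move=> oP FP x Px; have [||_ ->] := @derivable_near_eq _ F (cst 0) x 0 _ _.
- by near=> z; rewrite addr0; apply: FP; near: z; exact: open_nbhs_nbhs.
- exact: derivable_cst.
- by rewrite derive1_cst.
Unshelve. all: by end_near. Qed.

(** Where [u] vanishes on an open set, the equation reads 0 = u' = u^[1] / p a.e.; continuity of
    u^[1] removes the exceptional set. *)
Lemma qsol_quasi_derivative0 u u1 f (P : set R) : open P -> qsol u u1 f ->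
  (forall x, P x -> u.1 x = 0 /\ u.2 x = 0) -> forall x, P x -> u1.1 x = 0 /\ u1.2 x = 0.
Proof.
move=> oP qu uP; have [_ _ c3 c4] := qsol_continuous qu; have [a1 a2 _ _] := qu.
have z1 := derive1_zero_open oP (fun x Px => (uP x Px).1).
have z2 := derive1_zero_open oP (fun x Px => (uP x Px).2).
have e1 : {ae mu, forall x, P x -> u1.1 x = 0}.
  apply: (aeS (primitive_derive1 a1)) => x + Px; rewrite z1// => /esym/eqP.
  have [-> ->] := uP _ Px; rewrite !mulr0 addr0 subr0 mulf_eq0 invr_eq0 (gt_eqF (p0 x)) orbF.
  by move/eqP.
have e2 : {ae mu, forall x, P x -> u1.2 x = 0}.
  apply: (aeS (primitive_derive1 a2)) => x + Px; rewrite z2// => /esym/eqP.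
  have [-> ->] := uP _ Px; rewrite !mulr0 !addr0 mulf_eq0 invr_eq0 (gt_eqF (p0 x)) orbF.
  by move/eqP.
by move=> x Px; split; [exact: (ae_zero_continuous oP c3 e1)|exact: (ae_zero_continuous oP c4 e2)].
Qed.

Lemma locint0 : locint (0 : cfun (R := R)).1 /\ locint (0 : cfun (R := R)).2.
Proof. by split; exact: locint_cst. Qed.

Lemma boundary_form_const u u1 v v1 : qsol u u1 0 -> qsol v v1 0 ->
  forall x y, boundary_form u u1 v v1 x = boundary_form u u1 v v1 y.
Proof.
move=> qu qv; have H x y : x <= y -> boundary_form u u1 v v1 y - boundary_form u u1 v v1 x = 0.
  move=> /(primitive_boundary_form qu qv).2 ->.
  rewrite (_ : (fun t : R => _) = fun=> 0) ?Rintegral_cst ?mul0r//.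
  by apply/funext => t; rewrite /= !(mul0r, mulr0, addr0, subr0).
move=> x y; apply/eqP; rewrite -subr_eq0; have [/H h|/ltW/H ->//] := leP x y.
by rewrite -oppr_eq0 opprB h.
Qed.

(* The boundary form is constant; pair u with the solution whose data at x are the
   values of (-u^[1], u) at x. *)
Lemma qsol_unique u u1 c : qsol u u1 0 -> u.1 c = 0 /\ u.2 c = 0 ->
  u1.1 c = 0 /\ u1.2 c = 0 -> forall x, u.1 x = 0 /\ u.2 x = 0.
Proof.
move=> qu [uc1 uc2] [uc3 uc4] x; have [l1 l2] := locint0.
have [w [w1 [qw [w1x w2x w3x w4x]]]] :=
  qsol_exists lp lQ lr lW x (- u1.1 x) (- u1.2 x) (u.1 x) (u.2 x) l1 l2.
have := boundary_form_const qu qw x c.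
rewrite /boundary_form uc1 uc2 uc3 uc4 !mul0r !(addr0, subr0) w1x w2x w3x w4x => h.
have h' : u.1 x ^+ 2 + u.2 x ^+ 2 + u1.1 x ^+ 2 + u1.2 x ^+ 2 = 0 by rewrite -[RHS]h; ring.
have := sqr_ge0 (u.1 x); have := sqr_ge0 (u.2 x); have := sqr_ge0 (u1.1 x); have := sqr_ge0 (u1.2 x).
move=> h4 h3 h2 h1.
have e1 : u.1 x ^+ 2 = 0 by apply/le_anti; rewrite h1 andbT; move: h' h1 h2 h3 h4; lra.
have e2 : u.2 x ^+ 2 = 0 by apply/le_anti; rewrite h2 andbT; move: h' h1 h2 h3 h4; lra.
by move/eqP: e1; rewrite sqrf_eq0 => /eqP ->; move/eqP: e2; rewrite sqrf_eq0 => /eqP ->.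
Qed.

Definition csupp u := exists a b, forall x, x < a \/ b < x -> u.1 x = 0 /\ u.2 x = 0.

(** [Lmax] and [L00] in real coordinates; [LmaxP] and [L00P] give the equivalence. *)
Definition Lmaxv u f := [/\ L2 setT u, L2 setT f & exists u1, qsol u u1 f].
Definition L00v u f := Lmaxv u f /\ csupp u.

Lemma measurable_setT_real : measurable (setT : set R). Proof. by []. Qed.
Hint Resolve measurable_setT_real : core.

(** Both [g] and its quasi-derivative vanish outside the support interval, so the Lagrange bracket
    has compact support and its derivative integrates to 0. *)
Lemma Lagrange_compact u f g h : Lmaxv u f -> L00v g h -> ip setT h u = ip setT g f.
Proof.
move=> [Lu Lf [u1 qu]] [[Lg Lh [g1 qg]] [a [b gab]]].
have pb := primitive_boundary_form qg qu.
have oa : open [set x | x < a] by exact: open_lt.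
have ob : open [set x | b < x] by exact: open_gt.
have ga := qsol_quasi_derivative0 oa qg (fun x xa => gab x (or_introl xa)).
have gb := qsol_quasi_derivative0 ob qg (fun x xb => gab x (or_intror xb)).
have b0 x : x < a \/ b < x -> boundary_form g g1 u u1 x = 0.
  move=> xab; rewrite /boundary_form; have [-> ->] := gab _ xab.
  have [-> ->] : g1.1 x = 0 /\ g1.2 x = 0 by case: xab => [/ga|/gb].
  by rewrite !mul0r !subr0 addr0.
have [_ h0] := primitive_compact_integral pb b0.
apply/eqP; rewrite -subr_eq0 -[X in _ == X]h0 /ip; apply/eqP/esym.
by apply: RintegralB => //; exact: ip_integrable.
Qed.

(* If v solves l[v] = f on [a, b], then z = u - v - k is made orthogonal to the solutions
   w_i of l[w] = 0 with unit data at b. The solution g of l[g] = z with zero data at a then also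
   has zero data at b, so its extension by 0 is an admissible test function. *)
Lemma local_representation u f a b : a <= b -> L2 setT u -> L2 setT f ->
  (forall g h, L00v g h -> ip setT h u = ip setT g f) ->
  exists y y1, qsol y y1 f /\ {ae mu, forall x, `[a, b]%classic x -> u.1 x = y.1 x /\ u.2 x = y.2 x}.
Proof.
move=> ab Lu Lf H; have [lf1 lf2] := L2_locint Lf; have [l1 l2] := locint0.
have mE : measurable (`[a, b]%classic : set R) by exact: measurable_itv.
pose E : set R := `[a, b]%classic.
have [v [v1 [qv _]]] := qsol_exists lp lQ lr lW a 0 0 0 0 lf1 lf2.
have LuE : L2 E u by exact: L2_setT_itv.
have LvE : L2 E v by exact: L2_qsol qv.
have LfE : L2 E f by exact: L2_setT_itv.
have LB x y : L2 E x -> L2 E y -> L2 E (x - y).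
  by move=> Lx Ly; rewrite addrC -scaleN1r; exact: L2_lin.
have [w1 [w11 [qw1 [dw11 dw12 dw13 dw14]]]] := qsol_exists lp lQ lr lW b 1 0 0 0 l1 l2.
have [w2 [w21 [qw2 [dw21 dw22 dw23 dw24]]]] := qsol_exists lp lQ lr lW b 0 1 0 0 l1 l2.
have [w3 [w31 [qw3 [dw31 dw32 dw33 dw34]]]] := qsol_exists lp lQ lr lW b 0 0 1 0 l1 l2.
have [w4 [w41 [qw4 [dw41 dw42 dw43 dw44]]]] := qsol_exists lp lQ lr lW b 0 0 0 1 l1 l2.
pose K k := exists k1, qsol k k1 0.
pose ws : seq (cfun (R := R)) := [:: w1; w2; w3; w4].
have K0 : K 0.
  by exists 0; split; apply: primitive_eq (primitive_cst 0) _ _ => x //=;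
    rewrite !(mulr0, addr0, subr0, mul0r, oppr0).
have KD t x y : K x -> K y -> K (t *: x + y).
  by move=> [x1 qx] [y1 /(qsol_lin t qx)]; rewrite scaler0 addr0 => q; exists (t *: x1 + y1).
have KL x : K x -> L2 E x by move=> [x1 qx]; exact: L2_qsol qx.
have Kws w : w \in ws -> K w.
  by rewrite !inE => /or4P[] /eqP ->; [exists w11|exists w21|exists w31|exists w41].
have [k [k1 qk] hk] := @finite_orth _ _ (L2 E) (ip E) (L2_0 mE) (fun t x y => @L2_lin _ E t x y mE)
  (fun x y _ _ => ipC E x y) (fun t x y z => @ipD _ E t x y z mE) (fun x _ => ip_ge0 E x)
  K ws K0 KD KL Kws (u - v) (LB _ _ LuE LvE).
have LkE := KL _ (ex_intro _ k1 qk).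
pose z := u - v - k.
have LzE : L2 E z by exact: LB (LB _ _ LuE LvE) LkE.
pose h := ccut a b z.
have Lh : L2 setT h by exact: L2_ccut.
have [lh1 lh2] := L2_locint Lh.
have [g [g1 [qg [dg1 dg2 dg3 dg4]]]] := qsol_exists lp lQ lr lW a 0 0 0 0 lh1 lh2.
have hE y : ip E h y = ip E z y.
  apply: eq_Rintegral => x /set_mem; rewrite /E /= in_itv /= => xE.
  by rewrite /h /= /cut xE.
have LhE : L2 E h by exact: L2_setT_itv.
(* Green's formula on [[a, b]]; only the bracket at [b] remains, since [g] has zero data at [a]. *)
have Gr y y1 phi : qsol y y1 phi -> L2 E phi -> ip E h y - ip E g phi = boundary_form g g1 y y1 b.
  move=> qy Lphi; have := (primitive_boundary_form qg qy).2 _ _ ab.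
  have -> : boundary_form g g1 y y1 a = 0 by rewrite /boundary_form dg1 dg2 dg3 dg4; ring.
  rewrite subr0 => ->; rewrite /ip -RintegralB//; apply: ip_integrable => //.
    exact: L2_qsol qy.
  exact: L2_qsol qg.
have L0E : L2 E 0 by exact: L2_0.
have g0 y : ip E y 0 = 0.
  rewrite /ip (_ : (fun x => _) = fun=> 0) ?Rintegral_cst ?mul0r//.
  by apply/funext => t; rewrite /= !(mulr0, addr0).
have Gw w w' : w \in ws -> qsol w w' 0 -> boundary_form g g1 w w' b = 0.
  move=> hw qw; rewrite -(Gr _ _ _ qw L0E) g0 subr0 hE ipC; exact: hk.
(* With unit data at [b], the bracket with each [w_i] reads off, up to sign, one component of the
   data of [g]. *)
have g1b : g1.1 b = 0.
  have := Gw w1 w11 (ltac:(by rewrite !inE eqxx)) qw1.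
  by rewrite /boundary_form dw11 dw12 dw13 dw14; lra.
have g2b : g1.2 b = 0.
  have := Gw w2 w21 (ltac:(by rewrite !inE eqxx ?orbT)) qw2.
  by rewrite /boundary_form dw21 dw22 dw23 dw24; lra.
have g3b : g.1 b = 0.
  have := Gw w3 w31 (ltac:(by rewrite !inE eqxx ?orbT)) qw3.
  by rewrite /boundary_form dw31 dw32 dw33 dw34; lra.
have g4b : g.2 b = 0.
  have := Gw w4 w41 (ltac:(by rewrite !inE eqxx ?orbT)) qw4.
  by rewrite /boundary_form dw41 dw42 dw43 dw44; lra.
have LgE : L2 E g by exact: L2_qsol qg.
have Lg' : L2 setT (ccut a b g) by exact: L2_ccut.
have qg' : qsol (ccut a b g) (ccut a b g1) h.
  have [q1 q2 q3 q4] := qg.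
  split; [apply: primitive_eq (primitive_cut ab q1 _ _) _ _|apply: primitive_eq (primitive_cut ab q2 _ _) _ _
    |apply: primitive_eq (primitive_cut ab q3 _ _) _ _|apply: primitive_eq (primitive_cut ab q4 _ _) _ _] => // x;
    rewrite /h /= /cut; case: ifP => xE; rewrite ?xE ?(mulr0, addr0, subr0, mul0r, oppr0)//.
have Lgh : L00v (ccut a b g) h.
  split; first by split; [exact: Lg'|exact: Lh|exists (ccut a b g1); exact: qg'].
  exists a, b => x xab; rewrite /= /cut.
  by case: xab => [xa|bx]; rewrite ?(lt_geF xa) ?(lt_geF bx) ?andbF.
have := H _ _ Lgh.
have -> : ip setT h u = ip E z u.
  rewrite -hE /ip -Rintegral_cut; apply: eq_Rintegral => x _.
  by rewrite /h /= /cut; case: ifP => //; rewrite !mul0r addr0.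
have -> : ip setT (ccut a b g) f = ip E g f.
  rewrite /ip -Rintegral_cut; apply: eq_Rintegral => x _.
  by rewrite /= /cut; case: ifP => //; rewrite !mul0r addr0.
have bv : ip E h v - ip E g f = 0.
  by rewrite (Gr _ _ _ qv LfE) /boundary_form g1b g2b g3b g4b; ring.
have bk : ip E h k = 0.
  have := Gr _ _ _ qk L0E; rewrite g0 subr0 => ->.
  by rewrite /boundary_form g1b g2b g3b g4b; ring.
move=> zu; move: bv bk; rewrite !hE => zv zk.
(* Testing the weak equation with [g] gives [(z, u) = (g, f)], Green's formula for [v] gives
   [(z, v) = (g, f)], and [z] is orthogonal to [k]; hence [z = u - v - k] is orthogonal to
   itself. *)
have zz : ip E z z = 0.
  rewrite {2}/z; have Luv := LB _ _ LuE LvE.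
  have sub x y t : L2 E x -> L2 E y -> L2 E t -> ip E t (x - y) = ip E t x - ip E t y.
    move=> Lx Ly Lt; rewrite ipC addrC -scaleN1r ipD// mulN1r addrC.
    by rewrite (ipC _ x) (ipC _ y).
  by rewrite !sub// zk subr0 zu; move: zv; lra.
exists (v + k), (v1 + k1); split.
  by have := qsol_lin 1 qv qk; rewrite !scale1r addr0.
apply: (aeS (ip_eq0 mE LzE zz)) => x /[apply] -[].
have -> : z.1 x = u.1 x - v.1 x - k.1 x by [].
have -> : z.2 x = u.2 x - v.2 x - k.2 x by [].
have -> : (v + k).1 x = v.1 x + k.1 x by [].
have -> : (v + k).2 x = v.2 x + k.2 x by [].
by move=> h1 h2; split; lra.
Qed.

Lemma L2_ae_eq u v : measurable_fun setT v.1 -> measurable_fun setT v.2 ->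
  {ae mu, forall x, u.1 x = v.1 x /\ u.2 x = v.2 x} -> L2 setT u -> L2 setT v.
Proof.
move=> m1 m2 uv [_ _ i1 i2]; split => //.
- apply: (ae_eq_Rintegral (D := setT) (g := fun x => u.1 x ^+ 2) _ _ _ i1).1 => //.
    exact: measurable_funX.
  by apply: (aeS uv) => x [-> _].
- apply: (ae_eq_Rintegral (D := setT) (g := fun x => u.2 x ^+ 2) _ _ _ i2).1 => //.
    exact: measurable_funX.
  by apply: (aeS uv) => x [_ ->].
Qed.

(** Each local representative solves the equation on the whole line. Any two agree on []-1, 1[],
    hence everywhere by uniqueness, so the first one represents [u] on every interval. *)
Lemma regularity u f : L2 setT u -> L2 setT f ->
  (forall g h, L00v g h -> ip setT h u = ip setT g f) ->
  exists y, Lmaxv y f /\ {ae mu, forall x, u.1 x = y.1 x /\ u.2 x = y.2 x}.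
Proof.
move=> Lu Lf H.
have nn (n : nat) : - n.+1%:R <= n.+1%:R :> R.
  by rewrite (le_trans _ (ler0n _ _))// lerNl oppr0 ler0n.
have /choice[Y hY] n := local_representation (nn n) Lu Lf H.
have {hY}/choice[Y1 hY] n := hY n.
have oI : open `](-1 : R), 1[%classic by exact: interval_open.
have YE n x : (Y n).1 x = (Y 0).1 x /\ (Y n).2 x = (Y 0).2 x.
  have [q0 e0] := hY 0; have [qn en] := hY n.
  pose D := (-1) *: Y 0 + Y n; pose D1 := (-1) *: Y1 0 + Y1 n.
  have f0 : (-1) *: f + f = 0 by rewrite scaleN1r addNr.
  have qD : qsol D D1 0 by have := qsol_lin (-1) q0 qn; rewrite f0.
  have [c1 c2 _ _] := qsol_continuous qD.
  have D1E t : D.1 t = - (Y 0).1 t + (Y n).1 t by have [-> _] := cfunE (-1) (Y 0) (Y n) t; rewrite mulN1r.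
  have D2E t : D.2 t = - (Y 0).2 t + (Y n).2 t by have [_ ->] := cfunE (-1) (Y 0) (Y n) t; rewrite mulN1r.
  have eD : {ae mu, forall t, `](-1 : R), 1[%classic t -> D.1 t = 0 /\ D.2 t = 0}.
    apply: (aeS (aeI e0 en)) => t [h0 hn] tI; have /andP[t1 t2] : -1 < t < 1 by move: tI; rewrite /= in_itv.
    have [] := h0; first by rewrite /= in_itv /= !ltW.
    have n1 : 1 <= n.+1%:R :> R by rewrite ler1n.
    have [] := hn; first by rewrite /= in_itv /=; move: t1 t2 n1; lra.
    by move=> A1 A2 A3 A4; rewrite D1E D2E -A1 -A2 -A3 -A4 !addNr.
  have z1 := ae_zero_continuous oI c1 (aeS eD (fun t ht Pt => (ht Pt).1)).
  have z2 := ae_zero_continuous oI c2 (aeS eD (fun t ht Pt => (ht Pt).2)).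
  have z t (Pt : `](-1 : R), 1[%classic t) := conj (z1 t Pt) (z2 t Pt).
  have I0 : `](-1 : R), 1[%classic 0 by rewrite /= in_itv /= ltrN10 ltr01.
  have [] := qsol_unique qD (z 0 I0) (qsol_quasi_derivative0 oI qD z I0) x.
  by rewrite D1E D2E => h1 h2; split; lra.
have uY : {ae mu, forall x, u.1 x = (Y 0).1 x /\ u.2 x = (Y 0).2 x}.
  have : {ae mu, forall x n, `[- n.+1%:R, n.+1%:R]%classic x -> u.1 x = (Y n).1 x /\ u.2 x = (Y n).2 x}.
    by apply/ae_foralln => n; exact: (hY n).2.
  move=> h; apply: (aeS h) => x /(_ (Num.bound `|x|)) hx.
  have [<- <-] := YE (Num.bound `|x|) x; apply: hx.
  have hb : `|x| <= (Num.bound `|x|).+1%:R.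
    by rewrite (le_trans (ltW (archi_boundP (normr_ge0 x))))// ler_nat.
  by rewrite /= in_itv /= -ler_norml.
exists (Y 0); split=> //; split => //; last by exists (Y1 0); exact: (hY 0).1.
have [c1 c2 _ _] := qsol_continuous (hY 0).1.
by apply: L2_ae_eq uY Lu; exact: continuous_measurable.
Qed.

End Regularity.

(** * Cutoffs *)

Section LocL2.
Context {R : realType}.

Definition locL2 (G : R -> R) := measurable_fun setT G /\ locint (fun x => G x ^+ 2).

Lemma locL2_continuous (G : R -> R) : continuous G -> locL2 G.
Proof.
move=> cG; split; first exact: continuous_measurable.
by have := locintM_continuous cG (locint_continuous cG); under [X in locint X]eq_fun do rewrite -expr2.
Qed.

Lemma locL2M_continuous (F G : R -> R) : continuous F -> locL2 G -> locL2 (fun x => F x * G x).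
Proof.
move=> cF [mG lG]; split; first by apply: measurable_funM => //; exact: continuous_measurable.
have := locintM_continuous cF (locintM_continuous cF lG).
by under [X in locint X]eq_fun do rewrite mulrA -expr2 -exprMn.
Qed.

Lemma locL2D (F G : R -> R) : locL2 F -> locL2 G -> locL2 (fun x => F x + G x).
Proof.
move=> [mF lF] [mG lG]; have mFG : measurable_fun setT (fun x => F x + G x) by exact: measurable_funD.
split => //; apply: locint_le (locintZ 2 (locintD lF lG)); first exact: measurable_funX.
move=> x; rewrite ger0_norm ?sqr_ge0//; have := sqr_ge0 (F x - G x); nra.
Qed.

Lemma locL2Z c (G : R -> R) : locL2 G -> locL2 (fun x => c * G x).
Proof. by apply: locL2M_continuous => x; exact: cvg_cst. Qed.

Lemma L2_locL2 (u : cfun (R := R)) : L2 setT u -> locL2 u.1 /\ locL2 u.2.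
Proof.
move=> [m1 m2 i1 i2]; split; split => //; split=> [|x y].
- exact: measurable_funX.
- exact: integrableS i1.
- exact: measurable_funX.
- exact: integrableS i2.
Qed.

Lemma L2_locL2_compact (u : cfun (R := R)) a b : locL2 u.1 -> locL2 u.2 ->
  (forall x, x < a \/ b < x -> u.1 x = 0 /\ u.2 x = 0) -> L2 setT u.
Proof.
move=> [m1 l1] [m2 l2] u0.
have -> : u = ccut a b u.
  have h x : u.1 x = cut a b u.1 x /\ u.2 x = cut a b u.2 x.
    rewrite /cut; have [//|] := boolP (a <= x <= b).
    rewrite negb_and -!ltNge => /orP xab; by have [-> ->] := u0 _ xab.
  rewrite [LHS]surjective_pairing; congr pair; apply/funext => x; [exact: (h x).1|exact: (h x).2].
by apply: L2_ccut; split => //; [exact: l1.2|exact: l2.2].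
Qed.

End LocL2.

Section Cutoff.
Context {R : realType}.
Local Notation mu := (@lebesgue_measure R).
Variables (p Q r s : R -> R).
Hypotheses (p0 : forall x, 0 < p x) (lQ2 : locL2 Q).
Local Notation qsol := (qsol p Q r s).
Implicit Types (u v w f g h k : cfun (R := R)) (a b c : R).

Definition cscale (phi : R -> R) u : cfun (R := R) := (fun x => phi x * u.1 x, fun x => phi x * u.2 x).

(* l[phi u] in terms of l[u] = f, where psi = p phi'; (phi u)^[1] = phi u^[1] + psi u. *)
Definition cut_rhs (phi dphi dpsi : R -> R) u u1 f : cfun (R := R) :=
  (fun x => phi x * f.1 x - 2 * dphi x * u1.1 x - dpsi x * u.1 x - 2 * dphi x * u.1 x * Q x,
   fun x => phi x * f.2 x - 2 * dphi x * u1.2 x - dpsi x * u.2 x - 2 * dphi x * u.2 x * Q x).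

Variables (phi dphi dpsi : R -> R).
Let psi x := p x * dphi x.
Hypotheses (pphi : primitive phi dphi) (cdphi : continuous dphi) (ppsi : primitive psi dpsi)
  (ldpsi : locL2 dpsi).
Variables (a b : R).
Hypotheses (phi0 : forall x, x < a \/ b < x -> phi x = 0)
  (dphi0 : forall x, x < a \/ b < x -> dphi x = 0)
  (dpsi0 : forall x, x < a \/ b < x -> dpsi x = 0).

(** The coefficient [r] drops out of the commutator: p phi' u' contributes phi' (Q + i r) u, the
    first-order term of u^[2] contributes phi' (Q - i r) u, and the sum is 2 phi' Q u. *)
Lemma qsol_cscale u u1 f : qsol u u1 f ->
  qsol (cscale phi u) (cscale phi u1 + cscale psi u) (cut_rhs phi dphi dpsi u u1 f).
Proof.
move=> [a1 a2 a3 a4].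
have E x : (cscale phi u1 + cscale psi u).1 x = phi x * u1.1 x + psi x * u.1 x /\
    (cscale phi u1 + cscale psi u).2 x = phi x * u1.2 x + psi x * u.2 x by [].
split.
- apply: primitive_eq (primitiveM pphi a1) _ _ => x //.
  by rewrite (E x).1 /= /psi; field; exact: lt0r_neq0.
- apply: primitive_eq (primitiveM pphi a2) _ _ => x //.
  by rewrite (E x).2 /= /psi; field; exact: lt0r_neq0.
- apply: primitive_eq (primitiveD (primitiveM pphi a3) (primitiveM ppsi a1)) _ _ => x //.
  by rewrite (E x).1 (E x).2 /= /psi; field; exact: lt0r_neq0.
- apply: primitive_eq (primitiveD (primitiveM pphi a4) (primitiveM ppsi a2)) _ _ => x //.
  by rewrite (E x).1 (E x).2 /= /psi; field; exact: lt0r_neq0.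
Qed.

(** Each term of [cut_rhs] is a continuous function, or a continuous function times one of [f],
    [dpsi], [Q], which are locally square integrable; compact support does the rest. *)
Lemma L00v_cscale u u1 f : L2 setT u -> L2 setT f -> qsol u u1 f ->
  L00v p Q r s (cscale phi u) (cut_rhs phi dphi dpsi u u1 f).
Proof.
move=> Lu Lf qu; have [c1 c2 c3 c4] := qsol_continuous qu.
have cphi := primitive_continuous pphi.
have [lf1 lf2] := L2_locL2 Lf; have [lu1 lu2] := L2_locL2 Lu.
have supp x : x < a \/ b < x -> (cscale phi u).1 x = 0 /\ (cscale phi u).2 x = 0.
  by move=> /phi0 h; rewrite /= h !mul0r.
split; last by exists a, b.
split; last by exists (cscale phi u1 + cscale psi u); exact: qsol_cscale.
  by apply: L2_locL2_compact supp; apply: locL2M_continuous.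
have cM (F G : R -> R) : continuous F -> continuous G -> continuous (fun x => F x * G x).
  by move=> cF cG x; apply: cvgM; [exact: cF|exact: cG].
have main (F U U1 : R -> R) : locL2 F -> continuous U -> continuous U1 ->
   locL2 (fun x => phi x * F x - 2 * dphi x * U1 x - dpsi x * U x - 2 * dphi x * U x * Q x).
  move=> lF cU cU1.
  have h1 := locL2M_continuous cphi lF.
  have h2 := locL2Z (-2) (locL2_continuous (cM _ _ cdphi cU1)).
  have h3 := locL2Z (-1) (locL2M_continuous cU ldpsi).
  have h4 := locL2Z (-2) (locL2M_continuous (cM _ _ cdphi cU) lQ2).
  have := locL2D (locL2D (locL2D h1 h2) h3) h4.
  by congr locL2; apply/funext => x; ring.
apply: (@L2_locL2_compact _ _ a b); [exact: main|exact: main|].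
by move=> x xab; rewrite /= phi0// dphi0// dpsi0// !(mul0r, mulr0, subr0).
Qed.

(* The two sides differ by the integral of the derivative of psi phi |u|^2. *)
Lemma cutoff_energy_identity u u1 c : L2 setT u -> qsol u u1 (c *: u) ->
  ip setT (cut_rhs phi dphi dpsi u u1 (c *: u)) (cscale phi u) =
  c * ip setT (cscale phi u) (cscale phi u) +
    \int[mu]_(x in setT) (p x * dphi x ^+ 2 * (u.1 x ^+ 2 + u.2 x ^+ 2)).
Proof.
move=> Lu qu; have Lcu : L2 setT (c *: u) by rewrite -[_ *: _]addr0; apply: L2_lin => //; exact: L2_0.
have [[Lg Lh _] _] := L00v_cscale Lu Lcu qu.
have [a1 a2 a3 a4] := qu.
have pn := primitiveM (primitiveM ppsi pphi) (primitiveD (primitiveM a1 a1) (primitiveM a2 a2)).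
have [|inn n0] := @primitive_compact_integral _ _ _ a b pn.
  by move=> x /phi0 ->; rewrite !(mulr0, mul0r).
have i1 := ip_integrable measurableT Lh Lg.
have i2 := ip_integrable measurableT Lg Lg.
have i2' := integrableZl measurableT c i2.
have i12 := integrableB measurableT i1 i2'.
have i3 := integrableD measurableT i12 inn.
rewrite /ip -RintegralZl//; apply/eqP; rewrite addrC -subr_eq -RintegralB//.
rewrite -[X in X == _]addr0 -[X in _ + X == _]n0 -RintegralD//; apply/eqP.
apply: eq_Rintegral => x _.
have E1 : (c *: u.1) x = c * u.1 x by [].
have E2 : (c *: u.2) x = c * u.2 x by [].
by rewrite /= E1 E2 /psi; field; exact: lt0r_neq0.
Qed.

End Cutoff.

(** * The coordinate tau and cutoffs with p phi'^2 = O(K^2) *)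

Section CutoffProfile.
Context {R : realType}.
Local Notation mu := (@lebesgue_measure R).
Variables (p : R -> R).
Hypotheses (ACp : ACloc p) (dp2 : L2loc (derive1 p)) (p0 : forall x, 0 < p x)
 (intN : (\int[mu]_(x in `]-oo, (0%R : R)]) ((Num.sqrt (p x))^-1)%:E = +oo)%E)
 (intP : (\int[mu]_(x in `[(0%R : R), +oo[) ((Num.sqrt (p x))^-1)%:E = +oo)%E).

Let sp x := Num.sqrt (p x).
Let rs x := (sp x)^-1.

Let sp0 x : 0 < sp x. Proof. by rewrite sqrtr_gt0. Qed.
Let rs0 x : 0 < rs x. Proof. by rewrite invr_gt0. Qed.

Let spE x : sp x * sp x = p x. Proof. by rewrite -expr2 sqr_sqrtr// ltW. Qed.

Let csp : continuous sp.
Proof.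
by move=> x; apply: continuous_comp; [exact: ACloc_continuous|exact: sqrt_continuous].
Qed.

Let crs : continuous rs.
Proof. by move=> x; apply: continuousV; [exact: lt0r_neq0|exact: csp]. Qed.

Let ldp : locL2 (derive1 p).
Proof. by case: dp2 => m /locint_locally_integrable. Qed.

Let pp : primitive p (derive1 p).
Proof. by apply: ACloc_primitive_ae => //; [case: ldp|apply: aeW]. Qed.

Let psp : primitive sp (fun x => (2 * sp x)^-1 * derive1 p x).
Proof.
have D x : derive1 Num.sqrt (p x) = (2 * sp x)^-1 by rewrite derive1E derive_sqrt.
have := @primitive_comp _ Num.sqrt _ _ pp.
under [X in _ -> continuous X -> _]eq_fun do rewrite D.
under [X in _ -> _ -> primitive _ X]eq_fun do rewrite D.
apply.
  by move=> x; case: (is_derive1_sqrt (p0 x)).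
move=> x; apply: cvgV; first by rewrite mulf_neq0// lt0r_neq0.
by apply: cvgM; [exact: cvg_cst|exact: csp].
Qed.

(** If [tau] stayed below [M], its values at [n] would bound the integrals of [p^{-1/2}] over
    [[0, n]], and by monotone convergence the divergent one; likewise on the left. *)
Lemma half_line_divergent_primitive : exists tau, [/\ primitive tau rs,
  {homo tau : x y / x <= y} & forall M, exists a b, tau a <= - M /\ M <= tau b].
Proof.
have [tau pt t0] := primitive_exists 0 0 (locint_continuous crs).
have tnd : {homo tau : x y / x <= y}.
  move=> x y xy; rewrite -subr_ge0 pt.2//; apply: Rintegral_ge0 => t _; exact/ltW.
exists tau; split => // M.
have mrs A : measurable A -> measurable_fun A (EFin \o rs).
  move=> mA; apply/measurable_EFinP; apply: measurable_funTS; exact: continuous_measurable.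
have itau x y : x <= y -> (\int[mu]_(t in `[x, y]) (rs t)%:E = (tau y - tau x)%:E)%E.
  move=> xy; rewrite pt.2// /Rintegral fineK//.
  by apply: integrable_fin_num => //; exact: pt.1.2.
have rsE x : (0 <= (rs x)%:E)%E by rewrite lee_fin ltW.
have [b hb] : exists b, M <= tau b.
  apply: contrapT => /forallNP nb.
  have Fnd : nondecreasing_seq (fun n => `[0, n%:R]%classic : set R).
    move=> m n mn; apply/subsetPset; apply: subset_itvl; rewrite bnd_simp ler_nat//.
  have FU : \bigcup_n `[0, n%:R]%classic = `[(0 : R), +oo[%classic.
    apply/seteqP; split => x /=.
      by move=> [n _] /=; rewrite !in_itv /= => /andP[->].
    rewrite in_itv /= andbT => x0; exists (Num.bound x) => //=.
    by rewrite in_itv /= x0 ltW// archi_boundP.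
  have : (\int[mu]_(x in `[0%R, n%:R]) (rs x)%:E)%E @[n --> \oo] -->
      (\int[mu]_(x in \bigcup_n `[0%R, n%:R]%classic) (rs x)%:E)%E.
    apply: ge0_nondecreasing_set_cvg_integral => // n; exact: mrs.
  rewrite FU intP => /cvg_lim h.
  have : (lim (\int[mu]_(x in `[0%R, n%:R]) (rs x)%:E @[n --> \oo]) <= M%:E)%E.
    apply: lime_le.
      apply: ereal_nondecreasing_is_cvgn => m n mn.
      by rewrite !itau// lee_fin lerD2r tnd// ler_nat.
    apply: nearW => n; rewrite itau// lee_fin t0 subr0.
    by have /negP := nb n%:R; rewrite -ltNge => /ltW.
  by rewrite h// leye_eq.
have [a ha] : exists a, tau a <= - M.
  apply: contrapT => /forallNP nb.
  have Fnd : nondecreasing_seq (fun n => `[- n%:R, 0]%classic : set R).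
    by move=> m n mn; apply/subsetPset; apply: subset_itvr; rewrite bnd_simp lerN2 ler_nat.
  have FU : \bigcup_n `[- n%:R, 0]%classic = `]-oo, (0 : R)]%classic.
    apply/seteqP; split => x /=.
      by move=> [n _] /=; rewrite !in_itv /= => /andP[_ ->].
    rewrite in_itv /= => x0; exists (Num.bound (- x)) => //=.
    by rewrite in_itv /= x0 andbT lerNl ltW// archi_boundP// oppr_ge0.
  have : (\int[mu]_(x in `[(- n%:R)%R, 0%R]) (rs x)%:E)%E @[n --> \oo] -->
      (\int[mu]_(x in \bigcup_n `[(- n%:R)%R, 0%R]%classic) (rs x)%:E)%E.
    apply: ge0_nondecreasing_set_cvg_integral => // n; exact: mrs.
  rewrite FU intN => /cvg_lim h.
  have n0 n : - n%:R <= 0 :> R by rewrite oppr_le0.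
  have : (lim (\int[mu]_(x in `[(- n%:R)%R, 0%R]) (rs x)%:E @[n --> \oo]) <= M%:E)%E.
    apply: lime_le.
      apply: ereal_nondecreasing_is_cvgn => m n mn.
      by rewrite !itau// lee_fin lerD2l lerN2 tnd// lerN2 ler_nat.
    apply: nearW => n; rewrite itau// lee_fin t0 sub0r.
    by have /negP := nb (- n%:R); rewrite -ltNge lerNl => /ltW.
  by rewrite h// leye_eq.
by exists a, b.
Qed.

(* phi = max(0, 1 - (K tau)^2)^3; the cube makes phi' and (p phi')' regular enough. *)
Lemma cutoff_exists tau (K : R) : 0 < K -> primitive tau rs -> {homo tau : x y / x <= y} ->
  (forall M, exists a b, tau a <= - M /\ M <= tau b) ->
  exists phi dphi dpsi a b, [/\
   [/\ primitive phi dphi, continuous dphi, primitive (fun x => p x * dphi x) dpsi & locL2 dpsi],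
   [/\ forall x, x < a \/ b < x -> phi x = 0, forall x, x < a \/ b < x -> dphi x = 0 &
       forall x, x < a \/ b < x -> dpsi x = 0],
   forall x, p x * dphi x ^+ 2 <= 36 * K ^+ 2 &
   forall x, K * `|tau x| <= 2^-1 -> 4^-1 <= phi x].
Proof.
move=> K0 ptau tnd tunb.
pose t x := K * tau x.
have pt : primitive t (fun x => K * rs x) by exact: primitiveZ.
have ct := primitive_continuous pt.
pose G x := 1 - t x * t x.
have pG : primitive G (fun x => 0 - (K * rs x * t x + t x * (K * rs x))).
  exact: primitiveB (primitive_cst 1) (primitiveM pt pt).
have cG := primitive_continuous pG.
pose M x := Num.max 0 (G x).
have ACM : ACloc M.
  apply: (ACloc_lip (primitive_AC pG)) => a b _; exists 1 => // x y _ _ _.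
  rewrite mul1r /M; move: (G x) (G y) => gx gy.
  have h := ler_norm (gy - gx); have h' := ler_norm (gx - gy); rewrite distrC in h'.
  have h0 := normr_ge0 (gy - gx); rewrite ler_norml.
  by case: (leP 0 gx) => hx; case: (leP 0 gy) => hy; apply/andP; split; move: h h' h0 hx hy;
    move: (`|_|) => N; lra.
have [m pM] := ACloc_primitive ACM.
have cM := primitive_continuous pM.
(* Only the product [M m] is computed: where [G <= 0] the factor [M] is 0, so the derivative of the
   positive part is not examined there. *)
have Mm : {ae mu, forall x, M x * m x = - 2 * M x * t x * (K * rs x)}.
  apply: (aeS (aeI (primitive_derive1 pM) (primitive_ae_derivable pG))) => x [Mx [dG Gx]].
  have [Gx0|Gx0] := leP (G x) 0.
    have -> : M x = 0 by rewrite /M (max_idPl Gx0).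
    by rewrite !(mul0r, mulr0).
  have [|_ e] := @derivable_near_eq _ M G x 0 _ dG.
    have Gp : nbhs (G x) [set z | 0 < z] by apply: open_nbhs_nbhs; split; [exact: open_gt|].
    near=> z; rewrite addr0 /M; apply/max_idPr/ltW.
    by near: z; exact: (cG x _ Gp).
  by rewrite -Mx e Gx; ring.
have mcont (F : R -> R) : continuous F -> measurable_fun setT F by exact: continuous_measurable.
have cprod (F H : R -> R) : continuous F -> continuous H -> continuous (fun x => F x * H x).
  by move=> cF cH x; exact: (cvgM (cF x) (cH x)).
have ccst (c : R) : continuous ((fun=> c) : R -> R) by move=> x; exact: cvg_cst.
pose d2 x := - 4 * M x * (t x * (K * rs x)).
have cKrs : continuous (fun x => K * rs x) := cprod _ _ (ccst K) crs.
have ctK : continuous (fun x => t x * (K * rs x)) := cprod _ _ ct cKrs.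
have cMM : continuous (fun x => M x * M x) := cprod _ _ cM cM.
have cd2 : continuous d2 := cprod _ _ (cprod _ _ (ccst (-4)) cM) ctK.
have pM2 : primitive (fun x => M x * M x) d2.
  apply: primitive_ae_eq (primitiveM pM pM); first exact: (mcont _ cd2).
  by apply: (aeS Mm) => x h; rewrite mulrC h /d2; ring.
pose dphi x := - 6 * (M x * M x) * (t x * (K * rs x)).
have cdphi : continuous dphi := cprod _ _ (cprod _ _ (ccst (-6)) cMM) ctK.
have pphi : primitive (fun x => M x * M x * M x) dphi.
  apply: primitive_ae_eq (primitiveM pM2 pM); first exact: (mcont _ cdphi).
  apply: (aeS Mm) => x h; rewrite -[M x * M x * m x]mulrA h /d2 /dphi; ring.
(* Since [p rs = sp], one has [p dphi = - 6 K t M^2 sp], and this is its product rule. [p'] enters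
   linearly, through [sp'], with a continuous coefficient. *)
pose dpsi x := - 6 * K * ((K * rs x * (M x * M x) + t x * d2 x) * sp x
   + t x * (M x * M x) * ((2 * sp x)^-1 * derive1 p x)).
have ppsi : primitive (fun x => p x * dphi x) dpsi.
  apply: primitive_eq (primitiveZ (- 6 * K) (primitiveM (primitiveM pt pM2) psp)) _ _ => x //.
  by rewrite /dphi -spE /rs; field; exact: lt0r_neq0.
have ldpsi : locL2 dpsi.
  have c1 : continuous (fun x => - 6 * K * ((K * rs x * (M x * M x) + t x * d2 x) * sp x)).
    have csum : continuous (fun x => K * rs x * (M x * M x) + t x * d2 x).
      by move=> x; apply: cvgD; [exact: (cprod _ _ cKrs cMM)|exact: (cprod _ _ ct cd2)].
    exact: (cprod _ _ (ccst (- 6 * K)) (cprod _ _ csum csp)).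
  have c2 : continuous (fun x => - 6 * K * (t x * (M x * M x)) * (2^-1 * rs x)).
    exact: (cprod _ _ (cprod _ _ (ccst (- 6 * K)) (cprod _ _ ct cMM)) (cprod _ _ (ccst 2^-1) crs)).
  have := locL2D (locL2_continuous c1) (locL2M_continuous c2 ldp).
  congr locL2; apply/funext => x; rewrite /dpsi /rs; field; exact: lt0r_neq0.
(* Beyond [a] and [b] one has [|t| >= 1], where [M] vanishes. *)
have [a [b [ha hb]]] := tunb K^-1.
have Mout x : x < a \/ b < x -> M x = 0.
  move=> xab; rewrite /M; apply/max_idPl; rewrite /G subr_le0.
  have : t x <= -1 \/ 1 <= t x.
    case: xab => [xa|bx]; [left|right].
      by rewrite -(mulVf (lt0r_neq0 K0)) mulrC -mulrN ler_pM2l// (le_trans (tnd _ _ (ltW xa))).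
    by rewrite -(mulVf (lt0r_neq0 K0)) mulrC ler_pM2l// (le_trans hb)// tnd// ltW.
  case=> h; nra.
exists (fun x => M x * M x * M x), dphi, dpsi, a, b; split.
- by split.
- by split=> x /Mout h; rewrite /dphi /dpsi /d2 ?h !(mulr0, mul0r, addr0).
- move=> x; rewrite /dphi.
  (* The weight disappears because [p rs^2 = 1]; 36 is the square of the factor 6 = 3 * 2 from the
     cube and the square. *)
  have -> : p x * (- 6 * (M x * M x) * (t x * (K * rs x))) ^+ 2 =
     36 * K ^+ 2 * ((M x ^+ 4) * t x ^+ 2).
    by rewrite -spE /rs; field; exact: lt0r_neq0.
  apply: ler_piMr; first by rewrite mulr_ge0// sqr_ge0.
  have [Gx0|Gx0] := leP (G x) 0; rewrite /M.
    by rewrite (max_idPl Gx0) expr0n mul0r.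
  rewrite (max_idPr (ltW Gx0)).
  have t2 : t x ^+ 2 <= 1 by move: Gx0; rewrite /G -expr2 subr_gt0 => /ltW.
  have G1 : G x <= 1 by rewrite /G gerBl -expr2 sqr_ge0.
  have G4 : G x ^+ 4 <= 1 by rewrite exprn_ile1// ltW.
  by apply: mulr_ile1 => //; rewrite ?sqr_ge0// exprn_ge0// ltW.
(* For [|t| <= 1/2] one has [G >= 3/4], and (3/4)^3 = 27/64 exceeds 1/4. *)
- move=> x tx; rewrite /M.
  have t2 : t x * t x <= 4^-1.
    have : `|t x| <= 2^-1 by rewrite /t normrM (gtr0_norm K0).
    by rewrite ler_norml => /andP[h1 h2]; nra.
  have G34 : 3 / 4 <= G x by rewrite /G; lra.
  rewrite (max_idPr _); last by apply: le_trans G34; lra.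
  have : 9 / 16 <= G x * G x by nra.
  move: G34; nra.
Unshelve. all: by end_near. Qed.

End CutoffProfile.

Lemma shift_sub (R : pzRingType) (V : lmodType R) (t : R) (a b c d : V) :
  t *: (-1 *: a + b) + (-1 *: c + d) = t *: b + d - (t *: a + c).
Proof. by rewrite !scaleN1r scalerDr scalerN opprD addrACA addrC. Qed.

Lemma shift_add (R : pzRingType) (V : lmodType R) (t : R) (a c v e : V) :
  c - (t *: v + e) = t *: (a - v) + (- t *: a + c - e).
Proof.
rewrite scalerBr scaleNr opprD !addrA.
by rewrite -[_ - t *: v - t *: a]addrAC subrr sub0r [- _ + c]addrC.
Qed.

(** * Density of the range and symmetry of the maximal operator *)

Section EssentialSelfAdjointness.
Context {R : realType}.
Local Notation mu := (@lebesgue_measure R).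
Variables (p Q r s : R -> R) (gamma : R).
Hypotheses (ACp : ACloc p) (dp2 : L2loc (derive1 p)) (p0 : forall x, 0 < p x)
 (intN : (\int[mu]_(x in `]-oo, (0%R : R)]) ((Num.sqrt (p x))^-1)%:E = +oo)%E)
 (intP : (\int[mu]_(x in `[(0%R : R), +oo[) ((Num.sqrt (p x))^-1)%:E = +oo)%E)
 (lp : locint (fun x => (p x)^-1)) (lQ : locint (fun x => Q x / p x))
 (lr : locint (fun x => r x / p x)) (lW : locint (qW p Q r s)) (lQ2 : locL2 Q)
 (bounded_below : forall g h, L00v p Q r s g h -> gamma * ip setT g g <= ip setT h g).
Local Notation qsol := (qsol p Q r s).
Local Notation Lmaxv := (Lmaxv p Q r s).
Local Notation L00v := (L00v p Q r s).
Local Notation B := (ip (setT : set R)).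
Local Notation D := (L2 (setT : set R)).
Implicit Types (u v w f g h k : cfun (R := R)).

Let mT : measurable (setT : set R). Proof. by []. Qed.
Let D0 : D 0 := L2_0 mT.
Let DD t u v : D u -> D v -> D (t *: u + v). Proof. exact: L2_lin. Qed.
Let BC u v : D u -> D v -> B u v = B v u. Proof. by move=> _ _; exact: ipC. Qed.
Let BD t u v w : D u -> D v -> D w -> B (t *: u + v) w = t * B u w + B v w.
Proof. exact: ipD. Qed.
Let B_ge0 u : D u -> 0 <= B u u. Proof. by move=> _; exact: ip_ge0. Qed.

Lemma L2_sub u v : D u -> D v -> D (u - v). Proof. exact: (shB DD). Qed.
Lemma L2_scale t u : D u -> D (t *: u). Proof. exact: (shZ D0 DD). Qed.

Lemma kernel_trivial u : Lmaxv u ((gamma - 1) *: u) ->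
  {ae mu, forall x, u.1 x = 0 /\ u.2 x = 0}.
Proof.
move=> [Lu Lf [u1 qu]].
have [tau [ptau tnd tunb]] := half_line_divergent_primitive ACp p0 intN intP.
have bound K : 0 < K -> exists phi, [/\ continuous phi, D (cscale phi u),
    B (cscale phi u) (cscale phi u) <= 36 * K ^+ 2 * B u u &
    forall x, K * `|tau x| <= 2^-1 -> 4^-1 <= phi x].
  move=> K0.
  have [phi [dphi [dpsi [a [b [[pphi cdphi ppsi ldpsi] [phi0 dphi0 dpsi0] le36 ge4]]]]]] :=
    cutoff_exists ACp dp2 p0 K0 ptau tnd tunb.
  have Lg := L00v_cscale p0 lQ2 pphi cdphi ppsi ldpsi phi0 dphi0 dpsi0 Lu Lf qu.
  have := bounded_below Lg.
  rewrite (cutoff_energy_identity p0 lQ2 pphi cdphi ppsi ldpsi phi0 dphi0 dpsi0 Lu qu).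
  have [[Dg _ _] _] := Lg.
  set N := B _ _; set I := Rintegral _ _ _ => hN.
  have hI : I <= 36 * K ^+ 2 * B u u.
    have iu := ip_integrable mT Lu Lu.
    have iu' := integrableZl measurableT (36 * K ^+ 2) iu.
    rewrite /ip -RintegralZl//; apply: le_Rintegral => //.
      apply: le_integrable iu' => //=.
        apply/measurable_EFinP; have [m1 m2 _ _] := Lu.
        apply: measurable_funM; last by apply: measurable_funD; exact: measurable_funX.
        apply: measurable_funM; last by apply: measurable_funX; exact: continuous_measurable.
        by apply: continuous_measurable; exact: ACloc_continuous.
      move=> x _; have n0 : 0 <= u.1 x ^+ 2 + u.2 x ^+ 2 by rewrite addr_ge0// sqr_ge0.
      rewrite lee_fin ger0_norm; last by rewrite mulr_ge0// mulr_ge0 ?sqr_ge0// ltW.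
      apply: le_trans (ler_norm _); rewrite [X in _ <= _ * X](_ : _ = u.1 x ^+ 2 + u.2 x ^+ 2) //.
      exact: ler_wpM2r.
    by move=> x _; rewrite -!expr2; apply: ler_wpM2r => //; rewrite addr_ge0// sqr_ge0.
  exists phi; split => //; first exact: primitive_continuous pphi.
  rewrite -/N; apply: le_trans hI; move: hN; move: N I => N I hN; lra.
have loc a b : ip `[a, b] u u = 0.
  have LuE : L2 `[a, b] u by exact: L2_setT_itv.
  have [A A0 hA] := continuous_bounded a b (primitive_continuous ptau).
  apply/le_anti; rewrite ip_ge0 andbT; apply/ler_addgt0Pl => e e0; rewrite addr0.
  (* 576 = 16 * 36: the factor 16 comes from [phi >= 1/4] on [[a, b]], the factor 36 from the bound
     on [p phi'^2]. The summand 1 keeps [c] positive. *)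
  pose c := 576 * (B u u + 1).
  have c0 : 0 < c.
    by apply: mulr_gt0; [lra|apply: ltr_wpDl; [exact: ip_ge0|exact: ltr01]].
  have [K [K0 KA Ke]] : exists K, [/\ 0 < K, K * A <= 2^-1 & K ^+ 2 * c <= e].
    have m0 : 0 < Num.min (2 * A)^-1 (Num.min 1 (e / c)).
      by rewrite !lt_min invr_gt0 mulr_gt0// ltr01 divr_gt0.
    (* The first entry keeps [[a, b]] in the region where [phi >= 1/4]; [K <= 1] gives [K^2 <= K],
       so that [K c <= e] suffices. *)
    exists (Num.min (2 * A)^-1 (Num.min 1 (e / c))); split => //.
      apply: (@le_trans _ _ ((2 * A)^-1 * A)); last by rewrite invfM mulfVK ?gt_eqF.
      by rewrite ler_pM2r// ge_min lexx.
    set K := Num.min _ _ in m0 *.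
    have K1 : K <= 1 by rewrite /K !ge_min lexx !orbT.
    have Kec : K * c <= e by rewrite -ler_pdivlMr// /K !ge_min lexx !orbT.
    by apply: le_trans Kec; rewrite ler_pM2r// expr2 ler_piMl// ltW.
  have [phi [cphi Dphi le36 ge4]] := bound K K0.
  have h1 : ip `[a, b] u u <= 16 * ip `[a, b] (cscale phi u) (cscale phi u).
    have LE : L2 `[a, b] (cscale phi u) by exact: L2_setT_itv.
    have i1 := ip_integrable (measurable_itv `[a, b]) LuE LuE.
    have i2 := ip_integrable (measurable_itv `[a, b]) LE LE.
    rewrite /ip -RintegralZl//; apply: le_Rintegral => //.
      exact: (integrableZl _ 16 i2).
    move=> x; rewrite /= in_itv /= => /andP[ax xb].
    have g4 : 4^-1 <= phi x.
      by apply: ge4; apply: le_trans KA; rewrite ler_pM2l// hA.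
    have g16 : 1 <= 16 * (phi x * phi x) by nra.
    have -> : 16 * (phi x * u.1 x * (phi x * u.1 x) + phi x * u.2 x * (phi x * u.2 x)) =
       16 * (phi x * phi x) * (u.1 x * u.1 x + u.2 x * u.2 x) by ring.
    by rewrite ler_peMl// addr_ge0// -expr2 sqr_ge0.
  have h2 : ip `[a, b] (cscale phi u) (cscale phi u) <= B (cscale phi u) (cscale phi u).
    have i2 := ip_integrable mT Dphi Dphi.
    rewrite /ip [leLHS]Rintegral_mkcond; apply: le_Rintegral => //.
      rewrite -restrict_EFin; apply/integrable_restrict => //; rewrite setTI.
      by apply: integrableS i2.
    move=> x _; rewrite patchE; case: ifPn => // _.
    by rewrite addr_ge0// -expr2 sqr_ge0.
  apply: le_trans h1 _; apply: le_trans _ Ke.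
  rewrite /c; have := ip_ge0 setT u; move: h2 le36; have := sqr_ge0 K; nra.
have hn (n : nat) := ip_eq0 (measurable_itv `[- n%:R, n%:R]) (L2_setT_itv (- n%:R) n%:R Lu) (loc _ _).
apply: (aeS (ae_foralln hn)) => x /(_ (Num.bound `|x|)); apply.
by rewrite /= in_itv /= -ler_norml ltW// archi_boundP.
Qed.

Lemma qsol_ae_eq u u1 f f' : {ae mu, forall x, f.1 x = f'.1 x /\ f.2 x = f'.2 x} ->
  measurable_fun setT f.1 -> measurable_fun setT f.2 ->
  measurable_fun setT f'.1 -> measurable_fun setT f'.2 -> qsol u u1 f -> qsol u u1 f'.
Proof.
move=> ff m1 m2 m1' m2' [a1 a2 a3 a4]; split => //.
- apply: (primitive_ae_eq _ _ a3); last by apply: (aeS ff) => x [->].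
  have := measurable_funB (measurable_funD a3.1.1 m1) m1'.
  by congr (measurable_fun _ _); apply/funext => x /=; ring.
- apply: (primitive_ae_eq _ _ a4); last by apply: (aeS ff) => x [_ ->].
  have := measurable_funB (measurable_funD a4.1.1 m2) m2'.
  by congr (measurable_fun _ _); apply/funext => x /=; ring.
Qed.

(** The hypothesis says that [z] is orthogonal to the range of L00 - (gamma - 1). Regularity returns
    [y = z] a.e. with right-hand side a multiple of [z]; it is replaced by the same multiple of [y]
    before [kernel_trivial] applies. *)
Lemma weak_kernel_trivial z : D z ->
  (forall g h, L00v g h -> B h z = B g ((gamma - 1) *: z)) -> B z z = 0.
Proof.
move=> Dz H; have Dkz := L2_scale (gamma - 1) Dz.
have [y [[Dy _ [y1 qy]] zy]] := regularity lp lQ lr lW p0 Dz Dkz H.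
have Dky := L2_scale (gamma - 1) Dy.
have Ly : Lmaxv y ((gamma - 1) *: y).
  split => //; exists y1; have [m1 m2 _ _] := Dkz; have [m1' m2' _ _] := Dky.
  apply: (qsol_ae_eq _ m1 m2 m1' m2' qy).
  by apply: (aeS zy) => x [e1 e2]; split;
    [rewrite -[LHS]/((gamma - 1) * z.1 x) e1|rewrite -[LHS]/((gamma - 1) * z.2 x) e2].
have y0 := kernel_trivial Ly.
rewrite (@ae_eq_ip _ setT z 0 z) //.
  rewrite /ip (_ : (fun x => _) = fun=> 0) ?Rintegral_cst ?mul0r//.
  by apply/funext => t; rewrite /= !(mul0r, addr0).
by apply: (aeS (aeI zy y0)) => x [[-> ->] [-> ->]].
Qed.

Lemma L00v_lin t g h g' h' : L00v g h -> L00v g' h' -> L00v (t *: g + g') (t *: h + h').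
Proof.
move=> [[Dg Dh [g1 qg]] [a [b sg]]] [[Dg' Dh' [g1' qg']] [a' [b' sg']]].
split; first by split; [exact: DD|exact: DD|exists (t *: g1 + g1'); exact: qsol_lin].
exists (Num.min a a'), (Num.max b b') => x xab.
have [s1 s2] : (g.1 x = 0 /\ g.2 x = 0) /\ (g'.1 x = 0 /\ g'.2 x = 0).
  by case: xab; rewrite ?lt_min ?gt_max => /andP[h1 h2]; split;
    [apply: sg; left|apply: sg'; left|apply: sg; right|apply: sg'; right].
have [-> ->] := cfunE t g g' x; have [-> ->] := s1; have [-> ->] := s2.
by rewrite mulr0 addr0.
Qed.

Lemma sh_cvg_pairing (x_ : nat -> cfun (R := R)) x v e : (forall n, D (x_ n)) -> D x -> D v ->
  sh_cvg B x_ x -> 0 < e -> exists N, forall n, (N <= n)%N -> `|B (x_ n) v - B x v| < e.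
Proof.
move=> Dx_ Dx Dv cx e0; have v1 : 0 < B v v + 1 by rewrite ltr_wpDl ?B_ge0.
have [N hN] := cx (e ^+ 2 / (B v v + 1)) (divr_gt0 (exprn_gt0 2 e0) v1).
exists N => n /hN; rewrite ltr_pdivlMr// => h2.
have Dd := L2_sub (Dx_ n) Dx.
rewrite -(shBBl BD (Dx_ n) Dx Dv).
rewrite -ltr_sqr ?nnegrE ?(ltW e0)// real_normK ?num_real//.
apply: le_lt_trans (cauchy_schwarz D0 DD BC BD B_ge0 Dd Dv) (le_lt_trans _ h2).
by rewrite ler_wpM2l ?B_ge0// lerDl.
Qed.

Lemma sh_cvg_symmetry (x_ y_ : nat -> cfun (R := R)) x y u f :
  (forall n, D (x_ n)) -> (forall n, D (y_ n)) -> D x -> D y -> D u -> D f ->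
  sh_cvg B x_ x -> sh_cvg B y_ y ->
  (forall n, B (y_ n) u = B (x_ n) f) -> B y u = B x f.
Proof.
move=> Dx_ Dy_ Dx Dy Du Df cx cy H; apply/eqP; rewrite -subr_eq0 -normr_eq0; apply/eqP/le_anti.
rewrite normr_ge0 andbT; apply/ler_addgt0Pl => e e0; rewrite addr0.
have e20 : 0 < e / 2 by rewrite divr_gt0.
have [N1 h1] := sh_cvg_pairing Dx_ Dx Df cx e20.
have [N2 h2] := sh_cvg_pairing Dy_ Dy Du cy e20.
have {}h1 := h1 _ (leq_maxl N1 N2); have {}h2 := h2 _ (leq_maxr N1 N2).
move: h1 h2; rewrite H => h1 h2.
have -> : B y u - B x f = (B (x_ (maxn N1 N2)) f - B x f) - (B (x_ (maxn N1 N2)) f - B y u) by ring.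
by apply: le_trans (ler_normB _ _) _; move: h1 h2; lra.
Qed.

Lemma sh_cvg_null (x_ : nat -> cfun (R := R)) x z : (forall n, D (x_ n)) -> D x -> D z ->
  B (x - z) (x - z) = 0 -> sh_cvg B x_ x -> sh_cvg B x_ z.
Proof.
move=> Dx_ Dx Dz n0 cx e /cx[N hN]; exists N => n /hN.
have Dd := L2_sub Dx Dz; have Dn := L2_sub (Dx_ n) Dx; have Dm := L2_sub (Dx_ n) Dz.
have E : x_ n - x = (x_ n - z) - (x - z) by rewrite opprB addrA subrK.
rewrite E (shBB DD BC BD Dm Dd) n0 (BC Dm Dd) (null_orth D0 DD BC BD B_ge0 Dd Dm n0).
by rewrite mulr0 subr0 addr0.
Qed.

(** With Lambda = [kap], [f0] = (L - Lambda) u is projected on the range [S] of L00 - Lambda. The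
    weak kernel is used twice: the residual of the projection belongs to it, and so does the
    difference between [u] and the limit of the preimages. *)
Lemma Lmaxv_approx u f : Lmaxv u f -> exists un fn : nat -> cfun (R := R),
  [/\ forall n, L00v (un n) (fn n), sh_cvg B un u & sh_cvg B fn f].
Proof.
move=> Lu; have [Du Df _] := Lu.
pose kap := gamma - 1; pose f0 := (- kap) *: u + f.
have Df0 : D f0 by exact: DD.
pose S w := exists g h, L00v g h /\ w = (- kap) *: g + h.
have L0 : L00v 0 0.
  split; last by exists 0, 0.
  split => //; exists 0; split; apply: primitive_eq (primitive_cst 0) _ _ => x //=;
    by rewrite !(mulr0, addr0, subr0, mul0r, oppr0).
have S0 : S 0 by exists 0, 0; split => //; rewrite scaler0 addr0.
have SD t v w : S v -> S w -> S (t *: v + w).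
  move=> [g [h [Lg ->]]] [g' [h' [Lg' ->]]]; exists (t *: g + g'), (t *: h + h').
  split; first exact: L00v_lin.
  rewrite (scalerDr t _ h) (scalerDr (- kap) _ g') (scalerA t (- kap) g) (scalerA (- kap) t g).
  by rewrite (mulrC t) addrACA.
have SsD w : S w -> D w by move=> [g [h [[[Dg Dh _] _] ->]]]; exact: DD.
have [z Dz [zS [hn Shn chn]]] := projection D0 DD BC BD B_ge0 (@L2_ip_complete R) S0 SD SsD Df0.
have z0 : B z z = 0.
  apply: weak_kernel_trivial => // g h Lgh; have [[Dg Dh _] _] := Lgh.
  have := zS _ (ex_intro _ g (ex_intro _ h (conj Lgh erefl))); rewrite BD//.
  by rewrite (shBZr D0 DD BC BD _ Dz Dg) -/kap; lra.
have Dhn n : D (hn n) by exact: SsD.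
have c0 : sh_cvg B hn f0.
  apply: (sh_cvg_null Dhn _ _ _ chn) => //; first exact: L2_sub.
  have -> : f0 - z - f0 = - z by rewrite addrAC subrr sub0r.
  rewrite -scaleN1r (shBZl D0 BD _ Dz) ?(shBZr D0 DD BC BD _ Dz Dz) ?z0 ?mulr0//.
  exact: L2_scale.
have /choice[gn hgn] n := Shn n.
have /choice[fn hfn] n := hgn n.
have Lgf n : L00v (gn n) (fn n) by exact: (hfn n).1.
have Dgn n : D (gn n) by have [[]] := Lgf n.
have Dfn n : D (fn n) by have [[]] := Lgf n.
(* The shift by 1 turns semiboundedness into [B g g <= B (h - kap g) g]; Cauchy-Schwarz then allows
   division by [B g g]. *)
have coer g h : L00v g h -> B g g <= B ((- kap) *: g + h) ((- kap) *: g + h).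
  move=> Lgh; have [[Dg Dh _] _] := Lgh; have Dw : D ((- kap) *: g + h) by exact: DD.
  have h1 : B g g <= B ((- kap) *: g + h) g.
    by rewrite BD//; have := bounded_below Lgh; rewrite /kap; lra.
  have h2 := cauchy_schwarz D0 DD BC BD B_ge0 Dw Dg.
  have g0 := B_ge0 Dg; have w0 := B_ge0 Dw.
  move: h1 h2 g0 w0; move: (B g g) (B _ g) (B _ _) => G I N h1 h2 g0 w0.
  move: g0; rewrite le_eqVlt => /predU1P[<-//|g0].
  rewrite -(ler_pM2r g0); apply: le_trans h2; rewrite expr2; nra.
have cau : sh_cauchy B gn.
  move=> e e0; have [N hN] := sh_cvg_cauchy DD BC BD B_ge0 Dhn Df0 c0 e0.
  exists N => m n Nm Nn; apply: le_lt_trans (hN m n Nm Nn).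
  have -> : gn m - gn n = (-1) *: gn n + gn m by rewrite scaleN1r addrC.
  have Lmn := L00v_lin (-1) (Lgf n) (Lgf m).
  apply: le_trans (coer _ _ Lmn) _; rewrite (hfn m).2 (hfn n).2.
  rewrite le_eqVlt; apply/orP; left; apply/eqP.
  by rewrite shift_sub.
have [v Dv cv] := L2_ip_complete Dgn cau.
have Dkv : D (kap *: v + f0) by exact: DD.
(* [fn = hn + kap gn], where [hn] tends to [f0] and [gn] to [v]. *)
have cf : sh_cvg B fn (kap *: v + f0).
  move=> e e0.
  have e1 : 0 < e / 4 / (kap ^+ 2 + 1) by rewrite !divr_gt0// ltr_wpDl// sqr_ge0.
  have e2 : 0 < e / 4 by rewrite divr_gt0.
  have [N1 h1] := cv _ e1; have [N2 h2] := c0 _ e2; exists (maxn N1 N2) => n Nn.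
  have {}h1 := h1 n (leq_trans (leq_maxl _ _) Nn); have {}h2 := h2 n (leq_trans (leq_maxr _ _) Nn).
  have -> : fn n - (kap *: v + f0) = kap *: (gn n - v) + (hn n - f0).
    by rewrite (hfn n).2 (shift_add _ (gn n)).
  have Dgv := L2_sub (Dgn n) Dv; have Dkg := L2_scale kap Dgv; have Dhf := L2_sub (Dhn n) Df0.
  apply: le_lt_trans (norm_add_le DD BC BD B_ge0 Dkg Dhf) _.
  rewrite (shBZl D0 BD _ Dgv Dkg) (shBZr D0 DD BC BD _ Dgv Dgv).
  move: h1; rewrite ltr_pdivlMr ?ltr_wpDl ?sqr_ge0// => h1.
  have := B_ge0 Dgv; move: h1 h2; move: (B _ _) (B _ _) => X Y h1 h2 X0; nra.
have Dw := L2_sub Du Dv.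
(* Both [(u, f)] and [(v, kap v + f0)] satisfy the weak equation, the second as a limit of pairs of
   L00; in the difference, [f - (kap v + f0)] equals [kap (u - v)]. *)
have w0 : B (u - v) (u - v) = 0.
  apply: weak_kernel_trivial => // g h Lgh; have [[Dg Dh _] _] := Lgh.
  have e1 := Lagrange_compact p0 Lu Lgh.
  have e2 : B (kap *: v + f0) g = B v h.
    apply: (@sh_cvg_symmetry gn fn) => // n; rewrite ipC [RHS]ipC.
    by apply/esym; apply: (Lagrange_compact p0 _ Lgh); exact: (Lgf n).1.
  rewrite (shBBr DD BC BD Du Dv Dh) (shBZr D0 DD BC BD _ Dw Dg) (shBBr DD BC BD Du Dv Dg) -/kap.
  move: e2; rewrite BD// /f0 BD// (ipC _ v h) (ipC _ v g) (ipC _ u g) (ipC _ f g) -e1.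
  lra.
exists gn, fn; split => //.
  apply: (sh_cvg_null Dgn Dv Du _ cv).
  have -> : v - u = (-1) *: (u - v) by rewrite scaleN1r opprB.
  rewrite (shBZl D0 BD _ Dw) ?(shBZr D0 DD BC BD _ Dw Dw) ?w0 ?mulr0//.
  exact: L2_scale.
apply: (sh_cvg_null Dfn Dkv Df _ cf).
have -> : kap *: v + f0 - f = (- kap) *: (u - v).
  by rewrite /f0 addrA addrK scalerBr [RHS]addrC !scaleNr opprK.
rewrite (shBZl D0 BD _ Dw) ?(shBZr D0 DD BC BD _ Dw Dw) ?w0 ?mulr0//.
exact: L2_scale.
Qed.

(** Approximating [(g, h)] by compactly supported pairs avoids any study of the Lagrange bracket at
    infinity. *)
Lemma Lmaxv_symmetric u f g h : Lmaxv u f -> Lmaxv g h -> B h u = B g f.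
Proof.
move=> Lu Lg; have [gn [hn [Lgn cg ch]]] := Lmaxv_approx Lg.
have [Du Df _] := Lu; have [Dg Dh _] := Lg.
apply: (sh_cvg_symmetry _ _ Dg Dh Du Df cg ch) => n.
- by have [[]] := Lgn n.
- by have [[]] := Lgn n.
- exact: Lagrange_compact (Lgn n).
Qed.

End EssentialSelfAdjointness.

Local Open Scope complex_scope.

(** * Back to complex-valued functions *)

Section ComplexTransfer.
Context {R : realType}.
Local Notation mu := (@lebesgue_measure R).
Local Notation C := R[i].
Implicit Types (u v f g h : R -> C) (w k : cfun (R := R)).

Definition reim u : cfun (R := R) := (fun x => complex.Re (u x), fun x => complex.Im (u x)).
Definition ofreim w : R -> C := fun x => Complex (w.1 x) (w.2 x).

Lemma norm2E u : norm2 u = ip setT (reim u) (reim u).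
Proof. by apply: eq_Rintegral => x _; rewrite /csq !expr2. Qed.

(** Im (u conj v) = Re (u conj (i v)). As the maximal domain is stable under multiplication by i,
    real identities valid for all its elements give the complex ones. *)
Lemma innerE u v :
  inner u v = Complex (ip setT (reim u) (reim v)) (ip setT (reim u) (cmulI (reim v))).
Proof.
rewrite /inner; congr Complex; apply: eq_Rintegral => x _ /=; case: (u x) => a b;
  case: (v x) => c d /=; ring.
Qed.

Lemma cL2P u : cL2 u <-> L2 setT (reim u).
Proof.
split=> [[m1 [m2 i]]|[m1 m2 i1 i2]].
  split => //.
    apply: le_integrable i => //; first by apply/measurable_EFinP; exact: measurable_funX.
    move=> x _ /=; rewrite lee_fin /csq !ger0_norm ?addr_ge0 ?sqr_ge0//.
    by rewrite lerDl sqr_ge0.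
  apply: le_integrable i => //; first by apply/measurable_EFinP; exact: measurable_funX.
  move=> x _ /=; rewrite lee_fin /csq !ger0_norm ?addr_ge0 ?sqr_ge0//.
  by rewrite lerDr sqr_ge0.
by split => //; split => //; exact: (integrableD _ i1 i2).
Qed.

Lemma reim_aeE u v : {ae mu, forall x, u x = v x} <->
  {ae mu, forall x, (reim u).1 x = (reim v).1 x /\ (reim u).2 x = (reim v).2 x}.
Proof.
split=> h; apply: (aeS h) => x /=; first by move=> ->.
by case: (u x) => a b; case: (v x) => c d /= [-> ->].
Qed.

Lemma reim_sub u v : reim (fun x => u x - v x) = reim u - reim v.
Proof.
have E w k : w.1 = k.1 -> w.2 = k.2 -> w = k.
  by move: w k => [w1 w2] [k1 k2] /= -> ->.
apply: E; apply/funext => x; rewrite -[RHS]/(_ (u x) - _ (v x)) /=;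
  by case: (u x) => a b; case: (v x).
Qed.

Lemma cvg_norm2 (un : nat -> R -> C) u :
  (fun n => norm2 (fun x => un n x - u x)) @ \oo --> (0 : R) <->
  sh_cvg (ip setT) (fun n => reim (un n)) (reim u).
Proof.
split=> [/cvgrPdist_lt H e e0|H].
  have [N _ hN] := H e e0; exists N => n /hN.
  by rewrite sub0r normrN norm2E reim_sub ger0_norm// ip_ge0.
apply/cvgrPdist_lt => e /H[N hN]; exists N => // n /hN.
by rewrite sub0r normrN norm2E reim_sub ger0_norm// ip_ge0.
Qed.

(** Each quotient is a product of two of the given L^2_loc functions; Q^2 = p (Q^2 / p) with [p]
    continuous gives the last claim. *)
Lemma standingA_locint (p Q r s : R -> R) : standingA p Q r s -> ACloc p -> (forall x, 0 < p x) ->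
  [/\ locint (fun x => (p x)^-1), locint (fun x => Q x / p x), locint (fun x => r x / p x),
      locint (qW p Q r s) & locL2 Q].
Proof.
move=> [mp mQ mr ms [[m1 l1] [m2 l2] [m3 l3] ls _]] ACp p0.
have sp x : Num.sqrt `|p x| ^+ 2 = p x by rewrite sqr_sqrtr// gtr0_norm.
have sp' x : Num.sqrt `|p x| != 0.
  by rewrite gt_eqF// sqrtr_gt0 normr_gt0 gt_eqF.
move: l1 l2 l3 ls => /locint_locally_integrable l1 /locint_locally_integrable l2
  /locint_locally_integrable l3 /locint_locally_integrable ls.
have lQ2 : locint (fun x => Q x ^+ 2 / p x).
  by move: l2; congr (locint _); apply/funext => x; rewrite expr_div_n sp.
split.
- by move: l1; congr (locint _); apply/funext => x; rewrite exprVn sp.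
- have := locintM_sqr m2 m1 l2 l1; congr (locint _); apply/funext => x.
  by rewrite -mulrA -invfM -expr2 sp.
- have := locintM_sqr m3 m1 l3 l1; congr (locint _); apply/funext => x.
  by rewrite -mulrA -invfM -expr2 sp.
- have := locintB (locintD l2 l3) ls; congr (locint _); apply/funext => x.
  by rewrite /qW !expr_div_n sp mulrDl.
- split => //; have := locintM_continuous (ACloc_continuous ACp) lQ2.
  by congr (locint _); apply/funext => x; rewrite mulrCA divff ?mulr1// gt_eqF.
Qed.

Section Operators.
Variables (p Q r s : R -> R).
Hypotheses (mV : measurable_fun setT (fun x => (p x)^-1)) (mQ : measurable_fun setT Q)
  (mr : measurable_fun setT r) (ms : measurable_fun setT s) (p0 : forall x, 0 < p x).

(** The a.e. equations defining u^[1] and u^[2] are solved for u' and (u^[1])', dividing by [p];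
    absolute continuity then makes them integral equations. *)
Lemma LmaxP u f : Lmax p Q r s u f <-> Lmaxv p Q r s (reim u) (reim f).
Proof.
have pV (x : R) : (p x)%:C^-1 = ((p x)^-1)%:C by rewrite -fmorphV.
split=> [[Lu [Lf [[A1 A2] [u1 [[B1 B2] [e1 e2]]]]]]|[Lu Lf [w [a1 a2 a3 a4]]]].
  split; [exact/cL2P|exact/cL2P|exists (reim u1)].
  have [mu1 [mu2 _]] := Lu; have [mf1 [mf2 _]] := Lf.
  have mv1 := continuous_measurable (ACloc_continuous B1).
  have mv2 := continuous_measurable (ACloc_continuous B2).
  have mW : measurable_fun setT (qW p Q r s).
    apply: measurable_funB => //; apply: measurable_funM => //.
    by apply: measurable_funD; exact: measurable_funX.
  split; (apply: ACloc_primitive_ae => //;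
     [by repeat (apply: measurable_funB || apply: measurable_funD || apply: measurable_funM
        || apply: measurableT_comp) => //|]).
  - apply: (aeS e1) => x; rewrite /qd1 /cder /=; have := p0 x.
    case: (u1 x) => c d; case: (u x) => a b /= p0x [-> _]; field; exact: lt0r_neq0.
  - apply: (aeS e1) => x; rewrite /qd1 /cder /=; have := p0 x.
    case: (u1 x) => c d; case: (u x) => a b /= p0x [_ ->]; field; exact: lt0r_neq0.
  - apply: (aeS e2) => x; rewrite /qd2 /cder pV /qW /=.
    case: (f x) => c' d'; case: (u1 x) => c d; case: (u x) => a b /= [-> _]; ring.
  - apply: (aeS e2) => x; rewrite /qd2 /cder pV /qW /=.
    case: (f x) => c' d'; case: (u1 x) => c d; case: (u x) => a b /= [_ ->]; ring.
split; first exact/cL2P. split; first exact/cL2P.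
split; first by split; [exact: primitive_AC a1|exact: primitive_AC a2].
exists (ofreim w); split; first by split; [exact: primitive_AC a3|exact: primitive_AC a4].
split.
  apply: (aeS (aeI (primitive_derive1 a1) (primitive_derive1 a2))) => x [].
  rewrite /qd1 /cder /ofreim /= => -> ->; case: (u x) => a b /=.
  by congr Complex; field; rewrite gt_eqF.
apply: (aeS (aeI (primitive_derive1 a3) (primitive_derive1 a4))) => x [].
rewrite /qd2 /cder /ofreim /= pV => -> ->; case: (f x) => c' d'; case: (u x) => a b /=.
by congr Complex; rewrite /qW; ring.
Qed.

Lemma L00P u f : L00 p Q r s u f <-> L00v p Q r s (reim u) (reim f).
Proof.
split=> [[/LmaxP Lu [a [b ab]]]|[/LmaxP Lu [a [b ab]]]]; split => //; exists a, b => x /ab.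
  by move=> /= ->.
by rewrite /=; case: (u x) => c d /= [-> ->].
Qed.

End Operators.

Lemma L2_cmulI w : L2 setT w -> L2 setT (cmulI w).
Proof.
move=> [m1 m2 i1 i2]; split => //=; first exact: measurableT_comp.
by under eq_fun do rewrite sqrrN.
Qed.

Lemma Lmaxv_cmulI (p Q r s : R -> R) w k :
  Lmaxv p Q r s w k -> Lmaxv p Q r s (cmulI w) (cmulI k).
Proof.
move=> [Lw Lk [w1 q]]; split; [exact: L2_cmulI|exact: L2_cmulI|].
by exists (cmulI w1); exact: qsol_cmulI.
Qed.

End ComplexTransfer.

(** * Adjoints and closure of the preminimal operator *)

Section Adjoints.
Context {R : realType}.
Local Notation mu := (@lebesgue_measure R).
Variables (p Q r s : R -> R) (gamma : R).
Hypotheses (ACp : ACloc p) (dp2 : L2loc (derive1 p)) (p0 : forall x, 0 < p x)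
 (intN : (\int[mu]_(x in `]-oo, (0%R : R)]) ((Num.sqrt (p x))^-1)%:E = +oo)%E)
 (intP : (\int[mu]_(x in `[(0%R : R), +oo[) ((Num.sqrt (p x))^-1)%:E = +oo)%E)
 (lp : locint (fun x => (p x)^-1)) (lQ : locint (fun x => Q x / p x))
 (lr : locint (fun x => r x / p x)) (lW : locint (qW p Q r s)) (lQ2 : locL2 Q)
 (mQ : measurable_fun setT Q) (mr : measurable_fun setT r) (ms : measurable_fun setT s)
 (bounded_below : forall u f, L00 p Q r s u f -> (gamma * norm2 u)%:C <= inner f u).
Local Notation Lmax := (Lmax p Q r s).
Local Notation L00 := (L00 p Q r s).
Local Notation Lmaxv := (Lmaxv p Q r s).
Local Notation L00v := (L00v p Q r s).
Local Notation B := (ip (setT : set R)).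
Implicit Types (u v f g h : R -> R[i]).

Let mT : measurable (setT : set R). Proof. by []. Qed.

Let LmaxE u f : Lmax u f <-> Lmaxv (reim u) (reim f) := LmaxP lp.1 mQ mr ms p0 u f.
Let L00E u f : L00 u f <-> L00v (reim u) (reim f) := L00P lp.1 mQ mr ms p0 u f.

Let ofreimK (w : cfun (R := R)) : reim (ofreim w) = w. Proof. by case: w. Qed.

Let semibounded (g h : cfun) : L00v g h -> gamma * B g g <= B h g.
Proof.
move=> Lg; have /bounded_below : L00 (ofreim g) (ofreim h) by apply/L00E; rewrite !ofreimK.
by rewrite lecE innerE norm2E !ofreimK => /andP[_].
Qed.

Lemma inner_symmetric u f g h :
  Lmaxv (reim u) (reim f) -> (forall w k, Lmaxv w k -> B (reim h) w = B (reim g) k) ->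
  inner h u = inner g f.
Proof.
by move=> Lu H; rewrite !innerE (H _ _ Lu) (H _ _ (Lmaxv_cmulI Lu)).
Qed.

Lemma weak_regularity u f : cL2 u -> cL2 f ->
  (forall w k, L00v w k -> B k (reim u) = B w (reim f)) ->
  exists v, Lmax v f /\ {ae mu, forall x, u x = v x}.
Proof.
move=> /cL2P Lu /cL2P Lf H; have [y [Ly uy]] := regularity lp lQ lr lW p0 Lu Lf H.
by exists (ofreim y); split; [apply/LmaxE|apply/reim_aeE]; rewrite ofreimK.
Qed.

Lemma adjoint_L00_regularity u f : adjoint L00 u f ->
  exists v, Lmax v f /\ {ae mu, forall x, u x = v x}.
Proof.
move=> [cu [cf H]]; apply: weak_regularity => // w k Lw.
have /H : L00 (ofreim w) (ofreim k) by apply/L00E; rewrite !ofreimK.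
by rewrite !innerE !ofreimK => -[].
Qed.

Lemma Lmax_sub_adjoint_L00 u f : Lmax u f -> adjoint L00 u f.
Proof.
move=> Lu; have [cu [cf _]] := Lu; split => //; split => // g h /L00E Lg.
apply: (inner_symmetric ((LmaxE _ _).1 Lu)) => w k Lw.
exact: (Lagrange_compact p0 Lw Lg).
Qed.

Lemma Lmax_sub_adjoint u f : Lmax u f -> adjoint Lmax u f.
Proof.
move=> Lu; have [cu [cf _]] := Lu; split => //; split => // g h /LmaxE Lg.
apply: (inner_symmetric ((LmaxE _ _).1 Lu)) => w k Lw.
exact: (Lmaxv_symmetric ACp dp2 p0 intN intP lp lQ lr lW lQ2 semibounded Lw Lg).
Qed.

Lemma adjointS (S T : (R -> R[i]) -> (R -> R[i]) -> Prop) u f :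
  (forall g h, S g h -> T g h) -> adjoint T u f -> adjoint S u f.
Proof. by move=> ST [cu [cf H]]; split => //; split => // g h /ST; exact: H. Qed.

Lemma L00_sub_closure u f : L00 u f -> closure_op L00 u f.
Proof.
move=> Lu; have [[cu [cf _]] _] := Lu; split => //; split => //.
exists (fun=> u), (fun=> f).
have c v : sh_cvg B (fun=> reim v) (reim v).
  move=> e e0; exists 0%N => n _; rewrite subrr /ip (_ : (fun x => _) = fun=> 0).
    by rewrite Rintegral_cst ?mul0r.
  by apply/funext => x /=; rewrite !mul0r addr0.
by split => //; split; apply/cvg_norm2; exact: c.
Qed.

(** Lagrange's formula against a compactly supported test pair passes to the limit, so a pair in the
    closure satisfies the weak equation. *)
Lemma closure_L00_regularity u f : closure_op L00 u f ->
  exists v, Lmax v f /\ {ae mu, forall x, u x = v x}.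
Proof.
move=> [cu [cf [un [fn [Ln [/cvg_norm2 cvu /cvg_norm2 cvf]]]]]].
have Lu := (cL2P _).1 cu; have Lf := (cL2P _).1 cf.
apply: weak_regularity => // k l Lk; have [[Dk Dl _] _] := Lk; rewrite ipC [RHS]ipC.
have Lvn n := (L00E _ _).1 (Ln n).
apply: (sh_cvg_symmetry _ _ Lf Lu Dl Dk cvf cvu) => n.
- by have [[]] := Lvn n.
- by have [[]] := Lvn n.
- by rewrite ipC [RHS]ipC; exact: (Lagrange_compact p0 (Lvn n).1 Lk).
Qed.

Lemma inner_aer h u v : cL2 h -> cL2 u -> cL2 v -> {ae mu, forall x, u x = v x} ->
  inner h u = inner h v.
Proof.
move=> /cL2P Lh /cL2P Lu /cL2P Lv /reim_aeE uv.
rewrite !innerE; congr Complex; rewrite ipC [RHS]ipC; apply: ae_eq_ip => //.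
- by apply: (aeS uv).
- by apply: (aeS uv) => x [/= -> ->].
- exact: L2_cmulI.
- exact: L2_cmulI.
Qed.

Lemma inner_ael u v h : cL2 u -> cL2 v -> cL2 h -> {ae mu, forall x, u x = v x} ->
  inner u h = inner v h.
Proof.
move=> /cL2P Lu /cL2P Lv /cL2P Lh /reim_aeE uv.
rewrite !innerE; congr Complex; apply: ae_eq_ip => //.
- by apply: (aeS uv).
- by apply: (aeS uv).
- exact: L2_cmulI.
Qed.

(** Both pairs are moved to representatives in Dom L, where L is symmetric; inner products do not
    see the change. *)
Lemma closure_L00_sub_adjoint u f : closure_op L00 u f -> adjoint (closure_op L00) u f.
Proof.
move=> cu; have [Lu [Lf _]] := cu; split => //; split => // g h cg.
have [Lg [Lh _]] := cg.
have [v [Lv uv]] := closure_L00_regularity cu.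
have [k [Lk gk]] := closure_L00_regularity cg.
have [cv _] := Lv; have [ck _] := Lk.
rewrite (inner_aer Lh Lu cv uv) (inner_ael Lg ck Lf gk).
by have [_ [_ H]] := Lmax_sub_adjoint Lv; exact: H.
Qed.

Lemma Lmax_sub_closure u f : Lmax u f -> closure_op L00 u f.
Proof.
move=> Lu; have [cu [cf _]] := Lu; split => //; split => //.
have [un [fn [Ln cvu cvf]]] :=
  Lmaxv_approx ACp dp2 p0 intN intP lp lQ lr lW lQ2 semibounded ((LmaxE _ _).1 Lu).
exists (fun n => ofreim (un n)), (fun n => ofreim (fn n)); split.
  by move=> n; apply/L00E; rewrite !ofreimK.
have E (w : nat -> cfun (R := R)) : (fun n => reim (ofreim (w n))) = w.
  by apply/funext => n; rewrite ofreimK.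
by split; apply/cvg_norm2; rewrite E.
Qed.

End Adjoints.

Theorem theorem1 (R : realType) (p Q r s : R -> R) :
  standingA p Q r s ->
  (* (i) p in W^1_{2,loc}(R) and p > 0 *)
  ACloc p -> L2loc (derive1 p) -> (forall x, 0 < p x) ->
  (* (ii) *)
  (\int[@lebesgue_measure R]_(x in `]-oo, (0%R : R)]) ((Num.sqrt (p x))^-1)%:E = +oo)%E ->
  (\int[@lebesgue_measure R]_(x in `[(0%R : R), +oo[) ((Num.sqrt (p x))^-1)%:E = +oo)%E ->
  (* L00 bounded from below *)
  (exists gamma : R, forall u f, L00 p Q r s u f ->
      (gamma * norm2 u)%:C <= inner f u) ->
  ess_self_adjoint (L00 p Q r s) /\
  op_eq (adjoint (L00 p Q r s)) (Lmax p Q r s) /\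
  op_eq (Lmax p Q r s) (adjoint (Lmax p Q r s)).
Proof.
move=> SA ACp dp2 p0 intN intP [gamma bb].
have [lp lQ lr lW lQ2] := standingA_locint SA ACp p0; have [mp mQ mr ms _] := SA.
have aer f : {ae (@lebesgue_measure R), forall x, f x = f x :> R[i]} by exact: aeW.
have reg := adjoint_L00_regularity p0 lp lQ lr lW mQ mr ms.
have sub := Lmax_sub_adjoint ACp dp2 p0 intN intP lp lQ lr lW lQ2 mQ mr ms bb.
have dense := Lmax_sub_closure ACp dp2 p0 intN intP lp lQ lr lW lQ2 mQ mr ms bb.
(* In each of the three equalities one inclusion holds with the same pair, while the other passes
   through regularity and changes the representative of [u]. *)
split; [|split]; split=> u f Tu.
- exists u, f; split; last by split; exact: aer.
  exact: (closure_L00_sub_adjoint ACp dp2 p0 intN intP lp lQ lr lW lQ2 mQ mr ms bb Tu).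
(* Extending an operator shrinks its adjoint, so the adjoint of the closure lies in that of L00,
   where regularity applies. *)
- have /reg[v [Lv uv]] : adjoint (L00 p Q r s) u f.
    by apply: (adjointS _ Tu); exact: L00_sub_closure.
  by exists v, f; split; [exact: dense|split].
- by have [v [Lv uv]] := reg _ _ Tu; exists v, f; split; [|split].
- exists u, f; split; last by split; exact: aer.
  exact: (Lmax_sub_adjoint_L00 p0 lp mQ mr ms Tu).
- by exists u, f; split; [exact: sub|split; exact: aer].
- have /reg[v [Lv uv]] : adjoint (L00 p Q r s) u f.
    by apply: (adjointS _ Tu) => g h [].
  by exists v, f; split; [|split].
Qed.
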